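(* Let $d\geq 3$ be an integer. \begin{enumerate} \item There is a connected finite graph on $2\binom{3d+1}{d}$ vertices that is locally $K(2d+1,d)$. \item Let $|\Omega|=3d+1$, let $A\subseteq\Omega$, and put $a'=\min(|A|,3d+1-|A|)$. The local-neighborhood-preserving, loopless, type-invariant (with respect to the fixed block $A$) binary voltages on the fixed labeled graph $K(3d+1,d)$ (vertices the $d$-subsets of $\Omega$), modulo gauge, form an $\mathbb F_2$-vector space of dimension \[ [q^{a'-5}]\binom{d}{3}_q . \] This space has canonical coordinates (in the sense made precise in the context) indexed by the integer triples $(k,i,j)$ with $0\leq k<i<j\leq d-1$ and $k+i+j=a'-2$. \item If $2d+2\leq n\leq 3d$ and $A$ is any fixed subset of an $(n+d)$-point set, then every loopless type-invariant (with respect to $A$) local-neighborhood-preserving binary voltage on $K(n+d,d)$ is gauge equivalent to zero. \item There are exactly $2^{42}$ fixed-base gauge classes of local-neighborhood-preserving binary voltage assignments on the fixed labeled base $K(10,3)$ (with no type-invariance imposed). They are parametrized by $H^1(M_3(10);\mathbb F_2)$, via $\alpha\mapsto[\alpha]$, and this space has dimension $42$. Only the zero class has a disconnected lift. \item The induced $S_{10}$-action on the classes of item 4 (base relabeling) has exactly $1{,}245{,}395$ orbits, of which exactly $1{,}245{,}394$ consist of classes with connected lifts. \item Let $\Omega=\{0,\dots,9\}$, $A_0=\{0,1,2,3,4\}$ and let $\alpha_{A_0}$ be the binary voltage on $K(10,3)$ with $\alpha_{A_0}(\{S,T\})=1$ if and only if $\{|S\cap A_0|,|T\cap A_0|\}\in\{\{0,1\},\{1,3\}\}$.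 The fixed-base gauge class of the $240$-vertex cover defined by $\alpha_{A_0}$ has $S_{10}$-orbit of size $126$ and stabilizer isomorphic to $S_5\wr C_2$. \end{enumerate}
   Context: Graphs are simple. $K(n,d)$ is the Kneser graph: vertices are the $d$-subsets of an $n$-set, adjacent iff disjoint. A graph is locally $L$ if the subgraph induced on every open neighborhood is isomorphic to $L$. Binary voltages. For a connected simple graph $G$, a binary voltage is a function $\alpha:E(G)\to\mathbb F_2$ on unoriented edges. Its lift $\widetilde G_\alpha$ has vertex set $V(G)\times\mathbb F_2$, with $(u,\epsilon)$ adjacent to $(v,\eta)$ iff $uv\in E(G)$ and $\eta=\epsilon+\alpha(uv)$; the projection is $p(v,\epsilon)=v$. The voltage $\alpha$ is local-neighborhood-preserving if, for every vertex $(x,i)$ of $\widetilde G_\alpha$, $p$ restricts to an isomorphism from the graph induced on the open neighborhood of $(x,i)$ to the graph induced on the open neighborhood of $x$ in $G$. Two voltages are (fixed-base) gauge equivalent if they differ by a coboundary $(\delta f)(uv)=f(u)+f(v)$ with $f:V(G)\to\mathbb F_2$. Type-invariant voltages. Let $G$ be the Kneser graph on the $d$-subsets of a set $\Omega$ and fix a block $A\subseteq\Omega$. The type of a vertex $S$ is $t(S)=|S\cap A|$. A voltage $\alpha$ is type-invariant if $\alpha(ST)$ depends only on the unordered pair of types of $S,T$, and loopless if $\alpha(ST)=0$ whenever $t(S)=t(T)$. Gauge equivalence of loopless type-invariant voltages means that they differ by a type switching, i.e. by a voltage of the form $ST\mapsto s(t(S))+s(t(T))$, where $s$ is an $\mathbb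 F_2$-valued function on the set of types. Coefficients. $\binom{d}{3}_q$ is the Gaussian binomial coefficient; $[q^m]f(q)$ is the coefficient of $q^m$ in $f(q)$, with $[q^m]f(q)=0$ for $m<0$. Canonical coordinates in item 2. Let $A'=A$ if $|A|\le(3d+1)/2$ and $A'=\Omega\setminus A$ otherwise, so $|A'|=a'$, and compute types with respect to $A'$ (passing to the complement replaces type $i$ by $d-i$). Write $ij$ for the pair $\{i,j\}$, put $u=\min(d,a')$, $L=\max(0,a'-d-1)$, and let $T=\{0j:1\le j\le u\}$ if $L=0$, and $T=\{0j:L\le j\le d\}\cup\{id:1\le i<L\}$ if $L>0$. Each gauge class contains exactly one voltage that vanishes on all edges whose type pair lies in $T$; the coordinate of the class at the triple $(k,i,j)$ is the value of this representative on edges with type pair $\{i,j\}$. The assertion that these are coordinates means that the resulting linear map from the space of classes to the space of $\mathbb F_2$-valued functions on the set of triples is an isomorphism. Matching complex. $M_3(10)$ is the clique complex of $K(10,3)$ (simplices are collections of pairwise disjoint $3$-subsets of a $10$-set). $H^1(M_3(10);\mathbb F_2)=\ker\delta^1/\operatorname{im}\delta^0$ is simplicial cohomology; voltages on $K(10,3)$ are simplicial $1$-cochains. $S_{10}$ acts on voltages by $(g\alpha)(\{S,T\})=\alpha(\{g^{-1}S,g^{-1}T\})$ and hence on gauge classes. $S_5\wr C_2=(S_5\times S_5)\rtimes C_2$, with $C_2$ swapping the factors. *)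

(* Defs.v *)
From HB Require Import structures.
From mathcomp Require Import all_boot all_order all_algebra all_fingroup all_solvable.
From mathcomp Require Import generic_quotient ring_quotient.

Set Implicit Arguments.
Unset Strict Implicit.
Unset Printing Implicit Defensive.

Import GRing.Theory.
Local Open Scope ring_scope.
Local Open Scope quotient_scope.

Section QuotientSpace.
Variables (K : fieldType) (V : vectType K) (U : {vspace V}).

Definition vquot : Type := Quotient.quot (pred_of_vspace U : zmodClosed V).

HB.instance Definition _ := GRing.Zmodule.on vquot.
HB.instance Definition _ : EqQuotient V (Quotient.equiv _) vquot :=
  EqQuotient.on vquot.

Definition vclass (x : V) : vquot := \pi_vquot x.

Lemma vclassK (q : vquot) : vclass (repr q) = q.
Proof. exact: reprK. Qed.

Lemma eq_vclass x y : (vclass x = vclass y) <-> (x - y \in U).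
Proof.
by rewrite (Quotient.idealrBE (pred_of_vspace U : zmodClosed V)); split=> /eqP.
Qed.

Lemma vclassD : {morph vclass : x y / x + y}.
Proof. exact: Quotient.pi_add. Qed.

Definition vquot_scale (a : K) (q : vquot) : vquot := vclass (a *: repr q).

Lemma vclassZ a x : vclass (a *: x) = vquot_scale a (vclass x).
Proof.
apply/eq_vclass; rewrite -scalerBr memvZ //.
by apply/eq_vclass; rewrite vclassK.
Qed.

Fact vquot_scaleA a b q : vquot_scale a (vquot_scale b q) = vquot_scale (a * b) q.
Proof. by rewrite -(vclassK q) -!vclassZ scalerA. Qed.
Fact vquot_scale1 : left_id 1 vquot_scale.
Proof. by move=> q; rewrite -(vclassK q) -!vclassZ scale1r. Qed.
Fact vquot_scaleDr : right_distributive vquot_scale +%R.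
Proof.
move=> a q r; rewrite -(vclassK q) -(vclassK r).
by rewrite -vclassD -!vclassZ scalerDr vclassD.
Qed.
Fact vquot_scaleDl q : {morph vquot_scale^~ q : a b / a + b}.
Proof.
by move=> a b; rewrite -(vclassK q) -!vclassZ scalerDl vclassD.
Qed.

HB.instance Definition _ := GRing.Zmodule_isLmodule.Build K vquot
  vquot_scaleA vquot_scale1 vquot_scaleDr vquot_scaleDl.

Fact vclass_is_linear : linear vclass.
Proof. by move=> a x y; rewrite vclassD vclassZ. Qed.
HB.instance Definition _ := GRing.isSemilinear.Build K V vquot _ vclass
  (GRing.semilinear_linear vclass_is_linear).

Let compl_part (q : vquot) : subvs_of U^C :=
  Subvs (memv_projC U (repr q)).

Let compl_partE x : vsval (compl_part (vclass x)) = x - projv U x.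
Proof.
have /eq_vclass h : vclass (repr (vclass x)) = vclass x by exact: vclassK.
apply/eqP; rewrite /= -subr_eq0 opprD addrACA -opprD -linearB /=.
by rewrite (projv_id h) subrr.
Qed.

Fact vquot_vect_iso : Vector.axiom (\dim U^C) vquot.
Proof.
have [f f_lin f_bij] := subvs_vect_iso U^C.
exists (fun q => f (compl_part q)).
  move=> a q r; rewrite -f_lin; congr f; apply: val_inj.
  rewrite -(vclassK q) -(vclassK r) -(vclass_is_linear a).
  rewrite -[LHS]/(vsval (compl_part _)) compl_partE.
  rewrite -[RHS]/(a *: vsval (compl_part _) + vsval (compl_part _)) !compl_partE.
  by rewrite linearP /= scalerBr opprD addrACA.
have [g fK gK] := f_bij; exists (fun w => vclass (vsval (g w))) => [q|w].
  rewrite fK -[RHS]vclassK; apply/eq_vclass.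
  by rewrite /= addrAC subrr add0r rpredN memv_proj.
rewrite -[RHS]gK; congr f; apply: val_inj.
rewrite -[LHS]/(vsval (compl_part _)) compl_partE.
apply/eqP; rewrite subr_eq -subr_eq0 opprD addrA subrr add0r.
rewrite oppr_eq0 -memv0 -(capv_compl U) memv_cap memv_proj /=.
by rewrite -[projv U _](subKr (vsval (g w))) rpredB ?memv_projC ?subvsP.
Qed.
HB.instance Definition _ := Lmodule_hasFinDim.Build K vquot vquot_vect_iso.

End QuotientSpace.

(* The subquotient Z / (B :&: Z); this is Z / B when B <= Z. *)
Section SubQuotient.
Variables (K : fieldType) (V : vectType K) (Z B : {vspace V}).

Definition subquot : vectType K :=
  vquot (linfun (vsval : subvs_of Z -> V) @^-1: B)%VS.

Definition subclass (z : subvs_of Z) : subquot := vclass _ z.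

Lemma eq_subclass z1 z2 :
  (subclass z1 = subclass z2) <-> (vsval z1 - vsval z2 \in B).
Proof.
apply: (iff_trans (eq_vclass _ _ _)).
by rewrite -memv_preim lfunE.
Qed.

End SubQuotient.

Record sgraph := SGraph {
  vertex :> finType;
  adj : rel vertex;
  adj_sym : symmetric adj;
  adj_irr : irreflexive adj }.
Arguments adj {s}.

Definition nbhd (G : sgraph) (x : G) : {set G} := [set y | adj x y].

Definition connected_graph (G : sgraph) : bool :=
  (0 < #|G|)%N && [forall x : G, forall y : G, connect adj x y].

Definition graph_iso (G H : sgraph) : Prop :=
  exists2 f : G -> H, bijective f & forall x y, adj (f x) (f y) = adj x y.

Section Induced.
Variables (G : sgraph) (A : {set G}).
Definition induced_adj : rel {x : G | x \in A} := fun x y => adj (val x) (val y).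
Fact induced_sym : symmetric induced_adj.
Proof. by move=> x y; apply: adj_sym. Qed.
Fact induced_irr : irreflexive induced_adj.
Proof. by move=> x; apply: adj_irr. Qed.
Definition induced : sgraph := SGraph induced_sym induced_irr.
End Induced.

Definition locally (L G : sgraph) : Prop :=
  forall x : G, graph_iso (induced (nbhd x)) L.

Definition restricts_to_iso (G H : sgraph) (f : G -> H)
    (A : {set G}) (B : {set H}) : bool :=
  [&& dinjectiveb f (mem A), f @: A == B
    & [forall x in A, forall y in A, adj (f x) (f y) == adj x y]].

Section Kneser.
Variables (T : finType) (d : nat).
Definition kneser_vertex : finType := {S : {set T} | #|S| == d}.
(* The condition S != S' only matters for the single vertex set0 of d = 0. *)
Definition kneser_adj : rel kneser_vertex :=
  fun S S' => (S != S') && [disjoint val S & val S'].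
Fact kneser_sym : symmetric kneser_adj.
Proof. by move=> S S'; rewrite /kneser_adj eq_sym disjoint_sym. Qed.
Fact kneser_irr : irreflexive kneser_adj.
Proof. by move=> S; rewrite /kneser_adj eqxx. Qed.
Definition kneser : sgraph := SGraph kneser_sym kneser_irr.
End Kneser.

Section Cochains.
Variable G : sgraph.

Definition is_clique (s : {set G}) : bool :=
  [forall x in s, forall y in s, (x != y) ==> adj x y].

Definition simplex (p : nat) : finType :=
  {s : {set G} | (#|s| == p.+1) && is_clique s}.

Definition cochain (p : nat) : Type := {ffun simplex p -> ('F_2)^o}.
HB.instance Definition _ p := Finite.on (cochain p).
HB.instance Definition _ p := Vector.on (cochain p).

(* Extension of a cochain by 0 to all vertex sets. *)
Definition cochain_at p (f : cochain p) (s : {set G}) : ('F_2)^o :=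
  if insub s is Some x then f x else 0.

Definition delta p (f : cochain p) : cochain p.+1 :=
  [ffun s : simplex p.+1 => \sum_(x in val s) cochain_at f (val s :\ x)].

Fact delta_is_linear p : linear (@delta p).
Proof.
move=> a f g; apply/ffunP => s; rewrite !ffunE scaler_sumr -big_split /=.
apply: eq_bigr => x _; rewrite /cochain_at; case: insubP => [u _ _|_].
  by rewrite !ffunE.
by rewrite scaler0 addr0.
Qed.
HB.instance Definition _ p := GRing.isSemilinear.Build 'F_2
  (cochain p) (cochain p.+1) _ (@delta p)
  (GRing.semilinear_linear (@delta_is_linear p)).

Definition cocycles1 : {vspace cochain 1} := lker (linfun (@delta 1)).
Definition coboundaries1 : {vspace cochain 1} := limg (linfun (@delta 0)).
Definition H1 : vectType 'F_2 := subquot cocycles1 coboundaries1.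

End Cochains.

Section Voltages.
Variable G : sgraph.

(* An unoriented edge is a 1-simplex, i.e. a 2-element set of adjacent vertices. *)
Definition voltage : Type := cochain G 1.

Definition volt (alpha : voltage) (u v : G) : 'F_2 :=
  cochain_at alpha [set u; v].

Section Lift.
Variable alpha : voltage.
Definition lift_adj : rel (G * 'F_2) :=
  fun x y => adj x.1 y.1 && (y.2 == x.2 + volt alpha x.1 y.1).
Fact lift_sym : symmetric lift_adj.
Proof.
move=> x y; rewrite /lift_adj adj_sym /volt setUC.
congr (_ && _); rewrite [RHS]eq_sym -subr_eq; congr (_ == _); congr (_ + _).
by case: (cochain_at _ _) => -[|[|//]] i; apply: val_inj.
Qed.
Fact lift_irr : irreflexive lift_adj.
Proof. by move=> x; rewrite /lift_adj adj_irr. Qed.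
Definition lift_graph : sgraph := SGraph lift_sym lift_irr.
Definition lift_proj (x : lift_graph) : G := x.1.

Definition local_nbhd_preserving : bool :=
  [forall x : lift_graph, restricts_to_iso lift_proj (nbhd x) (nbhd (lift_proj x))].
End Lift.

(* On an edge e = uv the sum is f(u) + f(v). *)
Definition coboundary (f : {ffun G -> 'F_2}) : voltage :=
  [ffun e : simplex G 1 => \sum_(u in val e) f u].

Definition gauge_equiv (alpha beta : voltage) : bool :=
  [exists f : {ffun G -> 'F_2}, beta - alpha == coboundary f].

Definition gauge_class (alpha : voltage) : {set voltage} :=
  [set beta | gauge_equiv alpha beta].

Definition gauge_classes : {set {set voltage}} :=
  [set gauge_class alpha | alpha in [set a | local_nbhd_preserving a]].

End Voltages.

Section Types.
Variables (T : finType) (d : nat) (A : {set T}).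
Local Notation K := (kneser T d).
Implicit Types (S : K) (alpha : voltage K).

Definition vtype S : nat := #|val S :&: A|.

(* Equality of unordered pairs, with i = j allowed. *)
Definition has_types S S' (i j : nat) : bool :=
  perm_eq [:: vtype S; vtype S'] [:: i; j].

Definition type_invariant alpha : Prop :=
  forall S1 S2 S3 S4, adj S1 S2 -> adj S3 S4 ->
    has_types S1 S2 (vtype S3) (vtype S4) -> volt alpha S1 S2 = volt alpha S3 S4.

Definition loopless alpha : Prop :=
  forall S S', adj S S' -> vtype S = vtype S' -> volt alpha S S' = 0.

Definition type_switching alpha : Prop :=
  exists s : nat -> 'F_2, forall S S', adj S S' ->
    volt alpha S S' = s (vtype S) + s (vtype S').

Definition type_gauge_equiv alpha beta : Prop := type_switching (beta - alpha).

Definition vanishes_on (P : nat -> nat -> bool) alpha : Prop :=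
  forall S S' i j, adj S S' -> P i j -> has_types S S' i j -> volt alpha S S' = 0.

End Types.

(* Each pair is listed with its smaller element first; a - d - 1 is truncated. *)
Definition tree_pair (d a i j : nat) : bool :=
  let u := minn d a in
  let L := (a - d - 1)%N in
  if L == 0%N then (i == 0%N) && (1 <= j <= u)%N
  else (i == 0%N) && (L <= j <= d)%N || (1 <= i < L)%N && (j == d).

(* (k, i, j) with k + i + j = a - 2, stated without truncated subtraction. *)
Definition triple (d a : nat) : finType :=
  {t : 'I_d * 'I_d * 'I_d |
    (t.1.1 < t.1.2)%N && (t.1.2 < t.2)%N && (t.1.1 + t.1.2 + t.2 + 2 == a)%N}.
Definition triple_i d a (t : triple d a) : nat := (val t).1.2.
Definition triple_j d a (t : triple d a) : nat := (val t).2.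

(* The quotient of polynomials is exact. *)
Definition gauss_binomial (n k : nat) : {poly rat} :=
  (\prod_(i < k) (1 - 'X^(n - i))) %/ (\prod_(i < k) (1 - 'X^(i.+1))).

Definition coefz (p : {poly rat}) (m : int) : rat :=
  if m is Posz n then p`_n else 0.

Section Relabel.
Variables (T : finType) (d : nat).
Local Notation K := (kneser T d).

Fact relabel_vertex_subproof (g : {perm T}) (S : K) : #|g @: val S| == d.
Proof. by rewrite card_imset ?(valP S) //; apply: perm_inj. Qed.
Definition relabel_vertex (g : {perm T}) (S : K) : K :=
  exist _ (g @: val S) (relabel_vertex_subproof g S).

(* (g alpha)({S, S'}) = alpha({g^-1 S, g^-1 S'}). In MathComp permutations
   compose from left to right, so this is a right action. *)
Definition relabel (alpha : voltage K) (g : {perm T}) : voltage K :=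
  [ffun e : simplex K 1 => cochain_at alpha (relabel_vertex g^-1 @: val e)].

Lemma relabel_vertex1 S : relabel_vertex 1 S = S.
Proof.
by apply: val_inj; rewrite /= (eq_imset _ (@perm1 T)) imset_id.
Qed.

Lemma relabel_vertexM g h S :
  relabel_vertex (g * h) S = relabel_vertex h (relabel_vertex g S).
Proof.
by apply: val_inj; rewrite /= -imset_comp; apply: eq_imset => x; rewrite permM.
Qed.

Lemma relabel_vertex_inj g : injective (relabel_vertex g).
Proof.
move=> S S' /(congr1 (relabel_vertex g^-1)).
by rewrite -!relabel_vertexM mulgV !relabel_vertex1.
Qed.

Lemma relabel_vertex_adj g S S' :
  adj (relabel_vertex g S) (relabel_vertex g S') = adj S S'.
Proof.
rewrite /adj /= /kneser_adj (inj_eq (@relabel_vertex_inj g)) /=.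
by rewrite imset_disjoint //; apply: perm_inj.
Qed.

Lemma relabel_simplex g (s : {set K}) :
  (#|s| == 2%N) && is_clique s ->
  (#|relabel_vertex g @: s| == 2%N) && is_clique (relabel_vertex g @: s).
Proof.
case/andP=> s2 /forall_inP s_cl; rewrite card_imset ?s2 /=; last first.
  exact: relabel_vertex_inj.
apply/forall_inP => _ /imsetP[x xs ->]; apply/forall_inP => _ /imsetP[y ys ->].
rewrite (inj_eq (@relabel_vertex_inj g)) relabel_vertex_adj.
by move/forall_inP: (s_cl x xs); apply.
Qed.

Fact relabel1 : relabel^~ 1%g =1 id.
Proof.
move=> alpha; apply/ffunP => e; rewrite ffunE invg1.
by rewrite (eq_imset _ relabel_vertex1) imset_id /cochain_at valK.
Qed.

Fact relabelM alpha : act_morph relabel alpha.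
Proof.
move=> g h; apply/ffunP => e; rewrite !ffunE invMg /cochain_at.
set s := relabel_vertex h^-1 @: val e.
have ss : (#|s| == 2%N) && is_clique s by apply: relabel_simplex; exact: (valP e).
rewrite (insubT (fun s : {set K} => (#|s| == 2%N) && is_clique s) ss) ffunE /cochain_at /=.
by rewrite /s -imset_comp (eq_imset _ (relabel_vertexM _ _)).
Qed.

Definition relabel_action : action [set: {perm T}] (voltage K) :=
  TotalAction relabel1 relabelM.

Definition class_action : action [set: {perm T}] {set voltage K} :=
  (relabel_action^*)%act.

End Relabel.

Section Wreath.
Variable gT : finGroupType.

Definition swap (x : gT * gT) (s : 'S_2) : gT * gT :=
  if odd_perm s then (x.2, x.1) else x.

Fact swap1 : swap^~ 1%g =1 id.
Proof. by move=> x; rewrite /swap odd_perm1. Qed.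
Fact swapM x : act_morph swap x.
Proof.
by move=> s t; rewrite /swap odd_permM; case: x; do 2!case: odd_perm.
Qed.
Definition swap_action : action [set: 'S_2] (gT * gT)%type :=
  TotalAction swap1 swapM.

Fact swap_is_groupAction : is_groupAction [set: gT * gT] swap_action.
Proof.
move=> s _; rewrite inE; apply/andP; split; first by apply/subsetP => x; rewrite !inE.
apply/morphicP => x y _ _; rewrite !actpermE /= /swap.
by case: odd_perm.
Qed.
Definition swap_groupAction : groupAction [set: 'S_2] [set: gT * gT] :=
  GroupAction swap_is_groupAction.

Definition wreath2 : finGroupType := sdprod_by swap_groupAction.

End Wreath.

Definition A0 : {set 'I_10} := [set i : 'I_10 | (i < 5)%N].

Definition alphaA0 : voltage (kneser 'I_10 3) :=
  [ffun e : simplex (kneser 'I_10 3) 1 =>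
    ([exists S, exists S', (val e == [set S; S']) &&
       (has_types A0 S S' 0 1 || has_types A0 S S' 1 3)])%:R].

(* Main.v *)
From Stdlib Require Import NArith.
Require Import Defs.
From HB Require Import structures.
From mathcomp Require Import all_boot all_order all_algebra all_fingroup all_solvable.
From mathcomp Require Import generic_quotient zify ring.

Set Implicit Arguments.
Unset Strict Implicit.
Unset Printing Implicit Defensive.

Import GRing.Theory.
Local Open Scope ring_scope.


(** A binary voltage preserves neighbourhoods exactly when it sums to zero around every
    triangle ([lnpP]); so, modulo gauge, these voltages are the first cohomology of the
    clique complex, and over a connected base the lift of a voltage is disconnected
    exactly when the voltage is a coboundary ([lift_connectedN]).

    Type-invariant voltages on a Kneser graph are functions [f] of two types.  Vertices
    of types [t], [t.+1] and [u], [u.+1] span squares whose edges carry [f t u],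
    [f t.+1 u], [f t u.+1], [f t.+1 u.+1]; the sum of these, the mixed difference, is the
    holonomy around the square.  If there are at least [3 * d + 2] points, there is such
    a square with a common neighbour and the holonomy is zero, which makes [f] a
    switching ([mixed_diff_large], [mixed0_switching]).  On [3 * d + 1] points with a
    block of size [a] no square has a common neighbour, and the square at [(t, u)] goes
    around a hole [(t, u, v)] with [t + u + v = a - 2].  The types next to the hole form
    an annulus of six triangles, so the holonomy is symmetric in the three entries and,
    by looplessness, zero when two of them agree ([curvature23], [curvature_diag]).  Conversely any such
    function [w] on holes is integrated by [rect_sum], the sum of [w] over a rectangle,
    which is loopless, satisfies the triangle condition and vanishes on the tree of type
    pairs ([rect_sum_triangle], [rect_sum_normalised]).  A normalised voltage is thus the
    rectangle sum of its holonomies ([rect_sum_curvature]), and its value at a triple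
    [k < i < j] is [w k i j] plus terms with a smaller least entry; this triangularity
    gives the coordinates ([normalised_inj], [coord_surj]).  The triples are counted by
    the generating function of the sums of 3-subsets of [0 .. d - 1], a shifted Gaussian
    binomial ([card_triple]).  For a block of five points the hole [(0, 1, 2)] carries a
    voltage that is not a coboundary; its lift is the connected locally Kneser graph
    ([exists_locally_kneser]).

    On K(10,3) every five-point set [A] gives the cocycle [omega A], equal to 1 on the
    edges with types 1 and 2.  The 42 sets [A] that are first rows of standard tableaux
    of shape (5,5) also give 42 four-cycles, and the matrix of holonomies of the former
    around the latter is invertible; so the cohomology has dimension at least 42.  It has
    no more: a cocycle is determined by its values on 161 edges, since the rule that two
    zero edges of a triangle force the third spreads from these edges to all
    ([free_edges_determine]), and the coboundaries have dimension 119.  The four-cycles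
    therefore detect the class of a cocycle ([mem_coboundaries_circs]).

    The orbits are counted as the average number of fixed classes.  In the basis above a
    permutation fixes a class when 42 linear equations hold, so its number of fixed
    classes is a power of two found by elimination ([fixed_lperm]).  One permutation for
    each partition of ten suffices: fixed points of powers separate the conjugacy
    classes, and upper bounds for the centralisers are sharp because the resulting class
    sizes already add up to [10!] ([sum_class_function], [sum_fixed]).

    The voltage [alphaA0] differs from [omega A0] by the coboundary of the indicator of
    type 1.  Since [omega A = omega (~: A)], its orbit consists of the classes of the 126
    splittings into two five-point sets, told apart by the four-cycles; and the wreath
    product, which preserves the splitting, has the order [10! / 126] of the stabiliser. *)
(** * Voltages as symmetric functions on adjacent pairs *)

Lemma addF2xx (x : 'F_2) : x + x = 0.
Proof. by case: x => -[|[|//]] i; apply: val_inj. Qed.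

Lemma oppF2 (x : 'F_2) : - x = x.
Proof. by apply/eqP; rewrite eq_sym -addr_eq0 addF2xx. Qed.

Lemma addF2_eq0 (x y : 'F_2) : (x + y == 0) = (x == y).
Proof. by rewrite addr_eq0 oppF2. Qed.

Lemma F2_neq0 (x : 'F_2) : x != 0 -> x = 1.
Proof. by case: x => -[|[|//]] i //= _; apply: val_inj. Qed.

Lemma F2_ind (P : 'F_2 -> Prop) : P 0 -> P 1 -> forall x, P x.
Proof.
by move=> P0 P1 x; have [->//|/F2_neq0->] := eqVneq x 0.
Qed.

(** Decides an identity between sums of the listed atoms by running over all their
    values; [ring] does not know that [2 = 0]. *)
Tactic Notation "f2" constr(x) := elim/F2_ind: x.
Ltac f2done := first [by vm_compute | by apply/eqP; vm_compute].

Section VoltTheory.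
Variable G : sgraph.
Implicit Types (alpha beta : voltage G) (x y z : G).

Lemma adj_neq x y : adj x y -> x != y.
Proof. by apply: contraTneq => ->; rewrite adj_irr. Qed.

Lemma edge_simplex x y : adj x y -> (#|[set x; y]| == 2%N) && is_clique [set x; y].
Proof.
move=> xy; rewrite cards2 (adj_neq xy) /=.
apply/forall_inP => u; rewrite !inE => /orP[] /eqP->;
  apply/forall_inP => v; rewrite !inE => /orP[] /eqP->;
  by rewrite ?eqxx ?xy ?(adj_sym y x) ?xy ?implybT.
Qed.

Lemma simplex1P (e : simplex G 1) : exists x y, adj x y /\ val e = [set x; y].
Proof.
have /andP[/cards2P[x [y [xNy e_xy]]] /forall_inP cl] := valP e.
exists x, y; split=> //.
have xe : x \in val e by rewrite e_xy set21.
have ye : y \in val e by rewrite e_xy set22.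
by have /forall_inP/(_ y ye) := cl x xe; rewrite xNy.
Qed.

Lemma voltC alpha x y : volt alpha x y = volt alpha y x.
Proof. by rewrite /volt setUC. Qed.

Lemma volt_simplex alpha (e : simplex G 1) x y :
  val e = [set x; y] -> volt alpha x y = alpha e.
Proof. by move=> exy; rewrite /volt /cochain_at -exy valK. Qed.

Lemma volt_edge alpha x y (xy : adj x y) :
  volt alpha x y = alpha (Sub [set x; y] (edge_simplex xy)).
Proof. by apply: volt_simplex; rewrite SubK. Qed.

Lemma eq_volt alpha beta :
  (forall x y, adj x y -> volt alpha x y = volt beta x y) -> alpha = beta.
Proof.
move=> eq_ab; apply/ffunP => e; have [x [y [xy e_xy]]] := simplex1P e.
by rewrite -!(volt_simplex _ e_xy) eq_ab.
Qed.

Lemma volt_is_linear x y : linear (fun alpha => volt alpha x y : ('F_2)^o).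
Proof.
move=> a alpha beta; rewrite /volt /cochain_at.
by case: insubP => [u _ _|_]; rewrite ?ffunE // scaler0 addr0.
Qed.

Lemma voltD alpha beta x y : volt (alpha + beta) x y = volt alpha x y + volt beta x y.
Proof. by have := volt_is_linear x y 1 alpha beta; rewrite !scale1r. Qed.

Lemma volt0 x y : volt (0 : voltage G) x y = 0.
Proof. by rewrite /volt /cochain_at; case: insubP => *; rewrite ?ffunE. Qed.

Lemma voltN alpha x y : volt (- alpha) x y = volt alpha x y.
Proof. by apply/eqP; rewrite -addF2_eq0 -voltD addNr volt0. Qed.

Lemma voltB alpha beta x y : volt (alpha - beta) x y = volt alpha x y + volt beta x y.
Proof. by rewrite voltD voltN. Qed.

Lemma voltZ a alpha x y : volt (a *: alpha) x y = a * volt alpha x y.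
Proof. by have := volt_is_linear x y a alpha 0; rewrite !addr0 volt0 addr0. Qed.

Lemma volt_sum (I : finType) (F : I -> voltage G) x y :
  volt (\sum_i F i) x y = \sum_i volt (F i) x y.
Proof.
by elim/big_rec2: _ => [|i a b _ <-]; rewrite ?volt0 ?voltD.
Qed.

(** The hypothesis of [volt_mkvolt] makes the choice of an ordering of the two
    ends of each edge irrelevant. *)
Definition mkvolt (h : G -> G -> 'F_2) : voltage G :=
  [ffun e : simplex G 1 =>
     (if [pick p : G * G | val e == [set p.1; p.2]] is Some p then h p.1 p.2 else 0)
       : ('F_2)^o].

Lemma set2_inj x y u v : [set x; y] = [set u; v] ->
  (x = u /\ y = v) \/ (x = v /\ y = u).
Proof.
move=> e; have := set21 x y; have := set22 x y; rewrite !e !inE.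
have := set21 u v; have := set22 u v; rewrite -!e !inE.
move=> /orP[]/eqP e1 /orP[]/eqP e2 /orP[]/eqP e3 /orP[]/eqP e4; intuition congruence.
Qed.

Lemma volt_mkvolt (h : G -> G -> 'F_2) : (forall x y, h x y = h y x) ->
  forall x y, adj x y -> volt (mkvolt h) x y = h x y.
Proof.
move=> hC x y xy; rewrite (volt_edge _ xy) ffunE /=.
case: pickP => [[u v] /= /eqP/set2_inj[[-> ->]|[-> ->]]|/(_ (x, y)) /=] //.
by rewrite eqxx.
Qed.

Lemma volt_coboundary (f : {ffun G -> 'F_2}) x y : adj x y ->
  volt (coboundary f) x y = f x + f y.
Proof.
move=> xy; rewrite (volt_edge _ xy) ffunE /= big_setU1 ?big_set1 //.
by rewrite inE (adj_neq xy).
Qed.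

Lemma eq_coboundary alpha (f : {ffun G -> 'F_2}) :
  (forall x y, adj x y -> volt alpha x y = f x + f y) -> alpha = coboundary f.
Proof. by move=> h; apply: eq_volt => x y xy; rewrite h ?volt_coboundary. Qed.

Definition cocycle alpha : Prop := forall x y z, adj x y -> adj y z -> adj x z ->
  volt alpha x y + volt alpha y z + volt alpha x z = 0.

Lemma cocycleD alpha beta : cocycle alpha -> cocycle beta -> cocycle (alpha + beta).
Proof.
move=> ca cb x y z xy yz xz; rewrite !voltD.
rewrite -[RHS](addr0 0) -{1}(ca x y z) // -(cb x y z) //; ring.
Qed.

Lemma cocycleZ a alpha : cocycle alpha -> cocycle (a *: alpha).
Proof. by move=> ca x y z xy yz xz; rewrite !voltZ -!mulrDr ca ?mulr0. Qed.

Lemma cocycle_coboundary (f : {ffun G -> 'F_2}) : cocycle (coboundary f).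
Proof.
move=> x y z xy yz xz; rewrite !volt_coboundary //.
f2 (f x); f2 (f y); f2 (f z); f2done.
Qed.

Lemma cocycle3 alpha x y z : cocycle alpha -> adj x y -> adj y z -> adj x z ->
  volt alpha x z = volt alpha x y + volt alpha y z.
Proof.
move=> ca xy yz xz; apply/eqP; rewrite eq_sym -addF2_eq0; apply/eqP; exact: ca.
Qed.

(** The neighbours of [(x, i)] in the lift are the [(y, i + alpha(xy))], and two of
    them are adjacent exactly when the triangle condition holds. *)
Lemma lnpP alpha : reflect (cocycle alpha) (local_nbhd_preserving alpha).
Proof.
have nbE (x y : lift_graph alpha) : (y \in nbhd x) =
    adj x.1 y.1 && (y.2 == x.2 + volt alpha x.1 y.1) by rewrite inE.
apply: (iffP forallP) => [lnp x y z xy yz xz | ca x].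
  have /and3P[_ _ /forall_inP H] := lnp (x, 0 : 'F_2).
  have inN u (xu : adj x u) :
      (u, volt alpha x u) \in nbhd ((x, 0 : 'F_2) : lift_graph alpha).
    by rewrite nbE /= xu add0r eqxx.
  have /forall_inP/(_ _ (inN z xz)) := H _ (inN y xy).
  rewrite /lift_proj [adj _ _]yz => /eqP/esym/andP[_ /eqP /= ->].
  by rewrite addF2xx.
apply/and3P; split.
- apply/dinjectiveP => -[u i] [v j]; rewrite !nbE /lift_proj /=.
  by move=> /andP[_ /eqP->] /andP[_ /eqP->] ->.
- apply/eqP/setP => y; apply/imsetP/idP => [[u]|].
    by rewrite nbE inE => /andP[xu _] ->.
  rewrite inE => xy; exists (y, x.2 + volt alpha x.1 y) => //.
  by rewrite nbE /= eqxx andbT.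
- apply/forall_inP => -[y i]; rewrite nbE /= => /andP[xy /eqP->].
  apply/forall_inP => -[z j]; rewrite nbE /= => /andP[xz /eqP->].
  rewrite /lift_proj /= /lift_adj /=; case yz: (adj y z) => //=.
  by rewrite (cocycle3 ca xy yz xz) addrA eqxx.
Qed.

Lemma cliqueP (s : {set G}) :
  reflect {in s &, forall x y, x != y -> adj x y} (is_clique s).
Proof.
apply: (iffP forall_inP) => [h x y xs ys | h x xs].
  by move/forall_inP: (h x xs) => /(_ y ys)/implyP.
by apply/forall_inP => y ys; apply/implyP; apply: h.
Qed.

Lemma set3D x y z : x != y -> y != z -> x != z ->
  [/\ [set x; y; z] :\ x = [set y; z], [set x; y; z] :\ y = [set x; z]
    & [set x; y; z] :\ z = [set x; y]].
Proof.
move=> xy yz xz; split; apply/setP => u; rewrite !inE.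
- by case: (eqVneq u x) => [->|]; rewrite ?(negPf xy) ?(negPf xz).
- case: (eqVneq u y) => [->|]; rewrite ?(negPf yz) ?orbF //.
  by rewrite eq_sym (negPf xy).
- case: (eqVneq u z) => [->|]; rewrite ?orbF //.
  by rewrite eq_sym (negPf xz) eq_sym (negPf yz).
Qed.

Lemma delta_triangle alpha (s : simplex G 2) x y z : x != y -> y != z -> x != z ->
  val s = [set x; y; z] ->
  delta alpha s = volt alpha x y + volt alpha y z + volt alpha x z.
Proof.
move=> xy yz xz sE; rewrite ffunE sE -setUA.
rewrite big_setU1 ?inE ?negb_or ?xy ?xz //= big_setU1 ?inE //= big_set1 setUA.
have [-> -> ->] := set3D xy yz xz.
by rewrite addrA addrC addrA.
Qed.

Lemma triangle_simplex x y z : adj x y -> adj y z -> adj x z ->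
  exists s : simplex G 2, val s = [set x; y; z].
Proof.
move=> xy yz xz; suff h : (#|[set x; y; z]| == 3%N) && is_clique [set x; y; z].
  by exists (exist (fun s : {set G} => (#|s| == 3%N) && is_clique s) _ h).
apply/andP; split.
  by rewrite -setUA cardsU1 cards2 !inE negb_or !adj_neq.
apply/cliqueP => u v; rewrite !inE -!orbA.
by do 2![case/or3P=> /eqP->]; rewrite ?eqxx ?xy ?yz ?xz // adj_sym ?xy ?yz ?xz.
Qed.

Lemma simplex2P (s : simplex G 2) :
  exists x y z, [/\ adj x y, adj y z, adj x z & val s = [set x; y; z]].
Proof.
have /andP[/eqP s3 /cliqueP cl] := valP s.
have [x xs] : exists x, x \in val s by apply/set0Pn; rewrite -card_gt0 s3.
have /cards2P[y [z [yz s'E]]] : #|val s :\ x| == 2%N.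
  by have := cardsD1 x (val s); rewrite xs s3 add1n => -[] <-.
have sE : val s = [set x; y; z] by rewrite -setUA -s'E setD1K.
have : y \in val s :\ x by rewrite s'E set21.
have : z \in val s :\ x by rewrite s'E set22.
rewrite !in_setD1 => /andP[zx zs] /andP[yx ys].
by exists x, y, z; split; rewrite // cl // eq_sym.
Qed.

(** Both sides run over the triangles of [G], the simplices of dimension 2. *)
Lemma mem_cocycles1 alpha : reflect (cocycle alpha) (alpha \in cocycles1 G).
Proof.
rewrite memv_ker lfunE /=; apply: (iffP eqP) => [da0 x y z xy yz xz | ca].
  have [s sE] := triangle_simplex xy yz xz.
  by rewrite -(@delta_triangle _ s) ?adj_neq // da0 ffunE.
apply/ffunP => s; have [x [y [z [xy yz xz sE]]]] := simplex2P s.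
by rewrite (delta_triangle _ _ _ _ sE) ?adj_neq // ca // ffunE.
Qed.

Lemma vertex_simplex x : exists s : simplex G 0, val s = [set x].
Proof.
suff h : (#|[set x]| == 1%N) && is_clique [set x].
  by exists (exist (fun s : {set G} => (#|s| == 1%N) && is_clique s) _ h).
rewrite cards1 eqxx; apply/cliqueP => u v /set1P-> /set1P->.
by rewrite eqxx.
Qed.

Lemma delta_vertices (f : cochain G 0) :
  delta f = coboundary [ffun x => cochain_at f [set x]].
Proof.
apply: eq_coboundary => x y xy; rewrite (volt_edge _ xy) !ffunE /=.
rewrite big_setU1 ?inE ?(adj_neq xy) //= big_set1 addrC.
have -> : [set x; y] :\ y = [set x].
  apply/setP => u; rewrite !inE; case: (eqVneq u y) => [->|]; rewrite ?orbF //.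
  by rewrite eq_sym (negPf (adj_neq xy)).
have -> // : [set x; y] :\ x = [set y].
apply/setP => u; rewrite !inE; case: (eqVneq u x) => [->|] //.
by rewrite (negPf (adj_neq xy)).
Qed.

Lemma mem_coboundaries1 alpha :
  reflect (exists f, alpha = coboundary f) (alpha \in coboundaries1 G).
Proof.
apply: (iffP memv_imgP) => [[f _ ->]|[f ->]].
  by rewrite lfunE /= delta_vertices; eexists.
exists [ffun s : simplex G 0 => \sum_(x in val s) f x]; first exact: memvf.
rewrite lfunE /= delta_vertices; congr coboundary; apply/ffunP => x.
have [s sE] := vertex_simplex x.
by rewrite ffunE -sE /cochain_at valK ffunE sE big_set1.
Qed.

End VoltTheory.

(** * Double covers *)

Section Lifts.
Variable G : sgraph.
Implicit Types (alpha : voltage G) (x y : G).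

Lemma lift_adjE alpha (u v : lift_graph alpha) :
  adj u v = adj u.1 v.1 && (v.2 == u.2 + volt alpha u.1 v.1).
Proof. by []. Qed.

Lemma connect_adj_sym (H : sgraph) : connect_sym (@adj H).
Proof. by apply: sym_connect_sym; apply: adj_sym. Qed.

Lemma mem_connect_closed (H : sgraph) (P : pred H) (u v : H) :
  (forall a b, adj a b -> P a -> P b) -> P u -> connect adj u v -> P v.
Proof.
move=> clP Pu uv; have cl : closed adj P.
  by move=> a b ab; apply/idP/idP; apply: clP; rewrite // adj_sym.
by have := closed_connect cl uv; rewrite !unfold_in => <-.
Qed.

Lemma card_lift alpha : #|lift_graph alpha| = (2 * #|G|)%N.
Proof. by rewrite card_prod card_ord mulnC. Qed.

Lemma coboundary_disconnected (f : {ffun G -> 'F_2}) :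
  ~~ connected_graph (lift_graph (coboundary f)).
Proof.
apply/negP => /andP[]; rewrite card_lift muln_gt0 /= => /card_gt0P[x _].
move/forallP/(_ (x, 0))/forallP/(_ (x, 1)).
pose P (u : lift_graph (coboundary f)) := u.2 + f u.1 == f x.
move/(@mem_connect_closed _ P); rewrite /P /= add0r eqxx => h.
suff: false by []; rewrite -[false]/((1 : 'F_2) == 0) -(addF2_eq0 _ 0) addr0.
have: 1 + f x == f x; last by rewrite -addF2_eq0 -addrA addF2xx.
apply: h => // -[a i] [b j] /andP[/= ab /eqP->] /eqP <-.
rewrite volt_coboundary //; f2 i; f2 (f a); f2 (f b); f2done.
Qed.

(** Translation of the fibre coordinate commutes with adjacency, so if one fibre
    meets the component of [(r, 0)] twice then all do; otherwise that component is
    the graph of a function whose coboundary is the voltage. *)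
Lemma disconnected_coboundary alpha : connected_graph G ->
  ~~ connected_graph (lift_graph alpha) -> exists f, alpha = coboundary f.
Proof.
case/andP=> /card_gt0P[r _] /forallP connG disc.
have symL := @connect_adj_sym (lift_graph alpha).
pose C : pred (lift_graph alpha) := connect adj ((r, 0) : lift_graph alpha).
have clC a b : adj a b -> C a -> C b.
  by move=> ab Ca; apply: connect_trans Ca (connect1 ab).
have deck (a b : lift_graph alpha) : connect adj a b ->
    connect adj ((a.1, a.2 + 1) : lift_graph alpha) (b.1, b.2 + 1).
  move=> ab; apply: (@mem_connect_closed (lift_graph alpha)
    (fun c => connect adj ((a.1, a.2 + 1) : lift_graph alpha) (c.1, c.2 + 1))) ab.
    move=> c c'; rewrite lift_adjE => /andP[cc' /eqP c2] ac.
    apply: connect_trans ac (connect1 _); rewrite lift_adjE /= cc' c2 /=.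
    by rewrite addrAC eqxx.
  exact: connect0.
have C_fibre x : exists i, C (x, i).
  have /forallP/(_ x) rx := connG r.
  apply/existsP; apply: (@mem_connect_closed G
    (fun y => [exists i, C (y, i)])) rx => [a b ab /existsP[i Ca]|].
    apply/existsP; exists (i + volt alpha a b); apply: clC Ca.
    by rewrite lift_adjE /= ab eqxx.
  by apply/existsP; exists 0; apply: connect0.
have C_uniq x : C (x, 0) -> C (x, 1) -> False.
  move=> C0 C1; case/negP: disc; apply/andP; split.
    by apply/card_gt0P; exists (r, 0).
  have Cr : C (r, 1).
    apply: connect_trans C1 _; rewrite symL.
    by have := deck _ _ C0; rewrite /= add0r.
  have allC u : C u.
    case: u => y j; have [i Ci] := C_fibre y.
    have [->//|] := eqVneq j i; rewrite -addF2_eq0 => /F2_neq0 ij.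
    have -> : j = i + 1 by rewrite -ij addrC -addrA addF2xx addr0.
    by apply: connect_trans Cr _; have := deck _ _ Ci; rewrite /= add0r.
  apply/forallP => u; apply/forallP => v.
  by apply: connect_trans (allC v); rewrite symL; apply: allC.
pose f := [ffun x => if C (x, 0) then 0 else 1 : 'F_2].
have Cf x i : C (x, i) -> f x = i.
  rewrite ffunE; move: i; apply: F2_ind => [->//|]; case: ifP => // C0 C1.
  by case: (C_uniq x).
exists f; apply: eq_coboundary => x y xy.
have [i Ci] := C_fibre x; rewrite (Cf _ _ Ci).
have Cj : C (y, i + volt alpha x y).
  by apply: clC Ci; rewrite lift_adjE /= xy eqxx.
by rewrite (Cf _ _ Cj) addrA addF2xx add0r.
Qed.

Lemma lift_connectedN alpha : connected_graph G ->
  ~~ connected_graph (lift_graph alpha) <-> exists f, alpha = coboundary f.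
Proof.
move=> cG; split=> [|[f ->]]; first exact: disconnected_coboundary.
exact: coboundary_disconnected.
Qed.

End Lifts.

Lemma graph_iso_trans (G H L : sgraph) : graph_iso G H -> graph_iso H L -> graph_iso G L.
Proof.
move=> [f fb fE] [g gb gE]; exists (g \o f); first exact: bij_comp.
by move=> x y; rewrite /= gE fE.
Qed.

Lemma restricts_graph_iso (G H : sgraph) (f : G -> H) (A : {set G}) (B : {set H}) :
  restricts_to_iso f A B -> graph_iso (induced A) (induced B).
Proof.
move=> /and3P[/dinjectiveP f_inj /eqP fA /forall_inP f_adj].
have fP (x : induced A) : f (val x) \in B by rewrite -fA imset_f // (valP x).
exists (fun x => exist _ (f (val x)) (fP x)); last first.
  move=> x y; apply/eqP; rewrite eq_sym.
  have /forall_inP/(_ _ (valP y)) := f_adj _ (valP x).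
  by rewrite eq_sym.
apply: inj_card_bij => [x y [] /f_inj eq_xy|].
  by apply: val_inj; apply: eq_xy; apply: valP.
rewrite !card_sig /= -fA; rewrite card_in_imset //.
Qed.

(** * Sums of symmetric functions in characteristic two *)

Section SymmetricSums.
Variable n : nat.

(** Off-diagonal terms cancel in pairs. *)
Lemma sum_sym0 (f : 'I_n -> 'I_n -> 'F_2) :
  (forall i j, f i j = f j i) -> (forall i, f i i = 0) -> \sum_i \sum_j f i j = 0.
Proof.
move=> fC f0; rewrite pair_bigA /= (bigID (fun p : 'I_n * 'I_n => (p.1 < p.2)%N)) /=.
rewrite [X in _ + X](bigID (fun p : 'I_n * 'I_n => p.1 == p.2)) /=.
rewrite [X in _ + (X + _)]big1 ?add0r; last first.
  by move=> [i j] /= /andP[_ /eqP->].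
rewrite [X in _ + X](reindex_inj (h := fun p : 'I_n * 'I_n => (p.2, p.1))) /=; last first.
  by move=> [i j] [i' j'] [-> ->].
rewrite [X in _ + X](eq_big (fun p : 'I_n * 'I_n => (p.1 < p.2)%N) (fun p => f p.1 p.2)) ?addF2xx //.
by move=> [i j] /=; rewrite -val_eqE /=; lia.
Qed.

Variable w : nat -> nat -> nat -> 'F_2.
Hypothesis w12 : forall t u v, w t u v = w u t v.
Hypothesis w23 : forall t u v, w t u v = w t v u.
Hypothesis w_diag : forall t v, w t t v = 0.

Definition sum3 (Q : nat -> nat -> nat -> bool) : 'F_2 :=
  \sum_(t < n) \sum_(u < n) \sum_(v < n) (Q t u v)%:R * w t u v.

Lemma sum3_swap12 Q : sum3 Q = sum3 (fun t u v => Q u t v).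
Proof.
rewrite /sum3 exchange_big; apply: eq_bigr => u _; apply: eq_bigr => t _.
by apply: eq_bigr => v _; rewrite w12.
Qed.

Lemma sum3_swap23 Q : sum3 Q = sum3 (fun t u v => Q t v u).
Proof.
rewrite /sum3; apply: eq_bigr => t _; rewrite exchange_big.
by apply: eq_bigr => u _; apply: eq_bigr => v _; rewrite w23.
Qed.

Lemma sum3_sym12 Q : (forall t u v, Q t u v = Q u t v) -> sum3 Q = 0.
Proof.
move=> QC; rewrite /sum3.
rewrite (eq_bigr (fun t : 'I_n => \sum_(u < n) \sum_(v < n) (Q t u v)%:R * w t u v)) //.
apply: sum_sym0 => [t u|t].
  by apply: eq_bigr => v _; rewrite QC w12.
by rewrite big1 // => v _; rewrite w_diag mulr0.
Qed.

(** A condition on one coordinate is symmetric in the two others. *)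
Lemma sum3_only1 (q : pred nat) : sum3 (fun t _ _ => q t) = 0.
Proof. by rewrite sum3_swap23 sum3_swap12 sum3_swap23 sum3_sym12. Qed.

Lemma sum3_only2 (q : pred nat) : sum3 (fun _ u _ => q u) = 0.
Proof. by rewrite sum3_swap12 sum3_only1. Qed.

Lemma sum3_only3 (q : pred nat) : sum3 (fun _ _ v => q v) = 0.
Proof. by rewrite sum3_swap23 sum3_only2. Qed.

Lemma sum3D Q1 Q2 : sum3 Q1 + sum3 Q2 = sum3 (fun t u v => Q1 t u v (+) Q2 t u v).
Proof.
rewrite /sum3 -big_split; apply: eq_bigr => t _; rewrite -big_split.
apply: eq_bigr => u _; rewrite -big_split; apply: eq_bigr => v _ /=.
rewrite -mulrDl; congr (_ * _).
by case: (Q1 t u v); case: (Q2 t u v) => /=; rewrite ?addr0 ?add0r ?addF2xx.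
Qed.

Lemma eq_sum3 Q1 Q2 : (forall t u v, (t < n)%N -> (u < n)%N -> (v < n)%N ->
    w t u v != 0 -> Q1 t u v = Q2 t u v) -> sum3 Q1 = sum3 Q2.
Proof.
move=> eqQ; apply: eq_bigr => t _; apply: eq_bigr => u _; apply: eq_bigr => v _.
by have [->|nz] := eqVneq (w t u v) 0; rewrite ?mulr0 // eqQ.
Qed.

End SymmetricSums.

(** * Loopless type-invariant voltages as functions of two types *)

(** Here [w] plays the role of prescribed holonomies around the holes [(t, u, v)], and
    [rect_sum] that of a voltage with these holonomies, as a function of two types. *)
Section RectSum.
Variables (d a : nat) (w : nat -> nat -> nat -> 'F_2).
Hypothesis w12 : forall t u v, w t u v = w u t v.
Hypothesis w23 : forall t u v, w t u v = w t v u.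
Hypothesis w_diag : forall t v, w t t v = 0.
Hypothesis w_supp : forall t u v, w t u v != 0 -> (t + u + v + 2 = a)%N.

Definition rect_sum x y : 'F_2 := sum3 d w (fun t u _ => (t < x) && (u < y))%N.

Lemma rect_sumC x y : rect_sum x y = rect_sum y x.
Proof. by rewrite /rect_sum sum3_swap12 //; apply: eq_sum3 => t u v _ _ _ _; rewrite andbC. Qed.

Lemma rect_sum_loopless x : rect_sum x x = 0.
Proof. by rewrite /rect_sum sum3_sym12 // => t u v; rewrite andbC. Qed.

Lemma rect_sum0 y : rect_sum 0 y = 0.
Proof.
by rewrite /rect_sum -[RHS](sum3_only1 d w12 w23 w_diag (fun=> false)); apply: eq_sum3.
Qed.

Lemma rect_sum_d x : rect_sum x d = 0.
Proof.
rewrite /rect_sum -[RHS](sum3_only1 d w12 w23 w_diag (fun t => t < x)%N).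
by apply: eq_sum3 => t u v _ -> _ _; rewrite andbT.
Qed.

(** For a point [(t, u, v)] of the support, neither all nor none of [t < x], [u < y],
    [v < z] hold; so two of them hold iff an odd number of them fail, and each single
    failure contributes a sum that is symmetric in the two other coordinates. *)
Lemma rect_sum_triangle x y z : (x + y + z <= a <= x + y + z + 1)%N ->
  rect_sum x y + rect_sum y z + rect_sum x z = 0.
Proof.
move=> xyz.
have -> : rect_sum y z = sum3 d w (fun _ u v => (u < y) && (v < z))%N.
  by rewrite /rect_sum sum3_swap23 // sum3_swap12.
have -> : rect_sum x z = sum3 d w (fun t _ v => (t < x) && (v < z))%N.
  by rewrite /rect_sum sum3_swap23.
have <- : sum3 d w (fun t _ _ => x <= t)%N + sum3 d w (fun _ u _ => y <= u)%N
    + sum3 d w (fun _ _ v => z <= v)%N = 0.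
  by rewrite sum3_only1 // sum3_only2 // sum3_only3 // !addr0.
rewrite /rect_sum !sum3D; apply: eq_sum3 => t u v _ _ _ /w_supp tuv.
by case: (ltnP t x); case: (ltnP u y); case: (ltnP v z) => //; lia.
Qed.

(** Passing to the complement of both conditions adds conditions on one coordinate. *)
Lemma rect_sum_compl x y : rect_sum x y = sum3 d w (fun t u _ => (x <= t) && (y <= u))%N.
Proof.
have s0 : sum3 d w (fun t _ _ => x <= t)%N + sum3 d w (fun _ u _ => y <= u)%N
    + sum3 d w (fun _ _ _ => true) = 0.
  by rewrite sum3_only1 // sum3_only2 // (sum3_only1 d w12 w23 w_diag xpredT) !addr0.
rewrite -[LHS]addr0 -s0 /rect_sum !sum3D; apply: eq_sum3 => t u v _ _ _ _.
by case: (ltnP t x); case: (ltnP u y).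
Qed.

(** The mixed difference of a rectangle sum is the sum over the points with first
    coordinates [t] and [u], and the support has only one of these. *)
Lemma rect_sum_mixed t u v : (t < d)%N -> (u < d)%N -> (v < d)%N -> (t + u + v + 2 = a)%N ->
  rect_sum t u + rect_sum t.+1 u + rect_sum t u.+1 + rect_sum t.+1 u.+1 = w t u v.
Proof.
move=> td ud vd tuv; rewrite /rect_sum !sum3D.
rewrite (eq_sum3 (Q2 := fun t' u' v' => [&& t' == t, u' == u & v' == v])); last first.
  move=> t' u' v' _ _ _ /w_supp; rewrite !ltnS.
  by case: (ltngtP t' t); case: (ltngtP u' u); case: (ltngtP v' v) => //=; lia.
rewrite /sum3 (bigD1 (Ordinal td)) //= (bigD1 (Ordinal ud)) //= (bigD1 (Ordinal vd)) //=.
rewrite !eqxx mul1r !big1 ?addr0 // => i; rewrite -val_eqE /= => /negPf i_neq.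
- by rewrite big1 // => j _; rewrite big1 // => k _; rewrite i_neq mul0r.
- by rewrite big1 // => j _; rewrite i_neq mul0r.
- by rewrite i_neq mul0r.
Qed.

(** Only points whose third coordinate is at most [k] contribute to the complementary
    form of the sum, and [(i, j, k)] is the only one with third coordinate [k]. *)
Lemma rect_sum_lead i j k : (i < d)%N -> (j < d)%N -> (k < d)%N -> (i + j + k + 2 = a)%N ->
  (forall t u v, (v < k)%N -> w t u v = 0) -> rect_sum i j = w i j k.
Proof.
move=> id jd kd ijk small0; rewrite rect_sum_compl.
rewrite (eq_sum3 (Q2 := fun t' u' v' => [&& t' == i, u' == j & v' == k])); last first.
  move=> t' u' v' _ _ _ nz; have := w_supp nz.
  have : (k <= v')%N by rewrite leqNgt; apply: contra nz => /small0->.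
  by case: (ltngtP t' i); case: (ltngtP u' j); case: (ltngtP v' k) => //=; lia.
rewrite /sum3 (bigD1 (Ordinal id)) //= (bigD1 (Ordinal jd)) //= (bigD1 (Ordinal kd)) //=.
rewrite !eqxx mul1r !big1 ?addr0 // => h; rewrite -val_eqE /= => /negPf h_neq.
- by rewrite big1 // => ? _; rewrite big1 // => ? _; rewrite h_neq mul0r.
- by rewrite big1 // => ? _; rewrite h_neq mul0r.
- by rewrite h_neq mul0r.
Qed.

End RectSum.

(** Types [i, j, k] are realised by pairwise disjoint [d]-sets when the block, of size
    [a], and its complement, of size [b], are both large enough. *)
Section TypeFunctions.
Variables d a b : nat.

Definition type_edge i j := [&& i <= d, j <= d, i + j <= a & 2 * d <= i + j + b]%N.
Definition type_triangle i j k :=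
  [&& i <= d, j <= d, k <= d, i + j + k <= a & 3 * d <= i + j + k + b]%N.

Definition mixed_diff (f : nat -> nat -> 'F_2) t u : 'F_2 :=
  f t u + f t.+1 u + f t u.+1 + f t.+1 u.+1.

Variable f : nat -> nat -> 'F_2.
Hypothesis fC : forall i j, f i j = f j i.
Hypothesis f_triangle : forall i j k, type_triangle i j k -> f i j + f j k + f i k = 0.

Lemma f_triangleE i j k : type_triangle i j k -> f i j = f i k + f j k.
Proof.
by move/f_triangle/eqP; rewrite -addrA addF2_eq0 => /eqP->; rewrite addrC.
Qed.

Section MixedZero.
Hypothesis ab_large : (3 * d + 1 <= a + b)%N.
Hypothesis mixed0 : forall t u, type_edge t u -> type_edge t.+1 u.+1 -> mixed_diff f t u = 0.

(** The value of [2 * d - b - t], truncated at 0, is the least type adjacent to both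
    [t] and [t.+1]; any other one gives the same step. *)
Definition step t : 'F_2 := f t (2 * d - b - t) + f t.+1 (2 * d - b - t).
Definition potential i : 'F_2 := \sum_(t < i) step t.

Lemma potentialS i : potential i.+1 = potential i + step i.
Proof. by rewrite /potential big_ord_recr. Qed.

Lemma step_indep t u : type_edge t u -> type_edge t.+1 u -> f t u + f t.+1 u = step t.
Proof.
rewrite /step; set u0 := (2 * d - b - t)%N.
move=> tu tu'; have u0u : (u0 <= u)%N by move: tu tu'; rewrite /type_edge; lia.
rewrite -(subnKC u0u) in tu tu' *; elim: (u - u0)%N tu tu' => [|m IHm] tu tu'.
  by rewrite addn0.
have tu1 : type_edge t (u0 + m) by move: tu tu'; rewrite /type_edge; lia.
have tu1' : type_edge t.+1 (u0 + m) by move: tu tu'; rewrite /type_edge; lia.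
rewrite -IHm //; have := mixed0 tu1; rewrite -addnS => /(_ tu') /eqP.
by rewrite /mixed_diff -addrA addF2_eq0 addnS => /eqP->.
Qed.

Let h i j := f i j + (potential i + potential j).

Let hC i j : h i j = h j i.
Proof. by rewrite /h fC [potential i + _]addrC. Qed.

Let h_up i j : type_edge i j -> type_edge i.+1 j -> h i.+1 j = h i j.
Proof.
move=> ij ij'; rewrite /h potentialS -(step_indep ij ij').
f2 (f i j); f2 (f i.+1 j); f2 (potential i); f2 (potential j); f2done.
Qed.

Let h_up2 i j : type_edge i j -> type_edge i j.+1 -> h i j.+1 = h i j.
Proof.
move=> ij ij'; rewrite ![h i _]hC h_up //; move: ij ij'; rewrite /type_edge; lia.
Qed.

Let h_diag m i j : type_edge i j -> type_edge (i + m) (j - m) -> (m <= j)%N ->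
  h (i + m) (j - m) = h i j.
Proof.
elim: m => [|m IHm] ij ijm mj; first by rewrite addn0 subn0.
have ij1 : type_edge (i + m) (j - m) by move: ij ijm; rewrite /type_edge; lia.
rewrite -IHm //; last by lia.
have jm : (j - m = (j - m.+1).+1)%N by lia.
have [lt_a|ge_a] := ltnP (i + j) a.
  have e : type_edge (i + m).+1 (j - m) by move: ij ijm; rewrite /type_edge; lia.
  by rewrite -(h_up ij1 e) jm h_up2 ?addnS //; rewrite -?jm -?addnS in e *.
have e : type_edge (i + m) (j - m.+1) by move: ij ijm; rewrite /type_edge; lia.
by rewrite jm h_up2 -?jm // addnS h_up // -addnS.
Qed.

Let h_level i j i' j' : type_edge i j -> type_edge i' j' -> (i + j = i' + j')%N ->
  h i j = h i' j'.
Proof.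
wlog le_i : i j i' j' / (i <= i')%N => [W ij ij' eq_s|].
  by have [le|lt] := leqP i i'; [apply: W | symmetry; apply: W => //; apply: ltnW].
move=> ij ij' eq_s; have i'E : (i' = i + (i' - i))%N by lia.
have j'E : (j' = j - (i' - i))%N by lia.
by rewrite i'E j'E h_diag //; rewrite -?i'E -?j'E //; lia.
Qed.

Let h_const i j i' j' : type_edge i j -> type_edge i' j' -> h i j = h i' j'.
Proof.
wlog le_s : i j i' j' / (i + j <= i' + j')%N => [W ij ij'|].
  by have [le|lt] := leqP (i + j) (i' + j'); [apply: W|symmetry; apply: W => //; apply: ltnW].
move=> ij ij'; have [m s_eq] : exists m, (i + j + m = i' + j')%N.
  by exists (i' + j' - (i + j))%N; lia.
elim: m i j {le_s} ij s_eq => [|m IHm] i j ij s_eq.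
  by apply: h_level; rewrite // -s_eq addn0.
have [lt_i|ge_i] := ltnP i d.
  have e : type_edge i.+1 j by move: ij ij'; rewrite /type_edge; lia.
  by rewrite -(h_up ij e) IHm //; lia.
have e : type_edge i j.+1 by move: ij ij'; rewrite /type_edge; lia.
by rewrite -(h_up2 ij e) IHm //; lia.
Qed.

(** Subtracting the potential makes the function constant along single steps, hence
    constant; a constant voltage on a triangle vanishes since [3] is odd. *)
Lemma mixed0_switching i j : type_edge i j -> f i j = potential i + potential j.
Proof.
move=> ij; apply/eqP; rewrite -addF2_eq0; apply/eqP.
pose k := minn d (a - i - j).
have tri : type_triangle i j k by move: ij; rewrite /type_edge /type_triangle /k; lia.
have jk : type_edge j k by move: ij tri; rewrite /type_edge /type_triangle; lia.
have ik : type_edge i k by move: ij tri; rewrite /type_edge /type_triangle; lia.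
have := f_triangle tri.
have := h_const ij jk; have := h_const ij ik; rewrite /h.
move: (f i j) (f j k) (f i k) (potential i) (potential j) (potential k).
by do 6!apply: F2_ind => //=; move=> ? ? ?; apply/eqP; vm_compute.
Qed.

End MixedZero.

(** With at least two points left over by a triangle, the four edges of a mixed
    difference have a common neighbour. *)
Lemma mixed_diff_large t u : (3 * d + 2 <= a + b)%N ->
  type_edge t u -> type_edge t.+1 u.+1 -> mixed_diff f t u = 0.
Proof.
move=> ab tu tu'; pose z := minn d (a - t - u - 2).
have [T1 T2 T3 T4] : [/\ type_triangle t u z, type_triangle t.+1 u z,
    type_triangle t u.+1 z & type_triangle t.+1 u.+1 z].
  by move: tu tu'; rewrite /type_edge /type_triangle /z; split; lia.
rewrite /mixed_diff (f_triangleE T1) (f_triangleE T2) (f_triangleE T3) (f_triangleE T4).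
f2 (f t z); f2 (f u z); f2 (f t.+1 z); f2 (f u.+1 z); f2done.
Qed.

Section Holes.
Hypothesis ab_eq : (a + b = 3 * d + 1)%N.
Hypothesis f_loopless : forall i, f i i = 0.

(** Each of [t], [u], [v] may be raised by one.  Raising one or two of them gives the
    types of a triangle; raising none takes one point too many of the complement, and
    raising all takes one point too many of the block. *)
Definition hole t u v := [&& t < d, u < d, v < d & t + u + v + 2 == a]%N.

Definition curvature t u v : 'F_2 := if hole t u v then mixed_diff f t u else 0.

Lemma curvature12 t u v : curvature t u v = curvature u t v.
Proof.
rewrite /curvature /hole [(u + t)%N]addnC andbCA /mixed_diff.
case: ifP => // _; rewrite (fC t) (fC t.+1) (fC t.+1 u.+1) (fC t u.+1).
by congr (_ + _); rewrite -addrA addrCA addrC -addrA addrCA; rewrite addrC addrAC.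
Qed.

(** The six triangles around a hole form an annulus; four of them identify the two
    differences. *)
Lemma curvature23 t u v : curvature t u v = curvature t v u.
Proof.
rewrite /curvature.
have -> : hole t v u = hole t u v by rewrite /hole; lia.
case: ifP => // /and4P[td ud vd /eqP tuv].
have [T1 T2 T3 T4] : [/\ type_triangle t u v.+1, type_triangle t.+1 u v.+1,
    type_triangle t u.+1 v & type_triangle t.+1 u.+1 v].
  by rewrite /type_triangle; split; lia.
rewrite /mixed_diff (f_triangleE T1) (f_triangleE T2) (f_triangleE T3) (f_triangleE T4).
f2 (f t v.+1); f2 (f u v.+1); f2 (f t.+1 v.+1); f2 (f t v); f2 (f u.+1 v);
  f2 (f t.+1 v); f2done.
Qed.

Lemma curvature_diag t v : curvature t t v = 0.
Proof.
rewrite /curvature /mixed_diff; case: ifP => // _.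
by rewrite !f_loopless add0r addr0 fC addF2xx.
Qed.

Lemma curvature_supp t u v : curvature t u v != 0 -> (t + u + v + 2 = a)%N.
Proof. by rewrite /curvature; case: ifP => [/and4P[_ _ _ /eqP]//|]; rewrite eqxx. Qed.

Lemma hole_of_edges t u : type_edge t u -> type_edge t.+1 u.+1 ->
  exists v, hole t u v.
Proof.
move=> tu tu'; exists (a - t - u - 2)%N; move: tu tu'; rewrite /type_edge /hole; lia.
Qed.

End Holes.
End TypeFunctions.

(** * Normal forms along the tree of type pairs *)

Section NormalisedFunctions.
Variables d a b : nat.
Hypothesis ab_eq : (a + b = 3 * d + 1)%N.
Hypothesis a_small : (2 * a <= 3 * d + 1)%N.

Definition tree_normalised (f : nat -> nat -> 'F_2) : Prop :=
  forall i j, tree_pair d a i j -> type_edge d a b i j -> f i j = 0.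

Lemma tree_pair_edge i j : tree_pair d a i j -> type_edge d a b i j.
Proof. by rewrite /tree_pair /type_edge; case: ifP => hL; lia. Qed.

(** The tree pairs span all types that occur. *)
Lemma tree_connected (s : nat -> 'F_2) i :
  (forall i j, tree_pair d a i j -> s i = s j) -> (i <= d)%N -> (i <= a)%N -> s i = s 0.
Proof.
move=> s_tree id ia; rewrite /tree_pair in s_tree.
have [->//|i_gt0] := posnP i.
case: (posnP (a - d - 1)) s_tree => [L0|L_gt0] s_tree.
  by symmetry; apply: s_tree; rewrite eqxx; lia.
have [iL|iL] := ltnP i (a - d - 1); last by symmetry; apply: s_tree; lia.
by rewrite (s_tree i d) ?(s_tree 0 d) //; lia.
Qed.

Lemma normalised_switching0 (f : nat -> nat -> 'F_2) (s : nat -> 'F_2) :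
  (forall i j, type_edge d a b i j -> f i j = s i + s j) -> tree_normalised f ->
  forall i j, type_edge d a b i j -> f i j = 0.
Proof.
move=> fs nf i j ij; rewrite fs //.
have s_tree k l : tree_pair d a k l -> s k = s l.
  move=> kl; apply/eqP; rewrite -addF2_eq0 -fs ?nf //; exact: tree_pair_edge.
by rewrite !(tree_connected s_tree) ?addF2xx //; move: ij; rewrite /type_edge; lia.
Qed.

Lemma rect_sum_normalised (w : nat -> nat -> nat -> 'F_2) :
  (forall t u v, w t u v = w u t v) -> (forall t u v, w t u v = w t v u) ->
  (forall t v, w t t v = 0) -> tree_normalised (rect_sum d w).
Proof.
move=> w12 w23 w_diag i j; rewrite /tree_pair; case: ifP => _.
  by case/andP=> /eqP-> _ _; apply: rect_sum0.
case/orP=> [/andP[/eqP-> _]|/andP[_ /eqP->]] _; first exact: rect_sum0.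
exact: rect_sum_d.
Qed.

Section Injective.
Variable f : nat -> nat -> 'F_2.
Hypothesis fC : forall i j, f i j = f j i.
Hypothesis f_triangle : forall i j k, type_triangle d a b i j k ->
  f i j + f j k + f i k = 0.
Hypothesis f_loopless : forall i, f i i = 0.
Hypothesis f_norm : tree_normalised f.

Let w := curvature d a f.
Let w12 := curvature12 d a fC.
Let w23 := curvature23 f_triangle ab_eq.
Let w_diag := curvature_diag d a fC f_loopless.
Let w_supp := @curvature_supp d a f.

(** The difference of the two sides has zero holonomies, so it is a switching, and it
    vanishes along the tree. *)
Lemma rect_sum_curvature i j : type_edge d a b i j -> f i j = rect_sum d w i j.
Proof.
move=> ij; apply/eqP; rewrite -addF2_eq0; apply/eqP.
pose h i j := f i j + rect_sum d w i j.
have hC i' j' : h i' j' = h j' i' by rewrite /h fC rect_sumC.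
have h_tri i' j' k' : type_triangle d a b i' j' k' -> h i' j' + h j' k' + h i' k' = 0.
  move=> T; rewrite /h -[RHS](addr0 0) -{1}(f_triangle T).
  have <- : rect_sum d w i' j' + rect_sum d w j' k' + rect_sum d w i' k' = 0.
    apply: (rect_sum_triangle d w12 w23 w_diag w_supp).
    by move: T; rewrite /type_triangle; lia.
  by ring.
have h_mixed t u : type_edge d a b t u -> type_edge d a b t.+1 u.+1 ->
    mixed_diff h t u = 0.
  move=> tu tu'; have [v tuv] := hole_of_edges ab_eq tu tu'.
  have /and4P[td ud vd /eqP s_tuv] := tuv.
  have e : mixed_diff (rect_sum d w) t u = mixed_diff f t u.
    rewrite {1}/mixed_diff /w (rect_sum_mixed w_supp td ud vd s_tuv).
    by rewrite /curvature tuv.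
  rewrite -[RHS](addF2xx (mixed_diff f t u)) -{2}e /mixed_diff /h; ring.
have ab_large : (3 * d + 1 <= a + b)%N by rewrite ab_eq.
apply: (normalised_switching0 (mixed0_switching hC h_tri ab_large h_mixed)) ij.
move=> k l kl kl'; rewrite /h f_norm //.
by rewrite (rect_sum_normalised w12 w23 w_diag kl) ?addr0.
Qed.

Lemma hole_edge t u v : hole d a t u v -> type_edge d a b t u.
Proof. by rewrite /hole /type_edge; lia. Qed.

(** By induction on its least entry every hole has zero curvature: the value at the
    pair of its larger entries is its curvature plus terms with a smaller least entry. *)
Lemma normalised_inj :
  (forall k i j, (k < i < j)%N -> (j < d)%N -> (k + i + j + 2 = a)%N -> f i j = 0) ->
  forall i j, type_edge d a b i j -> f i j = 0.
Proof.
move=> f_coord i j ij; rewrite rect_sum_curvature //.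
suff w0 k t u v : (v < k)%N -> w t u v = 0.
  rewrite /rect_sum /sum3 big1 // => t _; rewrite big1 // => u _; rewrite big1 // => v _.
  by rewrite (w0 v.+1) // mulr0.
elim: k t u v => [|k IHk] t u v; first by rewrite ltn0.
rewrite ltnS leq_eqVlt => /orP[/eqP->{v}|]; last exact: IHk.
apply/eqP; apply/idPn => nz.
wlog tu : t u nz / (t < u)%N => [W|].
  case: (ltngtP t u) => [lt_tu|lt_ut|eq_tu]; first exact: W lt_tu.
    by apply: W lt_ut; rewrite /w w12.
  by move: nz; rewrite /w eq_tu w_diag eqxx.
have tuk : hole d a t u k by move: nz; rewrite /w /curvature; case: ifP; rewrite ?eqxx.
have /and4P[td ud kd /eqP s_tuk] := tuk.
case: (ltngtP t k) => [lt_tk|lt_kt|eq_tk].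
- by move: nz; rewrite /w w12 w23 -[curvature _ _ _]/w IHk ?eqxx.
- have e : rect_sum d w t u = w t u k :=
    rect_sum_lead w12 w23 w_diag w_supp td ud kd s_tuk IHk.
  move: nz; rewrite -e -rect_sum_curvature ?(hole_edge tuk) // (f_coord k) ?eqxx ?lt_kt //.
  by rewrite -s_tuk; lia.
- by move: nz; rewrite /w eq_tk w23 w_diag eqxx.
Qed.

End Injective.
End NormalisedFunctions.

Section Surjective.
Variables d a : nat.

Let tri3 (t : triple d a) : seq nat :=
  [:: val (val t).1.1; triple_i t; triple_j t].

Let tri3_lt (t : triple d a) :
  ((val t).1.1 < triple_i t)%N /\ (triple_i t < triple_j t)%N.
Proof. by have /andP[/andP[ki ij] _] := valP t. Qed.

Let tri3_sum (t : triple d a) : ((val t).1.1 + triple_i t + triple_j t + 2 = a)%N.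
Proof. by have /andP[_ /eqP] := valP t. Qed.

Let tri3_inj t t' : perm_eq (tri3 t) (tri3 t') -> t = t'.
Proof.
have so x : sorted leq (tri3 x).
  by have [ki ij] := tri3_lt x; rewrite /= (ltnW ki) (ltnW ij).
move=> e; have := sorted_eq leq_trans anti_leq (so t) (so t') e.
rewrite /tri3 /triple_i /triple_j => -[] /val_inj ek /val_inj ei /val_inj ej.
apply: val_inj; rewrite [val t]surjective_pairing [val t']surjective_pairing.
by rewrite [(val t).1]surjective_pairing [(val t').1]surjective_pairing ek ei ej.
Qed.

(** The holonomies prescribed by [x], extended to all orderings of the triples. *)
Definition sym_ext (x : {ffun triple d a -> ('F_2)^o}) (t u v : nat) : 'F_2 :=
  \sum_(p : triple d a) (perm_eq [:: t; u; v] (tri3 p))%:R * (x p : 'F_2).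

Lemma sym_ext_perm x t u v t' u' v' : perm_eq [:: t; u; v] [:: t'; u'; v'] ->
  sym_ext x t u v = sym_ext x t' u' v'.
Proof. by move=> e; apply: eq_bigr => p _; rewrite (permPl e). Qed.

Lemma sym_ext12 x t u v : sym_ext x t u v = sym_ext x u t v.
Proof. by apply: sym_ext_perm; rewrite (perm_catCA [:: t] [:: u] [:: v]). Qed.

Lemma sym_ext23 x t u v : sym_ext x t u v = sym_ext x t v u.
Proof. by apply: sym_ext_perm; rewrite perm_cons (perm_catC [:: u] [:: v]). Qed.

Lemma sym_ext_nz x t u v : sym_ext x t u v != 0 ->
  exists2 p, perm_eq [:: t; u; v] (tri3 p) & x p != 0.
Proof.
move=> nz; case: (pickP (fun p => perm_eq [:: t; u; v] (tri3 p) && (x p != 0))).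
  by move=> p /andP[]; exists p.
move=> none; move: nz; rewrite /sym_ext big1 ?eqxx // => p _.
have := none p; case: perm_eq => /=; last by rewrite mul0r.
by move/negbFE/eqP->; rewrite mulr0.
Qed.

Lemma sym_ext_diag x t v : sym_ext x t t v = 0.
Proof.
apply/eqP; apply: contraT => /sym_ext_nz[p /perm_uniq + _].
have [ki ij] := tri3_lt p.
have -> : uniq (tri3 p) by rewrite (sorted_uniq ltn_trans ltnn) //= ki ij.
by rewrite /= inE eqxx.
Qed.

Lemma sym_ext_supp x t u v : sym_ext x t u v != 0 -> (t + u + v + 2 = a)%N.
Proof.
move=> /sym_ext_nz[p /perm_sumn e _]; rewrite -(tri3_sum p).
have -> : ((val p).1.1 + triple_i p + triple_j p = sumn (tri3 p))%N.
  by rewrite /= addn0 addnA.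
by rewrite -e /=; lia.
Qed.

Lemma sym_extE x p : sym_ext x (triple_i p) (triple_j p) (val p).1.1 = x p.
Proof.
have e : perm_eq [:: triple_i p; triple_j p; val (val p).1.1] (tri3 p).
  by rewrite (perm_catC [:: _; _] [:: _]).
rewrite /sym_ext (bigD1 p) //= e mul1r big1 ?addr0 // => q qp.
case h: (perm_eq _ _); last by rewrite mul0r.
move: h; rewrite (permPl e) => /tri3_inj eq_pq.
by rewrite eq_pq eqxx in qp.
Qed.

Definition coord (x : {ffun triple d a -> ('F_2)^o}) : {ffun triple d a -> ('F_2)^o} :=
  [ffun p => rect_sum d (sym_ext x) (triple_i p) (triple_j p) : ('F_2)^o].

Lemma coordD x y : coord (x + y) = coord x + coord y.
Proof.
have sym_extD t u v : sym_ext (x + y) t u v = sym_ext x t u v + sym_ext y t u v.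
  rewrite /sym_ext -big_split; apply: eq_bigr => q _ /=.
  by rewrite ffunE mulrDr.
apply/ffunP => p; rewrite !ffunE /rect_sum /sum3 -big_split; apply: eq_bigr => t _ /=.
rewrite -big_split; apply: eq_bigr => u _ /=.
by rewrite -big_split; apply: eq_bigr => v _ /=; rewrite sym_extD mulrDr.
Qed.

(** The map is unitriangular for the order of the least entries. *)
Lemma coord_eq0 x : coord x = 0 -> x = 0.
Proof.
move=> cx0; apply/ffunP => p; rewrite ffunE.
suff x0 (k : nat) (q : triple d a) : ((val q).1.1 < k)%N -> x q = 0 by apply: (x0 (val p).1.1.+1).
elim: k q => [|k IHk] q; first by rewrite ltn0.
rewrite ltnS leq_eqVlt => /orP[/eqP kE|]; last exact: IHk.
have [ki ij] := tri3_lt q; have sq := tri3_sum q.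
have e0 : coord x q = 0 by rewrite cx0 ffunE.
rewrite -(sym_extE x q) -[RHS]e0 ffunE; symmetry.
apply: (rect_sum_lead (sym_ext12 x) (sym_ext23 x) (sym_ext_diag x) (@sym_ext_supp x)).
- by rewrite /triple_i.
- by rewrite /triple_j.
- by [].
- by move: sq; lia.
move=> t u v vk; apply/eqP; apply: contraT => /sym_ext_nz[r e].
rewrite IHk ?eqxx //.
have : v \in tri3 r by rewrite -(perm_mem e) !inE eqxx !orbT.
have [ki' ij'] := tri3_lt r.
rewrite !inE -kE => vr; apply: leq_ltn_trans vk; case/or3P: vr => /eqP-> //.
  exact: ltnW.
exact: ltnW (ltn_trans ki' ij').
Qed.

Lemma coord_surj (g : {ffun triple d a -> ('F_2)^o}) : exists x, coord x = g.
Proof.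
have c_inj : injective coord.
  move=> x y cxy; apply/eqP; rewrite -subr_eq0; apply/eqP/coord_eq0.
  rewrite coordD cxy -coordD.
  rewrite (_ : y - y = 0) ?subrr //; apply/eqP; rewrite -(inj_eq (@addrI _ (coord 0))).
  by rewrite -coordD !addr0.
by have [h _ hK] := injF_bij c_inj; exists (h g).
Qed.

End Surjective.

(** * Linear algebra *)

Lemma dim_linear_bij (K : fieldType) (V W : vectType K) (phi : {linear V -> W}) :
  bijective phi -> \dim {:V} = \dim {:W}.
Proof.
move=> [psi phiK psiK].
have ker0 : lker (linfun phi) == 0%VS.
  by apply/lker0P => x y; rewrite !lfunE => /(can_inj phiK).
rewrite -(limg_dim_eq (f := linfun phi)) ?(eqP ker0) ?capv0 //; congr (\dim _).
apply/vspaceP => w; rewrite memvf; apply/memv_imgP; exists (psi w); rewrite ?memvf //.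
by rewrite lfunE /= psiK.
Qed.

(** The first isomorphism theorem for the restriction of [c] to [Z]. *)
Lemma subquot_iso (K : fieldType) (V W : vectType K) (Z B : {vspace V})
    (c : {linear V -> W}) :
    (forall v, v \in Z -> (v \in B) = (c v == 0)) ->
    (forall w, exists2 v, v \in Z & c v = w) ->
  exists2 phi : {linear subquot Z B -> W}, bijective phi &
    forall z : subvs_of Z, phi (subclass B z) = c (vsval z).
Proof.
move=> c_ker c_onto.
pose U := (linfun (vsval : subvs_of Z -> V) @^-1: B)%VS.
pose phi (q : vquot U) : W := c (vsval (repr q)).
have phiE z : phi (subclass B z) = c (vsval z).
  apply/eqP; rewrite -subr_eq0 -linearB /= -c_ker; last by rewrite rpredB ?subvsP.
  by apply/eq_subclass; apply: vclassK.
have phi_lin : linear phi.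
  move=> a q r; rewrite -(vclassK q) -(vclassK r) -linearP /= -![vclass U _]/(subclass B _).
  by rewrite !phiE !linearP.
pose phi_mix := GRing.isSemilinear.Build K (subquot Z B) W _ phi
  (GRing.semilinear_linear phi_lin).
pose phiL : {linear subquot Z B -> W} := HB.pack phi phi_mix.
exists phiL => //; have phi_inj : injective phi.
  move=> q r; rewrite -(vclassK q) -(vclassK r) -![vclass U _]/(subclass B _) !phiE => /eqP.
  rewrite -subr_eq0 -linearB /= -c_ker; last by rewrite rpredB ?subvsP.
  by move/eq_subclass.
have ex_w w : exists z : subvs_of Z, c (vsval z) == w.
  by have [v vZ <-] := c_onto w; exists (Subvs vZ).
exists (fun w => subclass B (xchoose (ex_w w))) => [q|w].
  by apply: phi_inj; rewrite phiE; apply/eqP; apply: (xchooseP (ex_w _)).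
by rewrite /= phiE; apply/eqP; apply: (xchooseP (ex_w w)).
Qed.

Lemma dim_ffunF2 (I : finType) : \dim {: {ffun I -> ('F_2)^o}} = #|I|.
Proof. by rewrite dimvf /dim /= muln1. Qed.

Lemma span_closed (K : fieldType) (V : vectType K) (P : V -> Prop) (X : seq V) :
    P 0 -> (forall a u v, P u -> P v -> P (a *: u + v)) ->
    (forall v, v \in X -> P v) ->
  forall v, v \in <<X>>%VS -> P v.
Proof.
move=> P0 PD PX v /(@coord_span _ _ _ (in_tuple X)) ->.
elim/big_rec: _ => // i u _ Pu; apply: PD => //; apply: PX; exact: mem_nth.
Qed.

(** * The coefficients of the Gaussian binomial *)

Section Gaussian.
Local Notation poly := {poly rat}.

(** The generating function of the sums of [k]-subsets of [{0, ..., d-1}] for [k = 1, 2, 3],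
    built by adding the largest element last. *)
Definition esum1 d : poly := \sum_(x < d) 'X^x.
Definition esum2 d : poly := \sum_(y < d) 'X^y * esum1 y.
Definition esum3 d : poly := \sum_(z < d) 'X^z * esum2 z.

Lemma esum1E d : (1 - 'X) * esum1 d = 1 - 'X^d.
Proof.
elim: d => [|d IHd]; first by rewrite /esum1 big_ord0 mulr0 expr0 subrr.
by rewrite /esum1 big_ord_recr -/(esum1 d) /= mulrDr IHd (exprS 'X d); ring.
Qed.

Lemma esum2E d : (1 - 'X) * (1 - 'X^2) * ('X * esum2 d) = 'X * (1 - 'X^d) * ('X - 'X^d).
Proof.
elim: d => [|d IHd]; first by rewrite /esum2 big_ord0 !mulr0 expr0 subrr mulr0 mul0r.
have -> : esum2 d.+1 = esum2 d + 'X^d * esum1 d by rewrite /esum2 big_ord_recr.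
have -> : (1 - 'X) * (1 - 'X^2) * ('X * (esum2 d + 'X^d * esum1 d)) =
  (1 - 'X) * (1 - 'X^2) * ('X * esum2 d) +
  (1 - 'X^2) * 'X^d * 'X * ((1 - 'X) * esum1 d) by ring.
by rewrite IHd esum1E (exprS 'X d); ring.
Qed.

Lemma esum3E d : (1 - 'X) * (1 - 'X^2) * (1 - 'X^3) * esum3 d =
  (1 - 'X^d) * ('X - 'X^d) * ('X^2 - 'X^d).
Proof.
elim: d => [|d IHd]; first by rewrite /esum3 big_ord0 mulr0 expr0 subrr !mul0r.
have -> : esum3 d.+1 = esum3 d + 'X^d * esum2 d by rewrite /esum3 big_ord_recr.
have X0 : 'X != 0 :> poly by rewrite polyX_eq0.
apply: (mulfI X0).
have -> : 'X * ((1 - 'X) * (1 - 'X^2) * (1 - 'X^3) * (esum3 d + 'X^d * esum2 d)) =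
  'X * ((1 - 'X) * (1 - 'X^2) * (1 - 'X^3) * esum3 d) +
  (1 - 'X^3) * 'X^d * ((1 - 'X) * (1 - 'X^2) * ('X * esum2 d)) by ring.
by rewrite IHd esum2E (exprS 'X d); ring.
Qed.

(** The shift is the least sum [0 + 1 + 2 = 3] of a 3-subset. *)
Lemma gauss_binomial3 d : (3 <= d)%N -> esum3 d = 'X^3 * gauss_binomial d 3.
Proof.
move=> d3; rewrite /gauss_binomial !big_ord_recl !big_ord0 /= !mulr1 /bump /= !addn1 subn0.
pose D : poly := (1 - 'X) * ((1 - 'X^2) * (1 - 'X^3)); rewrite -[X in _ %/ X]/D.
have D0 : D != 0.
  rewrite /D !mulf_neq0 // -?[1]expr0 -opprB oppr_eq0; apply/eqP => e.
  - by have := congr1 (fun p : poly => p`_1) e; rewrite !coefE.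
  - by have := congr1 (fun p : poly => p`_2) e; rewrite !coefE.
  - by have := congr1 (fun p : poly => p`_3) e; rewrite !coefE.
have [k ->] : exists k, d = k.+3 by exists (d - 3)%N; lia.
have -> : (k.+3 - 1 = k.+2)%N by lia.
have -> : (k.+3 - 2 = k.+1)%N by lia.
have e : 'X^3 * ((1 - 'X^(k.+3)) * ((1 - 'X^(k.+2)) * (1 - 'X^(k.+1)))) = D * esum3 k.+3 :> poly.
  have e := esum3E k.+3; rewrite /D.
  have -> : (1 - 'X) * ((1 - 'X^2) * (1 - 'X^3)) * esum3 k.+3 =
    (1 - 'X) * (1 - 'X^2) * (1 - 'X^3) * esum3 k.+3 :> poly by ring.
  by rewrite e (exprS 'X k.+2) (exprS 'X k.+1) (exprS 'X k); ring.
have X3 : 'X^3 != 0 :> poly by rewrite -size_poly_eq0 size_polyXn.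
have /dvdpP[g gE] : 'X^3 %| esum3 k.+3.
  have : 'X^3 %| D * esum3 k.+3 by rewrite -e dvdp_mulr.
  rewrite Gauss_dvdpr // coprimep_expl // coprimep_sym coprimepX rootE /D.
  by rewrite !hornerE.
rewrite gE mulrC; congr (_ * _).
apply: (mulIf D0); rewrite divpK //.
  by apply: (mulfI X3); rewrite e gE; ring.
by apply/dvdpP; exists g; apply: (mulfI X3); rewrite e gE; ring.
Qed.

Lemma esum3_sum d : esum3 d = \sum_(p : 'I_d * 'I_d * 'I_d |
  (p.1.1 < p.1.2)%N && (p.1.2 < p.2)%N) 'X^(p.1.1 + p.1.2 + p.2).
Proof.
rewrite big_mkcond -(pair_bigA _ (fun (q : 'I_d * 'I_d) (z : 'I_d) =>
  if (q.1 < q.2)%N && (q.2 < z)%N then 'X^(q.1 + q.2 + z) else 0)) /=.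
rewrite exchange_big; apply: eq_bigr => z _ /=.
rewrite /esum2 (big_ord_widen d (fun y => 'X^y * esum1 y)) 1?ltnW // big_mkcond.
rewrite -(pair_bigA _ (fun x y : 'I_d =>
  if (x < y)%N && (y < z)%N then 'X^(x + y + z) else 0)) /= exchange_big /= mulr_sumr.
apply: eq_bigr => y _; case: ifP => [yz|_]; last first.
  by rewrite mulr0 big1 // => x _; rewrite andbF.
rewrite /esum1 (big_ord_widen d (fun x => 'X^x)) 1?ltnW // big_mkcond !mulr_sumr.
apply: eq_bigr => x _; rewrite andbT; case: ifP => _; last by rewrite !mulr0.
by rewrite !exprD; ring.
Qed.

(** A sum [a - 2] of the entries corresponds to the exponent [a - 2 - 3]. *)
Lemma card_triple d a : (3 <= d)%N ->
  #|triple d a|%:R = coefz (gauss_binomial d 3) (a%:Z - 5).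
Proof.
move=> d3; have coefE m : (esum3 d)`_m = #|triple d (m + 2)|%:R.
  rewrite esum3_sum coef_sum card_sig -sum1_card natr_sum.
  rewrite [RHS](eq_bigl (fun p : 'I_d * 'I_d * 'I_d =>
      ((p.1.1 < p.1.2)%N && (p.1.2 < p.2)%N) && (p.1.1 + p.1.2 + p.2 == m)%N)); last first.
    by move=> p; rewrite unfold_in /= eqn_add2r.
  rewrite [RHS]big_mkcondr; apply: eq_bigr => p _.
  by rewrite coefXn eq_sym; case: eqP.
have [a5|a5] := leqP 5 a; last first.
  have -> : a%:Z - 5 = - (5 - a)%:Z by lia.
  have [k ->] : exists k, (5 - a = k.+1)%N by exists (4 - a)%N; lia.
  rewrite -NegzE /= (_ : #|triple d a| = 0)%N //; apply: eq_card0 => -[[[x y] z] /=].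
  move=> p; exfalso; have /andP[/andP[/= xy yz] /eqP /= e] := p; lia.
have -> : a%:Z - 5 = Posz (a - 5)%N by lia.
have := coefE (a - 2)%N; rewrite gauss_binomial3 // subnK ?(leq_trans _ a5) // => <-.
by rewrite coefXnM /=; case: ltnP => [|_]; [lia | congr (_`_ _); lia].
Qed.

End Gaussian.

(** * Type-invariant voltages on Kneser graphs *)

Lemma exists_card_subset (T : finType) (X : {set T}) n : (n <= #|X|)%N ->
  exists2 Y : {set T}, Y \subset X & #|Y| = n.
Proof.
case/card_geqP => s [s_uniq s_n sX]; exists [set x in s].
  by apply/subsetP => x; rewrite inE => /sX.
by rewrite cardsE (card_uniqP s_uniq).
Qed.

Lemma disjoint_setU (T : finType) (X Y Z : {set T}) :
  [disjoint X :|: Y & Z] = [disjoint X & Z] && [disjoint Y & Z].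
Proof. by rewrite !disjoints_subset subUset. Qed.

Section Realisation.
Variables (T : finType) (A : {set T}).
Local Notation a := #|A|.
Local Notation b := #|~: A|.

Definition has_type (S : {set T}) m x : Prop := #|S| = m /\ #|S :&: A| = x.

Lemma has_type0 : has_type set0 0 0.
Proof. by split; rewrite ?set0I cards0. Qed.

Lemma has_typeU (S S' : {set T}) m m' x x' : [disjoint S & S'] ->
  has_type S m x -> has_type S' m' x' -> has_type (S :|: S') (m + m') (x + x').
Proof.
move=> SS' [<- <-] [<- <-]; split; first by rewrite cardsU disjoint_setI0 // cards0 subn0.
rewrite setIUl cardsU -setIIl (disjoint_setI0 SS') set0I cards0 subn0 //.
Qed.

Lemma extend_type (W : {set T}) m' x' m x : has_type W m' x' ->
    [&& x <= m, x + x' <= a & (m - x) + (m' - x') <= b]%N ->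
  exists2 S, has_type S m x & [disjoint S & W].
Proof.
case=> W_m W_x /and3P[xm xa mb].
have [X XA X_x] : exists2 X : {set T}, X \subset A :\: W & #|X| = x.
  by apply: exists_card_subset; rewrite cardsD setIC W_x; lia.
have W_x' : #|~: A :&: W| = (m' - x')%N.
  by rewrite setIC -setDE cardsD W_m W_x.
have [Y YA Y_x] : exists2 Y : {set T}, Y \subset ~: A :\: W & #|Y| = (m - x)%N.
  by apply: exists_card_subset; rewrite cardsD W_x'; lia.
move: XA YA; rewrite !subsetD => /andP[XA XW] /andP[YA YW].
have XY : [disjoint X & Y].
  by apply: disjointWl XA _; rewrite disjoint_sym disjoints_subset.
exists (X :|: Y).
  split; first by rewrite cardsU disjoint_setI0 // cards0 X_x Y_x; lia.
  rewrite setIUl (setIidPl XA) [Y :&: A]disjoint_setI0 ?setU0 //.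
  by rewrite disjoints_subset.
by rewrite disjoint_setU XW.
Qed.

Lemma has_type_bound (X : {set T}) m x : has_type X m x -> [&& x <= m, x <= a & m - x <= b]%N.
Proof.
case=> <- <-; have := cardsID A X; rewrite setDE.
have := subset_leq_card (subsetIr X A); have := subset_leq_card (subsetIr X (~: A)).
by lia.
Qed.

End Realisation.

Section KneserTypes.
Variables (T : finType) (d : nat) (A : {set T}).
Hypothesis d_gt0 : (0 < d)%N.
Local Notation K := (kneser T d).
Local Notation a := #|A|.
Local Notation b := #|~: A|.
Local Notation edge := (type_edge d a b).
Local Notation triangle := (type_triangle d a b).
Implicit Types (S : K) (alpha beta : voltage K).

Lemma kneser_adjE S S' : adj S S' = [disjoint val S & val S'].
Proof.
rewrite /adj /= /kneser_adj; case: eqP => //= <-.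
rewrite -setI_eq0 setIid -cards_eq0 (eqP (valP S)); lia.
Qed.

Lemma exists_vertex (X : {set T}) x : has_type A X d x ->
  exists2 S : K, val S = X & vtype A S = x.
Proof.
case=> X_d X_x; have h : #|X| == d by rewrite X_d.
by exists (exist (fun Y : {set T} => #|Y| == d) X h).
Qed.

Lemma vertex_type S : has_type A (val S) d (vtype A S).
Proof. by split; rewrite // (eqP (valP S)). Qed.

Lemma vtype_le S : (vtype A S <= d)%N.
Proof. by have /and3P[] := has_type_bound (vertex_type S). Qed.

Lemma adj_type_edge S S' : adj S S' -> edge (vtype A S) (vtype A S').
Proof.
rewrite kneser_adjE => SS'; have := vtype_le S; have := vtype_le S'.
have := has_type_bound (has_typeU SS' (vertex_type S) (vertex_type S')).
by rewrite /type_edge; lia.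
Qed.

Lemma realise_edge i j : edge i j ->
  exists S S', [/\ adj S S', vtype A S = i & vtype A S' = j].
Proof.
move=> ij.
have [X X_i _] : exists2 X, has_type A X d i & [disjoint X & set0].
  by apply: (extend_type (has_type0 A)); move: ij; rewrite /type_edge; lia.
have [Y Y_j YX] : exists2 Y, has_type A Y d j & [disjoint Y & X].
  by apply: (extend_type X_i); move: ij; rewrite /type_edge; lia.
have [S SE Si] := exists_vertex X_i; have [S' S'E S'j] := exists_vertex Y_j.
by exists S, S'; rewrite kneser_adjE SE S'E disjoint_sym.
Qed.

Lemma realise_triangle i j k : triangle i j k -> exists S S' S'',
  [/\ adj S S', adj S' S'', adj S S'' & [/\ vtype A S = i, vtype A S' = j & vtype A S'' = k]].
Proof.
move=> ijk; have : edge i j by move: ijk; rewrite /type_triangle /type_edge; lia.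
case/realise_edge=> S [S' [SS' Si S'j]].
have SS'd : [disjoint val S & val S'] by rewrite -kneser_adjE.
have [Z Z_k] : exists2 Z, has_type A Z d k & [disjoint Z & val S :|: val S'].
  apply: (extend_type (has_typeU SS'd (vertex_type S) (vertex_type S'))).
  by rewrite Si S'j; move: ijk; rewrite /type_triangle; lia.
rewrite disjoint_sym disjoint_setU => /andP[SZ S'Z].
have [S'' S''E S''k] := exists_vertex Z_k.
by exists S, S', S''; rewrite !kneser_adjE S''E.
Qed.

End KneserTypes.

Section KneserVoltages.
Variables (T : finType) (d : nat) (A : {set T}).
Hypothesis d_gt0 : (0 < d)%N.
Local Notation K := (kneser T d).
Local Notation a := #|A|.
Local Notation b := #|~: A|.
Local Notation edge := (type_edge d a b).
Local Notation triangle := (type_triangle d a b).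
Implicit Types (S U : K) (alpha beta : voltage K).

Lemma card_vertex S : #|val S| = d. Proof. exact: eqP (valP S). Qed.

Lemma raise_type S x y : x \in val S -> x \notin A -> y \notin val S -> y \in A ->
  exists2 S' : K, val S' = y |: (val S :\ x) & vtype A S' = (vtype A S).+1.
Proof.
move=> xS xA yS yA; apply: exists_vertex; split.
  have := cardsD1 x (val S); rewrite xS card_vertex => /esym e.
  by rewrite cardsU1 !inE negb_and yS orbT.
rewrite /vtype (_ : (_ :&: A) = y |: (val S :&: A)).
  by rewrite cardsU1 inE (negPf yS).
apply/setP => z; rewrite !inE; case: (eqVneq z y) => [->|_] /=; first by rewrite yA.
by case: eqP => [->|] //=; rewrite (negPf xA) andbF.
Qed.

(** Unlike a triangle condition, the square needs no common neighbour: one pair of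
    vertices is modified in two disjoint places. *)
Lemma realise_square t u : edge t u -> edge t.+1 u.+1 -> exists S S' U U',
  [/\ adj S U, adj S U', adj S' U & adj S' U'] /\
  [/\ vtype A S = t, vtype A S' = t.+1, vtype A U = u & vtype A U' = u.+1].
Proof.
move=> tu tu'; have [S [U [SU St Uu]]] := realise_edge d_gt0 tu.
have SUd : [disjoint val S & val U] by rewrite -kneser_adjE.
have outA (V : K) : (vtype A V < d)%N -> exists2 x, x \in val V & x \notin A.
  move=> Vd; have /card_gt0P[x] : (0 < #|val V :\: A|)%N.
    by rewrite cardsD card_vertex subn_gt0.
  by rewrite inE => /andP[]; exists x.
have [x xS xA] : exists2 x, x \in val S & x \notin A.
  by apply: outA; move: tu'; rewrite St /type_edge; lia.
have [x' x'U x'A] : exists2 x, x \in val U & x \notin A.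
  by apply: outA; move: tu'; rewrite Uu /type_edge; lia.
have [_ W_tu] := has_typeU SUd (vertex_type A S) (vertex_type A U).
have [Y YA /eqP/cards2P[y [y' [yy' YE]]]] :
    exists2 Y : {set T}, Y \subset A :\: (val S :|: val U) & #|Y| = 2%N.
  apply: exists_card_subset; rewrite cardsD setIC W_tu St Uu.
  by move: tu'; rewrite /type_edge; lia.
have : y \in Y by rewrite YE set21.
have : y' \in Y by rewrite YE set22.
move=> /(subsetP YA); rewrite !inE negb_or -andbA => /and3P[y'S y'U y'A].
move=> /(subsetP YA); rewrite !inE negb_or -andbA => /and3P[yS yU yA].
have [S' S'E S't] := raise_type xS xA yS yA.
have [U' U'E U'u] := raise_type x'U x'A y'U y'A.
exists S, S', U, U'; rewrite S't U'u St Uu; split=> //.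
have SUF z : z \in val S -> z \in val U -> False.
  by move=> zS zU; have := disjointFr SUd zS; rewrite zU.
split; rewrite ?SU // kneser_adjE // -setI_eq0 ?S'E ?U'E; apply/eqP/setP => z;
  rewrite !inE; apply/negP.
- case/andP=> zS /orP[/eqP zy'|/andP[_ zU]]; last exact: SUF zU.
  by rewrite -zy' zS in y'S.
- case/andP=> /orP[/eqP zy|/andP[_ zS]] zU; last exact: SUF zU.
  by rewrite -zy zU in yU.
case/andP=> /orP[/eqP zy|/andP[_ zS]] /orP[/eqP zy'|/andP[_ zU]].
- by rewrite -zy zy' eqxx in yy'.
- by rewrite -zy zU in yU.
- by rewrite -zy' zS in y'S.
- exact: SUF zU.
Qed.

(** The value of a type-invariant voltage on a pair of types; any value will do at
    pairs that occur on no edge. *)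
Definition tvolt alpha i j : 'F_2 :=
  if [pick p : K * K | adj p.1 p.2 && has_types A p.1 p.2 i j] is Some p
  then volt alpha p.1 p.2 else 0.

Lemma has_typesP S S' i j : reflect
  ((vtype A S = i /\ vtype A S' = j) \/ (vtype A S = j /\ vtype A S' = i))
  (has_types A S S' i j).
Proof.
rewrite /has_types; apply: (iffP idP) => [e|[[-> ->]|[-> ->]]] //; last first.
  by rewrite (perm_catC [:: j] [:: i]).
have : vtype A S \in [:: i; j] by rewrite -(perm_mem e) mem_head.
rewrite !inE => /orP[/eqP Si|/eqP Sj].
  by left; move: e; rewrite Si perm_cons => /perm_mem/(_ j); rewrite !inE eqxx => /eqP->.
have e' : perm_eq [:: vtype A S; vtype A S'] [:: j; i].
  by rewrite (permPl e) (perm_catC [:: i] [:: j]).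
right; move: e'; rewrite Sj perm_cons => /perm_mem/(_ i).
by rewrite !inE eqxx => /eqP->.
Qed.

Lemma has_types_refl S S' : has_types A S S' (vtype A S) (vtype A S').
Proof. exact: perm_refl. Qed.

Lemma has_typesC S S' i j : has_types A S S' i j = has_types A S S' j i.
Proof. by apply/has_typesP/has_typesP; tauto. Qed.

Lemma tvoltC alpha i j : tvolt alpha i j = tvolt alpha j i.
Proof.
rewrite /tvolt (eq_pick (Q := fun p : K * K => adj p.1 p.2 && has_types A p.1 p.2 j i)) //.
by move=> p; rewrite has_typesC.
Qed.

Lemma tvolt_is_linear i j : linear (fun alpha => tvolt alpha i j : ('F_2)^o).
Proof.
move=> x alpha beta; rewrite /tvolt; case: pickP => [p _|_].
  by rewrite voltD voltZ.
by rewrite scaler0 addr0.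
Qed.

Lemma tvoltE alpha S S' : type_invariant A alpha -> adj S S' ->
  volt alpha S S' = tvolt alpha (vtype A S) (vtype A S').
Proof.
move=> inv_a SS'; rewrite /tvolt; case: pickP => [p /andP[p_adj p_types]|].
  by symmetry; apply: inv_a.
move=> /(_ (S, S'))/negbT/negP[]; apply/andP; split; [exact: SS'|].
exact: has_types_refl.
Qed.

Lemma tvolt_has_types alpha S S' i j : type_invariant A alpha -> adj S S' ->
  has_types A S S' i j -> volt alpha S S' = tvolt alpha i j.
Proof.
by move=> inv_a SS' /has_typesP[[<- <-]|[<- <-]]; rewrite tvoltE // tvoltC.
Qed.

Lemma tvolt_loopless alpha i : loopless A alpha -> tvolt alpha i i = 0.
Proof.
move=> ll_a; rewrite /tvolt; case: pickP => // p /andP[p_adj /has_typesP p_i].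
by apply: ll_a => //; case: p_i => [] [-> ->].
Qed.

Lemma tvolt_triangle alpha i j k : type_invariant A alpha -> cocycle alpha ->
  triangle i j k -> tvolt alpha i j + tvolt alpha j k + tvolt alpha i k = 0.
Proof.
move=> inv_a ca /(realise_triangle d_gt0)[S [S' [S'' [e1 e2 e3 [<- <- <-]]]]].
by rewrite -!tvoltE // ca.
Qed.

Definition of_types (f : nat -> nat -> 'F_2) : voltage K :=
  mkvolt (fun S S' : K => f (vtype A S) (vtype A S')).

Section OfTypes.
Variable f : nat -> nat -> 'F_2.
Hypothesis fC : forall i j, f i j = f j i.

Lemma volt_of_types S S' : adj S S' ->
  volt (of_types f) S S' = f (vtype A S) (vtype A S').
Proof. by move=> SS'; rewrite volt_mkvolt. Qed.

Lemma of_types_invariant : type_invariant A (of_types f).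
Proof.
move=> S1 S2 S3 S4 e12 e34 /has_typesP t; rewrite !volt_of_types //.
by case: t => [] [-> ->].
Qed.

Lemma tvolt_of_types i j : edge i j -> tvolt (of_types f) i j = f i j.
Proof.
case/(realise_edge d_gt0) => S [S' [SS' <- <-]].
by rewrite -tvoltE ?volt_of_types //; apply: of_types_invariant.
Qed.

Lemma of_types_loopless : (forall i, f i i = 0) -> loopless A (of_types f).
Proof. by move=> f0 S S' SS' e; rewrite volt_of_types // e. Qed.

Lemma of_types_cocycle :
  (forall i j k, triangle i j k -> f i j + f j k + f i k = 0) -> cocycle (of_types f).
Proof.
move=> f_tri S S' S'' e1 e2 e3; rewrite !volt_of_types //; apply: f_tri.
have := adj_type_edge A d_gt0 e1; have := adj_type_edge A d_gt0 e2.
have SS' : [disjoint val S & val S'] by rewrite -kneser_adjE.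
have SSS : [disjoint val S :|: val S' & val S''].
  by rewrite disjoint_setU -!kneser_adjE // e2 e3.
have := has_typeU SSS (has_typeU SS' (vertex_type A S) (vertex_type A S'))
  (vertex_type A S'').
by move/has_type_bound; rewrite /type_edge /type_triangle; lia.
Qed.

End OfTypes.

(** With two spare points every mixed difference vanishes. *)
Lemma type_gauge_trivial alpha : (3 * d + 2 <= #|T|)%N ->
  loopless A alpha -> type_invariant A alpha -> cocycle alpha ->
  type_gauge_equiv A alpha 0.
Proof.
move=> T_large ll_a inv_a ca.
have ab : (3 * d + 2 <= a + b)%N by rewrite cardsC.
have tri i j k := tvolt_triangle inv_a ca (i := i) (j := j) (k := k).
exists (potential d b (tvolt alpha)) => S S' SS'.
rewrite voltB volt0 add0r tvoltE //.
apply: (mixed0_switching (a := a) (tvoltC alpha) tri).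
- by lia.
- by move=> t u; apply: mixed_diff_large.
- exact: adj_type_edge.
Qed.

(** The holonomies around realised squares are the mixed differences. *)
Lemma coboundary_mixed_diff alpha (f : {ffun K -> 'F_2}) t u :
  type_invariant A alpha -> alpha = coboundary f ->
  edge t u -> edge t.+1 u.+1 -> mixed_diff (tvolt alpha) t u = 0.
Proof.
move=> inv_a aE tu tu'.
have [S [S' [U [U' [[e1 e2 e3 e4] [St S't Uu U'u]]]]]] := realise_square tu tu'.
rewrite /mixed_diff -{1}St -{1}Uu -tvoltE // -{1}S't -{1}Uu -tvoltE //.
rewrite -{1}St -{1}U'u -tvoltE // -{1}S't -{1}U'u -tvoltE // aE !volt_coboundary //.
f2 (f S); f2 (f S'); f2 (f U); f2 (f U'); f2done.
Qed.

Lemma type_invariant_lin x alpha beta : type_invariant A alpha -> type_invariant A beta ->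
  type_invariant A (x *: alpha + beta).
Proof.
by move=> ia ib S1 S2 S3 S4 *; rewrite !voltD !voltZ (ia S1 S2 S3 S4) // (ib S1 S2 S3 S4).
Qed.

Lemma loopless_lin x alpha beta : loopless A alpha -> loopless A beta ->
  loopless A (x *: alpha + beta).
Proof. by move=> la lb S S' *; rewrite voltD voltZ la // lb // mulr0 addr0. Qed.

Definition switching (s : nat -> 'F_2) : voltage K := of_types (fun i j => s i + s j).

Lemma volt_switching s S S' : adj S S' ->
  volt (switching s) S S' = s (vtype A S) + s (vtype A S').
Proof. by move=> SS'; rewrite volt_of_types // => i j; rewrite addrC. Qed.

Lemma switchingP alpha : type_switching A alpha <-> exists s, alpha = switching s.
Proof.
split=> [[s sE]|[s ->]]; exists s => *; last exact: volt_switching.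
by apply: eq_volt => S S' SS'; rewrite volt_switching // sE.
Qed.

Lemma switching_invariant s : type_invariant A (switching s).
Proof. by apply: of_types_invariant => i j; rewrite addrC. Qed.

Lemma switching_loopless s : loopless A (switching s).
Proof. by move=> S S' SS' e; rewrite volt_switching // e addF2xx. Qed.

Lemma switching_cocycle s : cocycle (switching s).
Proof.
move=> S S' S'' e1 e2 e3; rewrite !volt_switching //.
f2 (s (vtype A S)); f2 (s (vtype A S')); f2 (s (vtype A S'')); f2done.
Qed.

Lemma eq_tvolt alpha beta : type_invariant A alpha -> type_invariant A beta ->
  (forall i j, edge i j -> tvolt alpha i j = tvolt beta i j) -> alpha = beta.
Proof.
move=> ia ib eq_ab; apply: eq_volt => S S' SS'; rewrite !tvoltE // eq_ab //.
exact: adj_type_edge.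
Qed.

Lemma vanishes_onP (P : nat -> nat -> bool) alpha : type_invariant A alpha ->
    (forall i j, P i j -> edge i j) ->
  vanishes_on A P alpha <-> (forall i j, P i j -> tvolt alpha i j = 0).
Proof.
move=> ia PE; split=> [va i j Pij|ta S S' i j SS' Pij tij].
  have [S [S' [SS' Si S'j]]] := realise_edge d_gt0 (PE _ _ Pij).
  rewrite -Si -S'j -tvoltE //; apply: va SS' Pij _.
  by rewrite -Si -S'j has_types_refl.
by rewrite (tvolt_has_types ia SS' tij) ta.
Qed.

End KneserVoltages.

(** Over a finite space the vectors satisfying a linear predicate can be listed, and
    they span the subspace. *)
Lemma vspace_of_pred (F : fieldType) (V : vectType F) (X : seq V) (P : pred V) :
    P 0 -> (forall a u v, P u -> P v -> P (a *: u + v)) -> (forall v, v \in X) ->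
  exists Z : {vspace V}, forall v, (v \in Z) = P v.
Proof.
move=> P0 PD allX; exists <<filter P X>>%VS => v; apply/idP/idP => [|Pv].
  apply: (@span_closed _ _ (fun u => P u : Prop)) v => // u.
  by rewrite mem_filter => /andP[].
by apply: memv_span; rewrite mem_filter Pv allX.
Qed.

Section InvariantSpace.
Variables (T : finType) (d : nat) (A : {set T}).
Local Notation K := (kneser T d).
Implicit Types (alpha : voltage K).

Lemma invariant_vspace : exists Z : {vspace voltage K}, forall alpha, alpha \in Z <->
  [/\ local_nbhd_preserving alpha, loopless A alpha & type_invariant A alpha].
Proof.
pose P alpha := [&& local_nbhd_preserving alpha,
  [forall S : K, forall S' : K,
    (adj S S' && (vtype A S == vtype A S')) ==> (volt alpha S S' == 0)]
  & [forall p : (K * K) * (K * K),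
      [&& adj p.1.1 p.1.2, adj p.2.1 p.2.2
        & has_types A p.1.1 p.1.2 (vtype A p.2.1) (vtype A p.2.2)]
      ==> (volt alpha p.1.1 p.1.2 == volt alpha p.2.1 p.2.2)]].
have PP alpha : P alpha <->
    [/\ local_nbhd_preserving alpha, loopless A alpha & type_invariant A alpha].
  split=> [/and3P[lnp /forallP ll /forallP inv]|[lnp ll inv]].
    split=> // [S S' SS' e|S1 S2 S3 S4 e12 e34 t].
      by have /forallP/(_ S')/implyP := ll S; rewrite SS' e eqxx => /(_ isT)/eqP.
    have /implyP := inv ((S1, S2), (S3, S4)).
    by move=> h; apply/eqP; apply: h; apply/and3P; split.
  apply/and3P; split=> //.
    apply/forallP => S; apply/forallP => S'; apply/implyP => /andP[SS' /eqP e].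
    by rewrite ll.
  by apply/forallP => p; apply/implyP => /and3P[e12 e34 t]; apply/eqP; apply: inv.
have [] := @vspace_of_pred _ (voltage K) (enum {: voltage K}) P.
- apply/PP; split; first by apply/lnpP => x y z *; rewrite !volt0 !addr0.
    by move=> S S' *; rewrite volt0.
  by move=> S1 S2 S3 S4 *; rewrite !volt0.
- move=> x u v /PP[/lnpP cu lu iu] /PP[/lnpP cv lv iv]; apply/PP; split.
  + by apply/lnpP/cocycleD => //; apply: cocycleZ.
  + exact: loopless_lin.
  + exact: type_invariant_lin.
- by move=> v; rewrite mem_enum.
by move=> Z ZE; exists Z => alpha; rewrite ZE; apply: PP.
Qed.

Lemma switching_vspace : exists B : {vspace voltage K}, forall alpha, alpha \in B <->
  type_switching A alpha.
Proof.
pose P alpha := [exists s : {ffun 'I_d.+1 -> 'F_2},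
  alpha == switching d A (fun i => s (inord i))].
have PP alpha : P alpha <-> type_switching A alpha.
  rewrite switchingP; split=> [/existsP[s /eqP->]|[s ->]]; first by eexists.
  apply/existsP; exists [ffun i : 'I_d.+1 => s i]; apply/eqP/eq_volt => S S' SS'.
  by rewrite !volt_switching // !ffunE !inordK // ltnS vtype_le.
have [] := @vspace_of_pred _ (voltage K) (enum {: voltage K}) P.
- apply/PP; exists (fun=> 0) => S S' _; rewrite volt0 addr0 //.
- move=> x u v /PP[s sE] /PP[r rE]; apply/PP; exists (fun i => x * s i + r i) => S S' e.
  by rewrite voltD voltZ sE // rE // mulrDr addrACA.
- by move=> v; rewrite mem_enum.
by move=> Z ZE; exists Z => alpha; rewrite ZE; apply: PP.
Qed.

End InvariantSpace.

(** * The coordinates of type-invariant voltages *)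

Section Coordinates.
Variables (T : finType) (d : nat) (A : {set T}).
Hypothesis d_gt0 : (0 < d)%N.
Hypothesis cardT : #|T| = (3 * d + 1)%N.
Hypothesis A_small : (2 * #|A| <= 3 * d + 1)%N.
Local Notation K := (kneser T d).
Local Notation a := #|A|.
Local Notation b := #|~: A|.
Local Notation edge := (type_edge d a b).
Local Notation triangle := (type_triangle d a b).
Implicit Types (S : K) (alpha beta : voltage K).

Lemma card_blocks : (a + b = 3 * d + 1)%N.
Proof. by rewrite cardsC. Qed.

(** The potential that vanishes at type 0 and has the given voltage as its differences
    along the tree: types from [a - d - 1] on are joined to 0, smaller ones to [d]. *)
Definition tree_potential alpha (x : nat) : 'F_2 :=
  if x == 0%N then 0 else
  if (a - d - 1 <= x)%N then tvolt A alpha 0 x else tvolt A alpha 0 d + tvolt A alpha x d.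

Definition normalise alpha : voltage K := alpha - switching d A (tree_potential alpha).

(** The value of the normalised representative, written so as to be visibly linear on
    all voltages. *)
Definition coordinates alpha : {ffun triple d a -> ('F_2)^o} :=
  [ffun p => tvolt A alpha (triple_i p) (triple_j p) +
    (tree_potential alpha (triple_i p) + tree_potential alpha (triple_j p)) : ('F_2)^o].

Lemma tvoltB alpha beta i j : tvolt A (alpha - beta) i j = tvolt A alpha i j + tvolt A beta i j.
Proof.
have e := tvolt_is_linear A i j (-1) beta alpha.
by rewrite [alpha - beta]addrC -scaleN1r e scaleN1r oppF2 addrC.
Qed.

Lemma tree_potential_is_linear x : linear (fun alpha => tree_potential alpha x : ('F_2)^o).
Proof.
move=> c alpha beta; rewrite /tree_potential; case: ifP => _; first by rewrite scaler0 addr0.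
case: ifP => _; first exact: tvolt_is_linear.
have := tvolt_is_linear A 0 d c alpha beta; have := tvolt_is_linear A x d c alpha beta.
by move=> -> ->; rewrite scalerDr addrACA.
Qed.

Lemma coordinates_is_linear : linear coordinates.
Proof.
move=> c alpha beta; apply/ffunP => p; rewrite !ffunE.
have := tvolt_is_linear A (triple_i p) (triple_j p) c alpha beta.
have := tree_potential_is_linear (triple_i p) c alpha beta.
have := tree_potential_is_linear (triple_j p) c alpha beta.
move=> /= -> -> ->.
have sc (x y : 'F_2) : x *: (y : ('F_2)^o) = x * y by [].
by rewrite !sc; ring.
Qed.

HB.instance Definition _ := GRing.isSemilinear.Build 'F_2
  (voltage K) {ffun triple d a -> ('F_2)^o} _ coordinates
  (GRing.semilinear_linear coordinates_is_linear).

Lemma tvolt_switching s i j : edge i j -> tvolt A (switching d A s) i j = s i + s j.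
Proof. by move=> ij; rewrite tvolt_of_types // => *; rewrite addrC. Qed.

Lemma tvolt_normalise alpha i j : edge i j -> tvolt A (normalise alpha) i j =
  tvolt A alpha i j + (tree_potential alpha i + tree_potential alpha j).
Proof. by move=> ij; rewrite tvoltB tvolt_switching. Qed.

Lemma normaliseP alpha : tree_normalised d a b (tvolt A (normalise alpha)).
Proof.
move=> i j ij ijE; rewrite tvolt_normalise // /tree_potential.
have dL : (a - d - 1 <= d)%N by lia.
have d0 : (d == 0)%N = false by lia.
move: ij; rewrite /tree_pair; case: ifP => hL.
  case/andP=> /eqP-> /andP[j1 j_le]; rewrite eqxx.
  have -> : (j == 0)%N = false by lia.
  have -> : (a - d - 1 <= j)%N by lia.
  by rewrite add0r addF2xx.
case/orP=> [/and3P[/eqP-> Lj jd]|/andP[/andP[i1 iL] /eqP->]].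
  rewrite eqxx Lj; have -> : (j == 0)%N = false by lia.
  by rewrite add0r addF2xx.
have -> : (i == 0)%N = false by lia.
rewrite leqNgt iL /= d0 dL.
f2 (tvolt A alpha i d); f2 (tvolt A alpha 0 d); f2done.
Qed.

Lemma normalise_invariant alpha : type_invariant A alpha -> type_invariant A (normalise alpha).
Proof.
move=> ia; rewrite /normalise addrC -scaleN1r; apply: type_invariant_lin => //.
exact: switching_invariant.
Qed.

Lemma tree_pair_edge' i j : tree_pair d a i j -> edge i j.
Proof. exact: (tree_pair_edge card_blocks A_small). Qed.

Lemma tree_potential_normalised alpha x :
  tree_normalised d a b (tvolt A alpha) -> (x <= d)%N -> (x <= a)%N -> tree_potential alpha x = 0.
Proof.
move=> na xd xa; have tree0 i j : tree_pair d a i j -> tvolt A alpha i j = 0.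
  by move=> t; apply: na => //; apply: tree_pair_edge'.
rewrite /tree_potential; case: eqP => // /eqP x0; case: ifP => Lx.
  by apply: tree0; rewrite /tree_pair; case: ifP => hL; lia.
by rewrite !tree0 ?addr0 // /tree_pair; case: ifP => hL; lia.
Qed.

Lemma triple_bounds (p : triple d a) :
  [/\ (triple_i p < d)%N, (triple_j p < d)%N, (triple_i p <= a)%N & (triple_j p <= a)%N].
Proof.
have /andP[_ /eqP s] := valP p; rewrite /triple_i /triple_j.
have aux x y z : (x + y + z + 2 = a -> y <= a /\ z <= a)%N by lia.
by have [] := aux _ _ _ s; split; rewrite ?ltn_ord.
Qed.

Lemma triple_edge (p : triple d a) : edge (triple_i p) (triple_j p).
Proof.
have [pi pj _ _] := triple_bounds p; have /andP[_ /eqP s] := valP p.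
have aux k i j : (k < d -> i < d -> j < d -> k + i + j + 2 = a -> edge i j)%N.
  by have := card_blocks; rewrite /type_edge; lia.
exact: aux (ltn_ord (val p).1.1) pi pj s.
Qed.

Lemma coordinates_normalised alpha p : tree_normalised d a b (tvolt A alpha) ->
  coordinates alpha p = tvolt A alpha (triple_i p) (triple_j p).
Proof.
move=> na; have [pi pj pia pja] := triple_bounds p.
by rewrite ffunE !tree_potential_normalised ?addr0 // ltnW.
Qed.

Lemma coordinates_switching s : coordinates (switching d A s) = 0.
Proof.
have tpE x : (x <= d)%N -> (x <= a)%N -> tree_potential (switching d A s) x = s x + s 0.
  move=> xd xa; rewrite /tree_potential; case: eqP => [->|/eqP x0]; first by rewrite addF2xx.
  have ab := card_blocks; case: ifP => Lx; rewrite !tvolt_switching; rewrite /type_edge; try lia.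
    by rewrite addrC.
  f2 (s 0%N); f2 (s d); f2 (s x); f2done.
apply/ffunP => p; have [pi pj pia pja] := triple_bounds p.
rewrite !ffunE tvolt_switching ?triple_edge // (tpE _ (ltnW pi) pia) (tpE _ (ltnW pj) pja).
f2 (s (triple_i p)); f2 (s (triple_j p)); f2 (s 0%N); f2done.
Qed.

Lemma normalised_eq0 alpha : cocycle alpha -> loopless A alpha -> type_invariant A alpha ->
  tree_normalised d a b (tvolt A alpha) ->
  (forall p : triple d a, tvolt A alpha (triple_i p) (triple_j p) = 0) ->
  forall i j, edge i j -> tvolt A alpha i j = 0.
Proof.
move=> ca la ia na a0.
apply: (normalised_inj card_blocks A_small (tvoltC A alpha) _ _ na).
- by move=> i j k; apply: tvolt_triangle.
- by move=> i; apply: tvolt_loopless.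
move=> k i j /andP[ki ij] jd s.
have kd : (k < d)%N by lia.
have id : (i < d)%N by lia.
have h : ((Ordinal kd, Ordinal id, Ordinal jd).1.1 < (Ordinal kd, Ordinal id, Ordinal jd).1.2)%N &&
  ((Ordinal kd, Ordinal id, Ordinal jd).1.2 < (Ordinal kd, Ordinal id, Ordinal jd).2)%N &&
  ((Ordinal kd, Ordinal id, Ordinal jd).1.1 + (Ordinal kd, Ordinal id, Ordinal jd).1.2 +
   (Ordinal kd, Ordinal id, Ordinal jd).2 + 2 == a)%N.
  by rewrite /= ki ij s eqxx.
exact: (a0 (exist _ (Ordinal kd, Ordinal id, Ordinal jd) h)).
Qed.

Lemma eq0_of_tvolt alpha : type_invariant A alpha ->
  (forall i j, edge i j -> tvolt A alpha i j = 0) -> alpha = 0.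
Proof.
move=> ia a0; apply: eq_volt => S S' SS'.
by rewrite volt0 (tvoltE ia SS') a0 //; apply: adj_type_edge.
Qed.

Lemma coordinates_ker alpha : cocycle alpha -> loopless A alpha -> type_invariant A alpha ->
  coordinates alpha = 0 -> alpha = switching d A (tree_potential alpha).
Proof.
move=> ca la ia c0; apply/eqP; rewrite -subr_eq0; apply/eqP.
apply: eq0_of_tvolt; first exact: normalise_invariant.
apply: (@normalised_eq0 (normalise alpha)).
- rewrite /normalise addrC -scaleN1r; apply: cocycleD => //.
  by apply: cocycleZ; apply: switching_cocycle.
- rewrite /normalise addrC -scaleN1r; apply: loopless_lin => //.
  exact: switching_loopless.
- exact: normalise_invariant.
- exact: normaliseP.
move=> p; rewrite tvolt_normalise ?triple_edge //.
by have /ffunP/(_ p) := c0; rewrite !ffunE.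
Qed.

Lemma coordinates_surj (g : {ffun triple d a -> ('F_2)^o}) : exists alpha,
  [/\ cocycle alpha, loopless A alpha, type_invariant A alpha & coordinates alpha = g].
Proof.
have [x <-] := coord_surj g; set f := rect_sum d (sym_ext x).
have fC i j : f i j = f j i by apply: rect_sumC; apply: sym_ext12.
exists (of_types d A f); split.
- apply: of_types_cocycle => // i j k ijk.
  apply: (rect_sum_triangle d (sym_ext12 x) (sym_ext23 x) (sym_ext_diag x) (@sym_ext_supp _ _ x)).
  by have := card_blocks; move: ijk; rewrite /type_triangle; lia.
- apply: of_types_loopless => // i; exact: (rect_sum_loopless d (sym_ext12 x) (sym_ext_diag x)).
- exact: of_types_invariant.
apply/ffunP => p; rewrite coordinates_normalised ?tvolt_of_types ?triple_edge ?ffunE //.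
move=> i j ij ijE; rewrite tvolt_of_types //.
exact: (rect_sum_normalised (b := b) (sym_ext12 x) (sym_ext23 x) (sym_ext_diag x) ij ijE).
Qed.

Lemma normalised_class_uniq alpha beta :
  type_invariant A alpha -> type_invariant A beta ->
  tree_normalised d a b (tvolt A alpha) -> tree_normalised d a b (tvolt A beta) ->
  type_switching A (alpha - beta) -> alpha = beta.
Proof.
move=> ia ib na nb [s sE]; apply/eqP; rewrite -subr_eq0; apply/eqP.
have iab : type_invariant A (alpha - beta).
  by rewrite addrC -scaleN1r; apply: type_invariant_lin.
apply: eq0_of_tvolt => //.
apply: (normalised_switching0 card_blocks A_small (s := s)).
  move=> i j /(realise_edge d_gt0)[S [S' [SS' <- <-]]].
  by rewrite -tvoltE // sE.
by move=> i j t ij; rewrite tvoltB na ?nb // addr0.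
Qed.

Theorem type_invariant_space : (3 <= d)%N -> exists Z B : {vspace voltage K},
  [/\ forall alpha, alpha \in Z <->
         [/\ local_nbhd_preserving alpha, loopless A alpha & type_invariant A alpha],
       forall alpha, alpha \in B <-> type_switching A alpha,
       (B <= Z)%VS,
       (\dim {: subquot Z B})%:R = coefz (gauss_binomial d 3) (a%:Z - 5)
     & (forall c : subquot Z B, exists! alpha : subvs_of Z,
          subclass B alpha = c /\ vanishes_on A (tree_pair d a) (vsval alpha))
       /\
       exists2 phi : {linear subquot Z B -> {ffun triple d a -> ('F_2)^o}},
         bijective phi &
         forall t : triple d a,
           (exists S S' : K, adj S S' /\ has_types A S S' (triple_i t) (triple_j t))
           /\
           forall alpha : subvs_of Z, vanishes_on A (tree_pair d a) (vsval alpha) ->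
             forall S S' : K, adj S S' -> has_types A S S' (triple_i t) (triple_j t) ->
               phi (subclass B alpha) t = volt (vsval alpha) S S'].
Proof.
move=> d3; have [Z ZP] := invariant_vspace d A; have [B BP] := switching_vspace d A.
have ZI alpha : alpha \in Z ->
    [/\ cocycle alpha, loopless A alpha & type_invariant A alpha].
  by case/ZP=> /lnpP.
have BE alpha : alpha \in B -> exists s, alpha = switching d A s.
  by move/BP/switchingP.
have sB s : switching d A s \in B by apply/BP/switchingP; exists s.
have sZ s : switching d A s \in Z.
  apply/ZP; split; [exact/lnpP/switching_cocycle|exact: switching_loopless|].
  exact: switching_invariant.
have BZ : (B <= Z)%VS by apply/subvP => alpha /BE[s ->].
have cker alpha : alpha \in Z -> (alpha \in B) = (coordinates alpha == 0).
  case/ZI=> ca la ia; apply/idP/eqP => [/BE[s ->]|c0]; first exact: coordinates_switching.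
  by rewrite (coordinates_ker ca la ia c0).
have conto g : exists2 alpha, alpha \in Z & coordinates alpha = g.
  have [alpha [ca la ia <-]] := coordinates_surj g; exists alpha => //.
  by apply/ZP; split=> //; apply/lnpP.
have [phi phi_bij phiE] := subquot_iso cker conto.
have vanE (alpha : subvs_of Z) : vanishes_on A (tree_pair d a) (vsval alpha) ->
    tree_normalised d a b (tvolt A (vsval alpha)).
  have [_ _ ia] := ZI _ (subvsP alpha).
  by move/(vanishes_onP d_gt0 ia tree_pair_edge') => h i j ij _; apply: h.
exists Z, B; split=> //.
  by rewrite (dim_linear_bij phi_bij) dim_ffunF2 card_triple.
split=> [c|].
  have [z zc] : exists z, subclass B z = c.
    by exists (repr (c : vquot _)); apply: vclassK.
  have [cz lz iz] := ZI _ (subvsP z).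
  have nZ : normalise (vsval z) \in Z by rewrite rpredB ?subvsP.
  exists (Subvs nZ); split.
    split.
      rewrite -zc; apply/eq_subclass; rewrite /= /normalise addrAC subrr add0r.
      by rewrite rpredN.
    apply/(vanishes_onP d_gt0 (normalise_invariant iz) tree_pair_edge') => i j ij.
    exact: normaliseP (tree_pair_edge' ij).
  move=> z' [z'c vz']; apply: val_inj => /=.
  have [_ _ iz'] := ZI _ (subvsP z').
  apply: normalised_class_uniq; [exact: normalise_invariant|exact: iz'|exact: normaliseP| |].
    exact: vanE.
  have zz' : vsval z - vsval z' \in B by apply/eq_subclass; rewrite zc z'c.
  by apply/BP; rewrite /normalise addrAC rpredB.
exists phi => // t; split.
  have [S [S' [SS' Si S'j]]] := realise_edge d_gt0 (triple_edge t).
  by exists S, S'; split; rewrite // -Si -S'j has_types_refl.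
move=> alpha va S S' SS' ty; have [_ _ ia] := ZI _ (subvsP alpha).
rewrite phiE coordinates_normalised ?(tvolt_has_types ia SS' ty) //; exact: vanE.
Qed.

End Coordinates.

(** * Kneser graphs: connectedness and neighbourhoods *)

Section KneserGraph.
Variables (T : finType) (d : nat).
Hypothesis d_gt0 : (0 < d)%N.
Local Notation K := (kneser T d).

(** Exchanging one point at a time: two sets that differ in one point have a common
    neighbour. *)
Lemma kneser_connected : (2 * d + 1 <= #|T|)%N -> connected_graph K.
Proof.
move=> T_large; apply/andP; split.
  have [X _ X_d] : exists2 X : {set T}, X \subset setT & #|X| = d.
    by apply: exists_card_subset; rewrite cardsT; lia.
  have hX : #|X| == d by rewrite X_d.
  by apply/card_gt0P; exists (exist (fun Y : {set T} => #|Y| == d) X hX).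
apply/forallP => S; apply/forallP => S'.
have [n Sn] : exists n, #|val S :\: val S'| = n by eexists.
elim: n S Sn => [|n IHn] S Sn.
  suff -> : S = S' by apply: connect0.
  apply/val_inj/eqP; rewrite eqEcard !card_vertex leqnn andbT.
  by rewrite -setD_eq0 -cards_eq0 Sn.
have [x] : exists x, x \in val S :\: val S' by apply/card_gt0P; rewrite Sn.
rewrite inE => /andP[xS' xS].
have [y] : exists y, y \in val S' :\: val S.
  apply/card_gt0P; have := cardsID (val S) (val S'); have := cardsID (val S') (val S).
  by rewrite setIC Sn !card_vertex; lia.
rewrite inE => /andP[yS yS'].
have xy : x \notin [set y] by rewrite inE; apply: contraNneq xS' => ->.
have [S1 S1E _] := raise_type xS xy yS (set11 y).
have S1n : #|val S1 :\: val S'| = n.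
  have -> : val S1 :\: val S' = (val S :\: val S') :\ x.
    apply/setP => z; rewrite S1E !inE; case: (eqVneq z y) => [->|] /=.
      by rewrite yS' (negPf yS) !andbF.
    by rewrite andbCA.
  by have := cardsD1 x (val S :\: val S'); rewrite inE xS' xS Sn add1n => -[] <-.
have [X XU X_d] : exists2 X : {set T}, X \subset ~: (y |: val S) & #|X| = d.
  apply: exists_card_subset; have := cardsC (y |: val S).
  by rewrite cardsU1 yS card_vertex; lia.
have hX : #|X| == d by rewrite X_d.
pose U : K := exist (fun Y : {set T} => #|Y| == d) X hX.
have UyS : [disjoint val U & y |: val S] by rewrite disjoints_subset.
have US : adj S U.
  by rewrite kneser_adjE // disjoint_sym; apply: disjointWr UyS; apply: subsetUr.
have US1 : adj U S1.
  rewrite kneser_adjE // S1E; apply: disjointWr UyS; apply: setUS; exact: subsetDl.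
exact: connect_trans (connect1 US) (connect_trans (connect1 US1) (IHn _ S1n)).
Qed.

Lemma nbhd_kneser (T' : finType) (S : K) (h : T' -> T) : injective h ->
  codom h =i ~: val S -> graph_iso (induced (nbhd S)) (kneser T' d).
Proof.
move=> h_inj h_im.
have sub_im (U : induced (nbhd S)) : val (val U) \subset codom h.
  have := valP U; rewrite inE kneser_adjE // disjoint_sym disjoints_subset => US.
  by apply/subsetP => x xU; rewrite h_im (subsetP US).
have imK (U : induced (nbhd S)) : h @: (h @^-1: val (val U)) = val (val U).
  apply/setP => x; apply/imsetP/idP => [[y]|xU]; first by rewrite inE => yU ->.
  by have /codomP[y xy] := subsetP (sub_im U) x xU; exists y; rewrite // inE -xy.
have fP (U : induced (nbhd S)) : #|h @^-1: val (val U)| == d.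
  by rewrite -(card_imset _ h_inj) imK card_vertex.
pose f (U : induced (nbhd S)) : kneser T' d :=
  exist (fun X : {set T'} => #|X| == d) _ (fP U).
have fE U : val (f U) = h @^-1: val (val U) by [].
have gP (V : kneser T' d) : #|h @: val V| == d by rewrite card_imset // card_vertex.
pose g0 (V : kneser T' d) : K := exist (fun X : {set T} => #|X| == d) _ (gP V).
have gN (V : kneser T' d) : g0 V \in nbhd S.
  rewrite inE kneser_adjE // disjoint_sym disjoints_subset; apply/subsetP => x.
  by case/imsetP=> y _ ->; rewrite -h_im codom_f.
exists f => [|U V].
  exists (fun V => exist _ (g0 V) (gN V)) => [U|V]; first by do 2!apply: val_inj; apply: imK.
  by apply: val_inj; apply/setP => y; rewrite /= inE mem_imset.
rewrite kneser_adjE // -[RHS]/(adj (val U) (val V)) kneser_adjE // !fE.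
by rewrite -[LHS](imset_disjoint h_inj) !imK.
Qed.

End KneserGraph.

(** * Covers, coordinates and rigidity for one block *)

Section OneBlock.
Variable d : nat.
Hypothesis d3 : (3 <= d)%N.
Let d_gt0 : (0 < d)%N. Proof. exact: leq_trans d3. Qed.

(** For a block of five points [(0, 1, 2)] is a triple.  A voltage with coordinate 1
    there is not a coboundary: coboundaries have zero mixed differences, so a
    type-invariant one is a switching and has zero coordinates. *)
Lemma exists_locally_kneser : exists G : sgraph,
  [/\ connected_graph G, #|G| = (2 * 'C(3 * d + 1, d))%N
    & locally (kneser 'I_(2 * d + 1) d) G].
Proof.
pose T := 'I_(3 * d + 1); pose K := kneser T d.
have cardT : #|T| = (3 * d + 1)%N by rewrite card_ord.
have [A _ A5] : exists2 A : {set T}, A \subset setT & #|A| = 5%N.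
  by apply: exists_card_subset; rewrite cardsT cardT; lia.
have A_small : (2 * #|A| <= 3 * d + 1)%N by rewrite A5; lia.
have [alpha [ca la ia c1]] := coordinates_surj d_gt0 cardT A_small
  [ffun=> 1 : ('F_2)^o].
have not_cob : ~ exists f, alpha = coboundary f.
  case=> f aE.
  have tri i j k := tvolt_triangle (i := i) (j := j) (k := k) d_gt0 ia ca.
  have ab := card_blocks A cardT.
  have ab_large : (3 * d + 1 <= #|A| + #|~: A|)%N by rewrite ab.
  have mixed0 t u := coboundary_mixed_diff d_gt0 ia aE (t := t) (u := u).
  have aS : alpha = switching d A (potential d #|~: A| (tvolt A alpha)).
    apply: (eq_tvolt d_gt0 ia); first exact: switching_invariant.
    move=> i j ij; rewrite tvolt_switching //.
    exact: (mixed0_switching (tvoltC A alpha) tri ab_large mixed0).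
  move: c1; rewrite aS coordinates_switching // => /ffunP.
  have d2 : (2 < d)%N by []; have d1 : (1 < d)%N by apply: ltnW.
  pose p := (Ordinal d_gt0, Ordinal d1, Ordinal d2).
  have hp : (p.1.1 < p.1.2)%N && (p.1.2 < p.2)%N && (p.1.1 + p.1.2 + p.2 + 2 == #|A|)%N.
    by rewrite A5.
  by move/(_ (exist _ p hp)); rewrite !ffunE => /eqP; rewrite eq_sym oner_eq0.
have cK : connected_graph K by apply: kneser_connected; rewrite ?cardT //; lia.
exists (lift_graph alpha); split.
- by apply: contraT => /(disconnected_coboundary cK).
- by rewrite card_lift card_sig /= -cardsE card_draws cardT.
move=> x; have /lnpP/forallP/(_ x) := ca.
move/restricts_graph_iso => iso1; apply: graph_iso_trans iso1 _.
have cS : #|~: val (lift_proj x)| = (2 * d + 1)%N.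
  by have := cardsC (val (lift_proj x)); rewrite card_vertex cardT; lia.
pose h (i : 'I_(2 * d + 1)) : T := enum_val (cast_ord (esym cS) i).
apply: (@nbhd_kneser _ _ d_gt0 _ _ h) => [i j /enum_val_inj/cast_ord_inj //|y].
apply/codomP/idP => [[i ->]|yS]; first exact: enum_valP.
exists (cast_ord cS (enum_rank_in yS y)).
by rewrite /h cast_ordK enum_rankK_in.
Qed.

(** Types with respect to the complementary block are [d - i]. *)
Section Complement.
Variables (T : finType) (A : {set T}).
Local Notation K := (kneser T d).

Lemma vtypeC (S : K) : vtype (~: A) S = (d - vtype A S)%N.
Proof.
have := cardsID A (val S); rewrite card_vertex setDE /vtype; lia.
Qed.

Lemma vtypeC_eq (S S' : K) : (vtype (~: A) S == vtype (~: A) S') = (vtype A S == vtype A S').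
Proof. by rewrite !vtypeC; have := vtype_le A S; have := vtype_le A S'; lia. Qed.

Lemma looplessC (alpha : voltage K) : loopless (~: A) alpha <-> loopless A alpha.
Proof.
by split=> ll S S' SS' /eqP e; apply: ll => //; apply/eqP; rewrite vtypeC_eq in e *.
Qed.

Lemma has_typesC_compl (S1 S2 S3 S4 : K) :
  has_types (~: A) S1 S2 (vtype (~: A) S3) (vtype (~: A) S4) =
  has_types A S1 S2 (vtype A S3) (vtype A S4).
Proof.
by apply/has_typesP/has_typesP => -[] [/eqP e1 /eqP e2]; [left|right|left|right];
  split; apply/eqP; first [by rewrite vtypeC_eq | by rewrite -vtypeC_eq].
Qed.

Lemma type_invariantC (alpha : voltage K) :
  type_invariant (~: A) alpha <-> type_invariant A alpha.
Proof.
by split=> inv S1 S2 S3 S4 e12 e34 t; apply: inv; rewrite // has_typesC_compl in t *.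
Qed.

Lemma type_switchingC (alpha : voltage K) :
  type_switching (~: A) alpha <-> type_switching A alpha.
Proof.
split=> -[s sE]; exists (fun i => s (d - i)%N) => S S' SS'; rewrite sE // !vtypeC //.
by rewrite !subKn ?vtype_le.
Qed.

End Complement.

Lemma type_invariant_classes (Omega : finType) (A : {set Omega}) :
  #|Omega| = (3 * d + 1)%N ->
  let a' := minn #|A| (3 * d + 1 - #|A|)%N in
  let A' := if (2 * #|A| <= 3 * d + 1)%N then A else ~: A in
  exists Z B : {vspace voltage (kneser Omega d)},
  [/\ forall alpha, alpha \in Z <->
        [/\ local_nbhd_preserving alpha, loopless A alpha
          & type_invariant A alpha],
      forall alpha, alpha \in B <-> type_switching A alpha,
      (B <= Z)%VS,
      (\dim {: subquot Z B})%:R = coefz (gauss_binomial d 3) (a'%:Z - 5)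
    & (forall c : subquot Z B, exists! alpha : subvs_of Z,
         subclass B alpha = c /\
         vanishes_on A' (tree_pair d a') (vsval alpha))
      /\
      exists2 phi : {linear subquot Z B -> {ffun triple d a' -> ('F_2)^o}},
        bijective phi &
        forall t : triple d a',
          (exists S S' : kneser Omega d,
             adj S S' /\ has_types A' S S' (triple_i t) (triple_j t))
          /\
          forall alpha : subvs_of Z,
            vanishes_on A' (tree_pair d a') (vsval alpha) ->
            forall S S' : kneser Omega d,
              adj S S' -> has_types A' S S' (triple_i t) (triple_j t) ->
              phi (subclass B alpha) t = volt (vsval alpha) S S'].
Proof.
move=> cardT a' A'; have cC := cardsC A; rewrite cardT in cC.
have a'E : a' = #|A'| by rewrite /a' /A'; case: ifP; lia.
have A'_small : (2 * #|A'| <= 3 * d + 1)%N by rewrite -a'E /a'; lia.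
rewrite a'E; have [Z [B [ZP BP BZ dimZ [uniqZ phiZ]]]] :=
  type_invariant_space d_gt0 cardT A'_small d3.
exists Z, B; split=> // alpha; rewrite ?ZP ?BP /A'; case: ifP => // _.
  have := looplessC A alpha; have := type_invariantC A alpha.
  by move=> iC lC; split=> -[lnp l i]; split=> //; [apply/lC|apply/iC|apply/lC|apply/iC].
exact: type_switchingC.
Qed.

Lemma type_invariant_rigid (n : nat) : (2 * d + 2 <= n <= 3 * d)%N ->
  forall (Omega : finType) (A : {set Omega}), #|Omega| = (n + d)%N ->
  forall alpha : voltage (kneser Omega d),
    loopless A alpha -> type_invariant A alpha ->
    local_nbhd_preserving alpha -> type_gauge_equiv A alpha 0.
Proof.
move=> /andP[n_ge _] Omega A cardO alpha la ia /lnpP ca.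
by apply: type_gauge_trivial => //; rewrite cardO; lia.
Qed.

End OneBlock.

(** * Subsets of a ten-point set as lists *)

Fixpoint sublists (k : nat) (s : seq nat) : seq (seq nat) :=
  match k, s with
  | 0, _ => [:: [::]]
  | _, [::] => [::]
  | k'.+1, x :: s' => [seq x :: t | t <- sublists k' s'] ++ sublists k s'
  end.

Lemma mem_sublists k s t : (t \in sublists k s) = subseq t s && (size t == k).
Proof.
elim: s k t => [|x s IHs] [|k] t; try by case: t => [|y t]; rewrite ?inE ?andbF.
rewrite /= mem_cat IHs; case: t => [|y t]; first by rewrite !sub0seq /= orbF; apply/mapP => -[].
rewrite /= eqSS; case: (eqVneq y x) => [->|yx].
  rewrite mem_map => [|? ? [] //]; rewrite IHs; case: eqP => [_|]; rewrite ?andbF ?orbF //.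
  rewrite !andbT; apply/orb_idr => h; apply: subseq_trans h; exact: subseq_cons.
by case: mapP => [[z _ [yz]]|_] //=; rewrite yz eqxx in yx.
Qed.

Section Lists.
Variable n : nat.

Definition lset (s : seq nat) : {set 'I_n} := [set i : 'I_n | val i \in s].

(** Lists without repetition of numbers below [n] stand for subsets of ['I_n]. *)
Definition is_list (k : nat) (s : seq nat) := [&& uniq s, size s == k & all (gtn n) s].

Lemma sublists_is_list k s : s \in sublists k (iota 0 n) -> is_list k s.
Proof.
rewrite mem_sublists /is_list => /andP[ss ->]; rewrite (subseq_uniq ss (iota_uniq 0 n)) /=.
by apply/allP => x /(mem_subseq ss); rewrite mem_iota.
Qed.

Lemma lset_surj k (X : {set 'I_n}) : #|X| = k ->
  exists2 s, s \in sublists k (iota 0 n) & lset s = X.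
Proof.
move=> Xk; exists (map val (enum X)).
  rewrite mem_sublists size_map -cardE Xk eqxx andbT -val_enum_ord map_subseq //.
  by rewrite {1}/enum_mem -enumT filter_subseq.
by apply/setP => i; rewrite inE mem_map ?mem_enum //; apply: val_inj.
Qed.

Lemma card_lsetI k s (P : pred nat) : is_list k s ->
  #|[set i in lset s | P (val i)]| = count P s.
Proof.
case/and3P=> s_uniq _ /allP s_n.
rewrite -size_filter.
have -> : #|[set i in lset s | P (val i)]| =
    size (map val (enum [set i in lset s | P (val i)])) by rewrite size_map -cardE.
apply: perm_size; apply: uniq_perm; rewrite ?filter_uniq //.
  by rewrite map_inj_uniq ?enum_uniq //; apply: val_inj.
move=> x; rewrite mem_filter; apply/mapP/andP => [[i] | [Px xs]].
  by rewrite mem_enum !inE => /andP[ix Pi] ->.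
by exists (Ordinal (s_n x xs)); rewrite // mem_enum !inE /= xs.
Qed.

Lemma card_lset k s : is_list k s -> #|lset s| = k.
Proof.
move=> ks; have := card_lsetI xpredT ks; rewrite count_predT.
have -> : [set i in lset s | true] = lset s by apply/setP => i; rewrite !inE andbT.
by move=> ->; case/and3P: ks => _ /eqP.
Qed.

Lemma card_lset_cap k s t : is_list k s -> #|lset s :&: lset t| = count (mem t) s.
Proof.
move=> ks; rewrite -(card_lsetI (mem t) ks); congr #|pred_of_set _|.
by apply/setP => i; rewrite !inE.
Qed.

Lemma disjoint_lset k s t : is_list k s -> [disjoint lset s & lset t] = ~~ has (mem t) s.
Proof.
move=> ks; rewrite -setI_eq0 -cards_eq0 (card_lset_cap _ ks) has_count.
by rewrite lt0n negbK.
Qed.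

End Lists.

(** * Two of three: consequences of the triangle condition *)

(** Rows of booleans record which edges are known to carry the value 0. *)
Fixpoint has2 (r r' : bitseq) : bool :=
  if r is b :: r1 then
    if r' is c :: r1' then if (if b then c else false) then true else has2 r1 r1' else false
  else false.

Definition spread (adjm m : seq bitseq) : seq bitseq :=
  [seq [seq if q.1.2 then true else if q.1.1 then has2 p.2 q.2 else false
       | q <- zip (zip p.1 p.2) m] | p <- zip adjm m].

Section Spread.
Variables (G : sgraph) (vs : seq G) (x0 : G) (alpha : voltage G).
Hypothesis ca : cocycle alpha.
Let v i := nth x0 vs i.

Definition square_rows k (m : seq bitseq) := (size m == k) && all (fun r => size r == k) m.

Definition entry (m : seq bitseq) i j : bool := nth false (nth [::] m i) j.

Definition known0 (m : seq bitseq) : Prop := forall i j,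
  entry m i j -> adj (v i) (v j) /\ volt alpha (v i) (v j) = 0.

Lemma size_zip_eq (T U : Type) k (s : seq T) (t : seq U) :
  size s = k -> size t = k -> size (zip s t) = k.
Proof. by move=> sk tk; rewrite size_zip sk tk minnn. Qed.

Lemma square_row k m i : square_rows k m -> (i < k)%N -> size (nth [::] m i) = k.
Proof.
case/andP=> /eqP mk /all_nthP h ik; apply/eqP; apply: h; by rewrite mk.
Qed.

Lemma has2P r r' : has2 r r' -> exists2 j, nth false r j & nth false r' j.
Proof.
elim: r r' => [|b r IHr] [|c r'] //=; case bc: (if b then c else false).
  by move=> _; exists 0%N; case: b bc.
by move=> /IHr[j rj r'j]; exists j.+1.
Qed.

Lemma spread_square k adjm m : square_rows k adjm -> square_rows k m -> square_rows k (spread adjm m).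
Proof.
move=> sa sm; have [/eqP ak _] := andP sa; have [/eqP mk _] := andP sm.
rewrite /square_rows size_map (size_zip_eq ak mk) eqxx /=.
apply/(all_nthP [::]) => i; rewrite size_map (size_zip_eq ak mk) => ik.
rewrite (nth_map ([::], [::])) ?(size_zip_eq ak mk) // size_map nth_zip ?ak ?mk //=.
rewrite (@size_zip_eq _ _ k) //; apply: size_zip_eq; exact: square_row.
Qed.

Lemma entry_spread k adjm m i j : square_rows k adjm -> square_rows k m ->
  entry (spread adjm m) i j ->
  entry m i j || entry adjm i j && has2 (nth [::] m i) (nth [::] m j).
Proof.
move=> sa sm; have [/eqP ak _] := andP sa; have [/eqP mk _] := andP sm.
rewrite /entry; case: (ltnP i k) => [ik|ki]; last first.
  rewrite [nth [::] (spread _ _) i]nth_default ?nth_nil //.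
  by rewrite size_map (size_zip_eq ak mk).
rewrite (nth_map ([::], [::])) ?(size_zip_eq ak mk) // nth_zip ?ak ?mk //=.
have rz : size (zip (nth [::] adjm i) (nth [::] m i)) = k.
  by apply: size_zip_eq; apply: square_row.
case: (ltnP j k) => [jk|kj]; last first.
  by rewrite nth_default // size_map (size_zip_eq rz mk).
rewrite (nth_map (false, false, [::])) ?(size_zip_eq rz mk) // nth_zip ?rz ?mk //=.
rewrite nth_zip ?(square_row sa) ?(square_row sm) //=.
Qed.

(** If [il] and [jl] are edges with value 0 and [ij] is an edge, then [ijl] is a
    triangle. *)
Lemma spread_known0 k adjm m : square_rows k adjm -> square_rows k m ->
  (forall i j, entry adjm i j -> adj (v i) (v j)) ->
  known0 m -> known0 (spread adjm m).
Proof.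
move=> sa sm adjP m0 i j /(entry_spread sa sm)/orP[/m0 //|/andP[/adjP ij]].
case/has2P=> l /m0[il il0] /m0[jl jl0].
split=> //; have := ca ij jl il; rewrite il0 jl0 !addr0; exact.
Qed.

Lemma iter_spread_known0 k adjm m t : square_rows k adjm -> square_rows k m ->
  (forall i j, entry adjm i j -> adj (v i) (v j)) ->
  known0 m -> known0 (iter t (spread adjm) m).
Proof.
move=> sa sm adjP m0; suff [] : square_rows k (iter t (spread adjm) m) /\
  known0 (iter t (spread adjm) m) by [].
elim: t => [|t [st kt]] //=; split; first exact: spread_square.
exact: (spread_known0 sa st adjP kt).
Qed.

End Spread.

(** * Counting solutions of linear systems over the field with two elements *)

Definition xors (r q : bitseq) : bitseq := [seq p.1 (+) p.2 | p <- zip r q].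
Definition dot (x r : bitseq) : bool := foldr (fun p b => p.1 && p.2 (+) b) false (zip x r).

(** Gaussian elimination, one variable at a time. *)
Fixpoint nullity (n : nat) (rows : seq bitseq) : nat :=
  if n is n'.+1 then
    if [seq r <- rows | head false r] is r :: _ then
      nullity n' [seq if head false q then xors (behead q) (behead r) else behead q
                 | q <- rows]
    else (nullity n' (map behead rows)).+1
  else 0.

Fixpoint allbits (n : nat) : seq bitseq :=
  if n is n'.+1 then [seq false :: x | x <- allbits n'] ++ [seq true :: x | x <- allbits n']
  else [:: [::]].

Definition solves (rows : seq bitseq) (x : bitseq) := all (fun r => ~~ dot x r) rows.

Lemma dot_cons b x c r : dot (b :: x) (c :: r) = b && c (+) dot x r.
Proof. by []. Qed.

Lemma dot_xors x r q : size r = size x -> size q = size x ->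
  dot x (xors r q) = dot x r (+) dot x q.
Proof.
elim: x r q => [|b x IHx] [|c r] [|e q] //= [sr] [sq].
rewrite -[xors (c :: r) _]/((c (+) e) :: xors r q) !dot_cons IHx //.
by case: b; case: c; case: e; case: (dot x r); case: (dot x q).
Qed.

Lemma mem_allbits n x : (x \in allbits n) = (size x == n).
Proof.
elim: n x => [|n IHn] [|b x] //=; rewrite mem_cat.
  by apply/negbTE; rewrite negb_or; apply/andP; split; apply/mapP => -[].
rewrite eqSS -IHn; case: b.
  rewrite [X in _ || X]mem_map ?orb_idl // => [|? ? [] //]; by case/mapP.
rewrite mem_map ?orb_idr // => [|? ? [] //]; by case/mapP.
Qed.

Lemma allbits_uniq n : uniq (allbits n).
Proof.
elim: n => //= n IHn; rewrite cat_uniq !map_inj_uniq ?IHn => [|? ? [] //|? ? [] //].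
by rewrite andbT; apply/hasPn => _ /mapP[x _ ->]; apply/mapP => -[].
Qed.

Lemma count_add (T : eqType) (P Q R : pred T) (s : seq T) :
  {in s, forall x, P x + Q x = R x :> nat}%N -> (count P s + count Q s = count R s)%N.
Proof.
elim: s => //= x s IHs h; rewrite addnACA h ?mem_head // IHs // => y ys.
by apply: h; rewrite inE ys orbT.
Qed.

(** A pivot row determines the first variable from the others; without a pivot the
    first variable is free. *)
Lemma nullityP n rows : all (fun r => size r == n) rows ->
  count (solves rows) (allbits n) = (2 ^ nullity n rows)%N.
Proof.
elim: n rows => [|n IHn] rows rows_n /=.
  rewrite expn0 addn0; suff -> : solves rows [::] by [].
  by apply/allP => r; rewrite /dot; case: r.
have rowsE : rows = [seq head false r :: behead r | r <- rows].
  rewrite -[LHS]map_id; apply/eq_in_map => r /(allP rows_n).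
  by case: r.
have beh_n r : r \in rows -> size (behead r) == n.
  by move/(allP rows_n); rewrite size_behead => /eqP->.
rewrite count_cat !count_map.
case E: [seq r <- rows | head false r] => [|r s].
  rewrite expnS mul2n -addnn -IHn; last first.
    by rewrite all_map; apply/allP => r /beh_n.
  have head0 q : q \in rows -> head false q = false.
    move=> qrows; apply/negbTE/negP => hq.
    by have := mem_filter (head false) q rows; rewrite E hq qrows.
  congr (_ + _)%N; apply: eq_count => x; rewrite /= /solves all_map [in LHS]rowsE all_map;
    by apply: eq_in_all => q /head0 /=; rewrite dot_cons => ->; rewrite andbF.
have [rrows hr] : r \in rows /\ head false r.
  by have := mem_filter (head false) r rows; rewrite E mem_head => /esym/andP[].
set rows' := map _ _; have rows'_n : all (fun q => size q == n) rows'.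
  rewrite all_map; apply/allP => q qrows /=; case: ifP => _; last exact: beh_n.
  by rewrite size_map size_zip (eqP (beh_n _ qrows)) (eqP (beh_n _ rrows)) minnn.
rewrite -IHn //.
have key x b : size x = n -> solves rows (b :: x) = (b == dot x (behead r)) && solves rows' x.
  move=> xn; have dotE q : q \in rows -> dot (b :: x) q = b && head false q (+) dot x (behead q).
    by move/(allP rows_n); case: q.
  apply/idP/andP => [sol|[/eqP bE sol]].
    have bE : b = dot x (behead r).
      have := allP sol _ rrows; rewrite dotE // hr andbT.
      by case: (b); case: (dot _ _).
    split; first exact/eqP.
    rewrite /solves all_map; apply/allP => q qrows /=.
    have := allP sol _ qrows; rewrite dotE //; case: ifP => hq; rewrite ?andbF //.
    by rewrite andbT dot_xors ?xn ?(eqP (beh_n _ _)) // -bE addbC.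
  apply/allP => q qrows; rewrite dotE //.
  move: sol; rewrite /solves all_map => /allP/(_ q qrows) /=.
  case: ifP => hq; rewrite ?andbF // andbT dot_xors ?xn ?(eqP (beh_n _ _)) // -bE.
  by rewrite addbC.
apply: count_add => x; rewrite mem_allbits => /eqP xn /=; rewrite !key //.
by case: (dot x _); case: (solves rows' x).
Qed.

Lemma dot_nseq0 n r : dot (nseq n false) r = false.
Proof. by elim: n r => [|n IHn] [|b r] //; rewrite dot_cons IHn. Qed.

Lemma nullity0_inj n rows x : all (fun r => size r == n) rows -> nullity n rows = 0%N ->
  size x = n -> solves rows x -> x = nseq n false.
Proof.
move=> /nullityP + null0 xn sol_x; rewrite null0 expn0 -size_filter => c1.
have : x \in filter (solves rows) (allbits n) by rewrite mem_filter mem_allbits xn sol_x /=.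
have : nseq n false \in filter (solves rows) (allbits n).
  rewrite mem_filter mem_allbits size_nseq eqxx andbT.
  by apply/allP => r _; rewrite dot_nseq0.
by case: (filter _ _) c1 => [|z [|//]] // _; rewrite !inE => /eqP-> /eqP.
Qed.

(** * The graph K(10,3) *)

Section OmegaVoltages.
Local Notation K := (kneser 'I_10 3).
Implicit Types (A : {set 'I_10}) (S : K).

Definition one_two (i j : nat) : bool := (i == 1) && (j == 2) || (i == 2) && (j == 1).

Definition omega A : voltage K := of_types 3 A (fun i j => (one_two i j)%:R).

Lemma one_twoC i j : one_two i j = one_two j i.
Proof. by rewrite /one_two orbC andbC (andbC (i == 1)). Qed.

Lemma volt_omega A S S' : adj S S' ->
  volt (omega A) S S' = (one_two (vtype A S) (vtype A S'))%:R.
Proof. by move=> SS'; rewrite volt_of_types // => i j; rewrite one_twoC. Qed.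

(** On five plus five points a triangle leaves one point over, so its types add up to 4
    or 5; the pair of types 1 and 2 occurs an even number of times in each case. *)
Lemma cocycle_omega A : #|A| = 5%N -> cocycle (omega A).
Proof.
move=> A5; have cA : #|~: A| = 5%N by have := cardsC A; rewrite A5 card_ord; lia.
apply: of_types_cocycle => // [i j|i j k]; first by rewrite one_twoC.
rewrite A5 cA /type_triangle => /and5P[]; case: i => [|[|[|[|i]]]] // _.
all: case: j => [|[|[|[|j]]]] // _; case: k => [|[|[|[|k]]]] // _ _ _.
all: f2done.
Qed.

End OmegaVoltages.

Section KneserTen.
Local Notation K := (kneser 'I_10 3).
Local Notation pts := (iota 0 10).
Implicit Types (A : {set 'I_10}) (S : K) (alpha beta : voltage K).

Fact vertex012_subproof : #|lset 10 [:: 0; 1; 2]%N| == 3.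
Proof. by rewrite (card_lset (k := 3)). Qed.
Definition vertex012 : K := exist _ (lset 10 [:: 0; 1; 2]%N) vertex012_subproof.

Definition vtx (s : seq nat) : K := insubd vertex012 (lset 10 s).

Lemma val_vtx s : is_list 10 3 s -> val (vtx s) = lset 10 s.
Proof. by move=> hs; rewrite val_insubd (card_lset hs). Qed.

Lemma adj_vtx s t : is_list 10 3 s -> is_list 10 3 t -> adj (vtx s) (vtx t) = ~~ has (mem t) s.
Proof.
by move=> hs ht; rewrite kneser_adjE // !val_vtx // (disjoint_lset _ hs).
Qed.

Lemma vtype_vtx l s : is_list 10 3 s -> vtype (lset 10 l) (vtx s) = count (mem l) s.
Proof. by move=> hs; rewrite /vtype val_vtx // (card_lset_cap _ hs). Qed.

Definition triads := sublists 3 pts.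

Lemma vtx_surj S : exists2 s, s \in triads & vtx s = S.
Proof.
have [s s3 sS] := lset_surj (card_vertex S); exists s => //.
by apply: val_inj; rewrite val_vtx ?sublists_is_list.
Qed.

(** ** Five-point blocks and four-cycles *)

Definition om (l s t : seq nat) : bool := one_two (count (mem l) s) (count (mem l) t).

Lemma volt_om l s t : is_list 10 3 s -> is_list 10 3 t -> ~~ has (mem t) s ->
  volt (omega (lset 10 l)) (vtx s) (vtx t) = (om l s t)%:R.
Proof. by move=> hs ht st; rewrite volt_omega ?adj_vtx // !vtype_vtx. Qed.

(** First rows of the standard Young tableaux of shape (5,5), by the ballot condition
    that the entry at place [i] is at most [2 * i]. *)
Definition standard (l : seq nat) := all (fun p => p.1 <= p.2.*2)%N (zip l (iota 0 5)).
Definition std : seq (seq nat) := [seq l <- sublists 5 pts | standard l].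

(** Opposite vertices of the cycle differ by exchanging one point of the set for one of
    the complement.  The choice of these points makes the matrix of holonomies below
    invertible. *)
Definition cyc (l : seq nat) : seq nat * seq nat * seq nat * seq nat :=
  let a := nth 0%N l in let b := nth 0%N [seq i <- pts | i \notin l] in
  ([:: a 0; a 1; a 2], [:: b 0; b 1; a 3], [:: a 0; a 1; b 2], [:: b 0; b 1; b 3])%N.

(** The holonomy of [omega] for the set listed by [l] around the cycle of [q]. *)
Definition hol (l q : seq nat) : bool :=
  let: (s, t, s', t') := cyc q in
  let i := count (mem l) s in let j := count (mem l) t in
  let i' := count (mem l) s' in let j' := count (mem l) t' in
  one_two i j (+) one_two i' j (+) one_two i' j' (+) one_two i j'.

Definition circ alpha (q : seq nat) : 'F_2 :=
  let: (s, t, s', t') := cyc q in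
  volt alpha (vtx s) (vtx t) + volt alpha (vtx s') (vtx t) +
  volt alpha (vtx s') (vtx t') + volt alpha (vtx s) (vtx t').

Definition cyc_ok (q : seq nat) : bool :=
  let: (s, t, s', t') := cyc q in
  [&& all (is_list 10 3) [:: s; t; s'; t'], ~~ has (mem t) s, ~~ has (mem t) s',
      ~~ has (mem t') s' & ~~ has (mem t') s].

Lemma std_ok : (size std == 42%N) && all cyc_ok std && all (is_list 10 5) std.
Proof. by vm_compute. Qed.

Lemma natrF2_addb (b c : bool) : (b (+) c)%:R = b%:R + c%:R :> 'F_2.
Proof. by case: b; case: c; f2done. Qed.

Lemma circ_om l q : cyc_ok q -> circ (omega (lset 10 l)) q = (hol l q)%:R.
Proof.
rewrite /cyc_ok /circ /hol; case: (cyc q) => [[[s t] s'] t'] /=.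
case/and5P=> /and5P[hs ht hs' ht' _] e1 e2 e3 e4.
by rewrite !volt_om // !natrF2_addb.
Qed.

Lemma circ_coboundary (f : {ffun K -> 'F_2}) q : cyc_ok q -> circ (coboundary f) q = 0.
Proof.
rewrite /cyc_ok /circ; case: (cyc q) => [[[s t] s'] t'] /=.
case/and5P=> /and5P[hs ht hs' ht' _] e1 e2 e3 e4.
rewrite !volt_coboundary ?adj_vtx //.
f2 (f (vtx s)); f2 (f (vtx t)); f2 (f (vtx s')); f2 (f (vtx t')); f2done.
Qed.

Lemma circ_is_linear q : linear (fun alpha => circ alpha q : ('F_2)^o).
Proof.
move=> a alpha beta; rewrite /circ; case: (cyc q) => [[[s t] s'] t'].
rewrite !voltD !voltZ.
have sc (x y : 'F_2) : x *: (y : ('F_2)^o) = x * y by [].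
by rewrite sc; ring.
Qed.

Definition std_nth (i : 'I_42) : seq nat := nth [::] std i.

Lemma size_std : size std = 42%N.
Proof. by apply/eqP; have /andP[/andP[]] := std_ok. Qed.

Lemma std_nth_mem i : std_nth i \in std.
Proof. by rewrite mem_nth // size_std. Qed.

Lemma std_nth_ok i : cyc_ok (std_nth i).
Proof. by have /andP[/andP[_ /allP/(_ _ (std_nth_mem i))]] := std_ok. Qed.

Lemma std_nth_list i : is_list 10 5 (std_nth i).
Proof. by have /andP[_ /allP/(_ _ (std_nth_mem i))] := std_ok. Qed.

Definition circs alpha : {ffun 'I_42 -> ('F_2)^o} :=
  [ffun q => circ alpha (std_nth q) : ('F_2)^o].

Lemma circs_is_linear : linear circs.
Proof. by move=> a alpha beta; apply/ffunP => q; rewrite !ffunE circ_is_linear. Qed.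

HB.instance Definition _ := GRing.isSemilinear.Build 'F_2
  (voltage K) {ffun 'I_42 -> ('F_2)^o} _ circs (GRing.semilinear_linear circs_is_linear).

Lemma circs_coboundary f : circs (coboundary f) = 0.
Proof. by apply/ffunP => q; rewrite !ffunE circ_coboundary ?std_nth_ok. Qed.

Definition combination (x : 42.-tuple bool) : voltage K :=
  \sum_(i < 42) (tnth x i)%:R *: omega (lset 10 (std_nth i)).

Lemma cocycle_combination x : cocycle (combination x).
Proof.
rewrite /combination; elim/big_rec: _ => [|i alpha _ ca].
  by move=> S S' S'' _ _ _; rewrite !volt0 !addr0.
apply: cocycleD => //; apply/cocycleZ/cocycle_omega; apply: card_lset.
exact: std_nth_list.
Qed.

Definition hol_rows : seq bitseq := [seq [seq hol l q | l <- std] | q <- std].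

Lemma hol_nullity : nullity 42 hol_rows = 0%N.
Proof. by vm_compute. Qed.

Lemma dotE (n : nat) (x : n.-tuple bool) (r : bitseq) : size r = n ->
  (dot x r)%:R = \sum_(i < n) (tnth x i)%:R * (nth false r i)%:R :> 'F_2.
Proof.
elim: n x r => [|n IHn] x [|c r] //; first by rewrite tuple0 big_ord0.
case/tupleP: x => b x [rn]; rewrite [tval _]/= dot_cons natrF2_addb IHn //.
rewrite big_ord_recl tnth0 /=; congr (_ + _); first by case: b; case: c; f2done.
by apply: eq_bigr => i _; rewrite tnthS.
Qed.

Lemma circs_combination x q : circs (combination x) q =
  (dot x (nth [::] hol_rows q))%:R.
Proof.
have q42 : (q < size std)%N by rewrite size_std.
rewrite /combination linear_sum sum_ffunE dotE; last first.
  by rewrite (nth_map [::]) // size_map size_std.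
apply: eq_bigr => i _; rewrite linearZ /= !ffunE circ_om ?std_nth_ok //.
by rewrite (nth_map [::]) // (nth_map [::]) ?size_std.
Qed.

Definition tuple_addb (x y : 42.-tuple bool) : 42.-tuple bool :=
  [tuple tnth x i (+) tnth y i | i < 42].

Lemma combinationD x y :
  combination (tuple_addb x y) = combination x + combination y.
Proof.
rewrite /combination -big_split; apply: eq_bigr => i _ /=.
by rewrite tnth_mktuple natrF2_addb scalerDl.
Qed.

Lemma circs_combination_eq0 x : circs (combination x) = 0 -> x = [tuple of nseq 42 false].
Proof.
move=> cx0; have sol (y : 42.-tuple bool) : circs (combination y) = 0 -> solves hol_rows y.
  move=> cy0; apply/(all_nthP [::]) => q; rewrite size_map size_std => q42.
  have /ffunP/(_ (Ordinal q42)) := cy0; rewrite circs_combination ffunE /=.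
  by case: (dot y _).
have rows42 : all (fun r => size r == 42%N) hol_rows by vm_compute.
apply: val_inj; exact: (nullity0_inj rows42 hol_nullity (size_tuple x) (sol x cx0)).
Qed.

Lemma circs_combination_inj : injective (fun x => circs (combination x)).
Proof.
move=> x y /= /eqP; rewrite -subr_eq0 -linearB /= => /eqP cxy.
have : circs (combination (tuple_addb x y)) = 0.
  rewrite combinationD linearD /= -[RHS]cxy linearB /=; congr (_ + _).
  by apply/ffunP => q; rewrite !ffunE oppF2.
move/circs_combination_eq0 => xy0; apply: eq_from_tnth => i.
have := congr1 (fun t => tnth t i) xy0; rewrite tnth_mktuple (tnth_nth false (nseq_tuple _ _)).
by rewrite nth_nseq ltn_ord => /negbT; rewrite negb_add => /eqP.
Qed.

Lemma card_ffunF2_tuple n : #|{: {ffun 'I_n -> ('F_2)^o}}| = #|{: n.-tuple bool}|.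
Proof. by rewrite card_tuple card_ffun card_bool !card_ord. Qed.

Lemma circs_combination_surj w : exists x, circs (combination x) = w.
Proof.
have /(_ _)[|g _ gK] := inj_card_bij circs_combination_inj; last by exists (g w).
exact: eq_leq (card_ffunF2_tuple 42).
Qed.

(** ** The upper bound *)

(** The edges from which the values of a cocycle on all other edges follow: row [i]
    lists the partners of the triple number [i].  They are the outcome of a greedy
    selection, and their number 161 = 119 + 42 is the least possible. *)
Definition free_rows : seq (seq nat) :=
  [:: [:: 90; 96; 97; 99; 105; 106]; [:: 112]; [:: 75; 78; 94];
      [:: 79; 83; 88; 99; 117]; [:: 70; 82; 92]; [:: 90]; [:: 89; 108]; [:: 70; 100];
      [:: 63; 100; 113]; [:: 59; 61; 93; 97]; [:: 52; 53; 88; 107; 109]; [:: 85];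
      [:: 48; 54; 63; 89; 93]; [:: 48; 50; 51; 60; 85; 93; 98]; [:: 47; 85; 97; 116];
      [:: 81; 111]; [:: 37; 58; 84]; [:: 102]; [:: 50]; [:: 81];
      [:: 50; 54; 59; 61; 72; 73; 102; 105; 111]; [:: 47; 96; 119]; [:: 41; 67; 99];
      [:: 42; 59]; [:: 40; 57; 75; 96]; [:: 77; 80; 97]; [:: 67; 72; 74]; [:: 43];
      [:: 40; 43; 81]; [:: 52; 59; 67; 105]; [:: 109]; [:: 48]; [:: 88; 92]; [:: 66];
      [:: 54; 56]; [:: 36; 39; 58; 100]; [::]; [::]; [:: 106]; [::];
      [:: 88; 93; 95; 111; 112]; [::]; [::]; [::]; [:: 81]; [:: 73]; [:: 100]; [::];
      [:: 72]; [:: 117]; [:: 65; 67; 76; 77; 82; 92; 99]; [::]; [:: 76]; [::];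
      [:: 69; 83; 87]; [:: 88; 105]; [::]; [:: 79]; [:: 68; 69; 89; 92; 93; 115];
      [:: 98; 103; 114]; [:: 91]; [::]; [:: 73; 100]; [:: 67; 79; 85; 86]; [:: 114];
      [::]; [:: 107]; [::]; [::]; [:: 110]; [::]; [:: 97]; [:: 90]; [:: 93]; [::];
      [::]; [:: 96; 118]; [::]; [::]; [::]; [:: 101]; [:: 87; 88]; [:: 100];
      [:: 102]; [::]; [::]; [::]; [::]; [::]; [::]; [::]; [::]; [::]; [::]; [::];
      [::]; [::]; [::]; [::]; [:: 104]]%N.

Definition free_pair (i j : nat) : bool :=
  (j \in nth [::] free_rows i) || (i \in nth [::] free_rows j).

Definition triads_adj : seq bitseq := [seq [seq ~~ has (mem t) s | t <- triads] | s <- triads].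
Definition free_matrix : seq bitseq :=
  [seq [seq free_pair i j | j <- iota 0 120] | i <- iota 0 120].

Definition free_list : seq (nat * nat) :=
  [seq (i, j) | i <- iota 0 100, j <- nth [::] free_rows i].

Lemma free_list_ok : (size free_list == 161%N) && (size free_rows == 100%N) &&
  all (fun p => entry triads_adj p.1 p.2 && entry triads_adj p.2 p.1) free_list.
Proof. by vm_compute. Qed.

(** In 34 rounds the rule that two known edges of a triangle give the third has
    reached every edge. *)
Lemma free_spread : iter 34 (spread triads_adj) free_matrix == triads_adj.
Proof. by vm_compute. Qed.

End KneserTen.

Section UpperBound.
Local Notation K := (kneser 'I_10 3).
Implicit Types (S : K) (alpha beta : voltage K).

Definition vertices : seq K := map vtx triads.
Definition vx (i : nat) : K := nth (vtx [::]) vertices i.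

Lemma size_triads : size triads = 120%N.
Proof. by vm_compute. Qed.

Lemma vxE i : (i < 120)%N -> vx i = vtx (nth [::] triads i).
Proof. by move=> i120; rewrite /vx (nth_map [::]) // size_triads. Qed.

Lemma nth_triads i : (i < 120)%N -> is_list 10 3 (nth [::] triads i).
Proof. by move=> i120; apply: sublists_is_list; rewrite mem_nth ?size_triads. Qed.

Lemma entry_map (f : nat -> nat -> bool) n i j :
  entry [seq [seq f i j | j <- iota 0 n] | i <- iota 0 n] i j =
  [&& (i < n)%N, (j < n)%N & f i j].
Proof.
rewrite /entry; case: (ltnP i n) => [i_n|n_i] /=; last first.
  by rewrite [nth [::] _ i]nth_default ?size_map ?size_iota // nth_nil.
rewrite (nth_map 0%N) ?size_iota // nth_iota // add0n.
case: (ltnP j n) => [j_n|n_j] /=; last by rewrite nth_default // size_map size_iota.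
by rewrite (nth_map 0%N) ?size_iota // nth_iota.
Qed.

Lemma entry_triads_adj i j :
  entry triads_adj i j = [&& (i < 120)%N, (j < 120)%N & adj (vx i) (vx j)].
Proof.
rewrite /entry /triads_adj; case: (ltnP i 120) => [i_n|n_i]; last first.
  by rewrite [nth [::] _ i]nth_default ?size_map ?size_triads // nth_nil.
rewrite (nth_map [::]) ?size_triads //.
case: (ltnP j 120) => [j_n|n_j]; last by rewrite nth_default // size_map size_triads.
rewrite (nth_map [::]) ?size_triads // !vxE // adj_vtx //; exact: nth_triads.
Qed.

Lemma mem_free_list i j : j \in nth [::] free_rows i -> (i, j) \in free_list.
Proof.
move=> ji; apply/allpairsPdep; exists i, j; split=> //.
rewrite mem_iota /= ltnNge; apply: contraL ji => i100.
have /andP[/andP[_ /eqP s100] _] := free_list_ok.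
by rewrite nth_default ?s100.
Qed.

(** The zeros spread from the 161 listed edges over all triangles. *)
Lemma free_edges_determine alpha : cocycle alpha ->
  (forall p, p \in free_list -> volt alpha (vx p.1) (vx p.2) = 0) -> alpha = 0.
Proof.
move=> ca a0; apply: eq_volt => S S' SS'; rewrite volt0.
have sq (f : nat -> nat -> bool) :
    square_rows 120 [seq [seq f i j | j <- iota 0 120] | i <- iota 0 120].
  rewrite /square_rows size_map size_iota eqxx andTb; apply/allP => r /mapP[i _ ->].
  by rewrite size_map size_iota.
have sqA : square_rows 120 triads_adj.
  rewrite /square_rows size_map size_triads eqxx andTb; apply/allP => r /mapP[i _ ->].
  by rewrite size_map size_triads.
have adjP i j : entry triads_adj i j -> adj (vx i) (vx j).
  by rewrite entry_triads_adj => /and3P[].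
have free0 : known0 vertices (vtx [::]) alpha free_matrix.
  move=> i j; rewrite entry_map => /and3P[_ _ /orP[]] /mem_free_list ij.
    have /andP[_ /allP/(_ _ ij)/andP[/adjP ij_adj _]] := free_list_ok.
    by split; [exact: ij_adj | exact: (a0 _ ij)].
  have /andP[_ /allP/(_ _ ij)/andP[_ /adjP ij_adj]] := free_list_ok.
  by split; [exact: ij_adj | rewrite voltC; exact: (a0 _ ij)].
have := iter_spread_known0 (t := 34) ca sqA (sq _) adjP free0.
rewrite (eqP free_spread) => known.
have vx_surj (S0 : K) : exists2 i, (i < 120)%N & vx i = S0.
  have [s s3 <-] := vtx_surj S0; exists (index s triads).
    by rewrite -size_triads index_mem.
  by rewrite vxE ?nth_index // -size_triads index_mem.
have [i i120 Si] := vx_surj S; have [j j120 S'j] := vx_surj S'.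
have [] := known i j; last by rewrite -Si -S'j.
by rewrite entry_triads_adj i120 j120 Si S'j.
Qed.

Definition free_values alpha : {ffun 'I_161 -> ('F_2)^o} :=
  [ffun p : 'I_161 => let ij := nth (0%N, 0%N) free_list p in
    volt alpha (vx ij.1) (vx ij.2) : ('F_2)^o].

Lemma free_values_is_linear : linear free_values.
Proof. by move=> a alpha beta; apply/ffunP => p; rewrite !ffunE /= voltD voltZ. Qed.

HB.instance Definition _ := GRing.isSemilinear.Build 'F_2
  (voltage K) {ffun 'I_161 -> ('F_2)^o} _ free_values
  (GRing.semilinear_linear free_values_is_linear).

Lemma dim_cocycles : (\dim (cocycles1 K) <= 161)%N.
Proof.
have /andP[/andP[/eqP s161 _] _] := free_list_ok.
have ker0 : (cocycles1 K :&: lker (linfun free_values) = 0)%VS.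
  apply/eqP; rewrite -subv0; apply/subvP => alpha /memv_capP[/mem_cocycles1 ca].
  rewrite memv_ker lfunE /= memv0 => /eqP a0; apply/eqP/free_edges_determine => // p pF.
  have p161 : (index p free_list < 161)%N by rewrite -s161 index_mem.
  have /ffunP/(_ (Ordinal p161)) := a0; rewrite !ffunE /= nth_index //.
rewrite -(limg_dim_eq (f := linfun free_values)) //.
rewrite -[X in (_ <= X)%N](card_ord 161) -dim_ffunF2; apply: dimvS; exact: subvf.
Qed.

End UpperBound.

Section DimCoboundaries.
Variable G : sgraph.

Definition cobound (f : {ffun G -> ('F_2)^o}) : voltage G := coboundary (f : {ffun G -> 'F_2}).

Lemma cobound_is_linear : linear cobound.
Proof.
move=> a f g; apply: eq_volt => x y xy.
rewrite voltD voltZ /cobound !volt_coboundary // !ffunE.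
have sc (u v : 'F_2) : u *: (v : ('F_2)^o) = u * v by [].
by rewrite !sc; ring.
Qed.

HB.instance Definition _ := GRing.isSemilinear.Build 'F_2
  {ffun G -> ('F_2)^o} (voltage G) _ cobound (GRing.semilinear_linear cobound_is_linear).

Lemma coboundaries1E : coboundaries1 G = limg (linfun cobound).
Proof.
apply/vspaceP => alpha; apply/mem_coboundaries1/memv_imgP => [[f ->]|[f _ ->]].
  by exists f; rewrite ?memvf // lfunE.
by rewrite lfunE; exists f.
Qed.

(** On a connected graph only the constant functions have zero coboundary. *)
Lemma dim_coboundaries : connected_graph G -> (#|G| <= \dim (coboundaries1 G) + 1)%N.
Proof.
case/andP=> _ /forallP conn.
have := limg_ker_dim (linfun cobound) fullv.
rewrite -coboundaries1E dim_ffunF2 capfv => <-; rewrite addnC leq_add2l.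
pose one := [ffun=> 1] : {ffun G -> ('F_2)^o}.
apply: leq_trans (_ : \dim <[one]> <= 1)%N; last by rewrite dim_vline; case: (one == 0).
apply/dimvS/subvP => f; rewrite memv_ker lfunE /= => /eqP f0.
case: (pickP (fun _ : G => true)) => [r _|none]; last first.
  have -> : f = 0 by apply/ffunP => x; have := none x.
  exact: mem0v.
apply/vlineP; exists (f r); apply/ffunP => x; rewrite !ffunE.
have fE : f x == f r.
  have /forallP/(_ x) rx := conn r.
  apply: (@mem_connect_closed G (fun y => f y == f r)) rx => // a b ab /eqP <-.
  have := volt_coboundary (f : {ffun G -> 'F_2}) ab.
  rewrite -[coboundary _]/(cobound f) f0 volt0 => /esym/eqP.
  by rewrite addF2_eq0 eq_sym.
by rewrite (eqP fE) [RHS]mulr1.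
Qed.

End DimCoboundaries.

(** * Gauge classes *)

Section GaugeClasses.
Variable G : sgraph.
Implicit Types alpha beta : voltage G.

Lemma mem_gauge_class alpha beta :
  (beta \in gauge_class alpha) = (beta - alpha \in coboundaries1 G).
Proof.
rewrite inE; apply/existsP/mem_coboundaries1 => [[f /eqP ->]|[f ->]]; first by exists f.
by exists f.
Qed.

Lemma gauge_class_refl alpha : alpha \in gauge_class alpha.
Proof. by rewrite mem_gauge_class subrr mem0v. Qed.

Lemma eq_gauge_class alpha beta :
  (gauge_class alpha == gauge_class beta) = (alpha - beta \in coboundaries1 G).
Proof.
apply/eqP/idP => [e|ab]; first by rewrite -mem_gauge_class -e gauge_class_refl.
apply/setP => gamma; rewrite !mem_gauge_class.
have -> : gamma - beta = (gamma - alpha) + (alpha - beta) by rewrite addrA subrK.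
by rewrite [RHS]rpredDr.
Qed.

Lemma coboundary_cocycle alpha : alpha \in coboundaries1 G -> cocycle alpha.
Proof. by move/mem_coboundaries1 => [f ->]; apply: cocycle_coboundary. Qed.

Lemma coboundaries_sub_cocycles : (coboundaries1 G <= cocycles1 G)%VS.
Proof. by apply/subvP => alpha /coboundary_cocycle /mem_cocycles1. Qed.

Lemma gauge_classesP (c : {set voltage G}) :
  reflect (exists2 alpha, cocycle alpha & c = gauge_class alpha) (c \in gauge_classes G).
Proof.
apply: (iffP imsetP) => [[alpha]|[alpha ca ->]]; first by rewrite inE => /lnpP; exists alpha.
by exists alpha; rewrite // inE; apply/lnpP.
Qed.

Lemma cocycle_gauge_class alpha beta :
  cocycle alpha -> beta \in gauge_class alpha -> cocycle beta.
Proof.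
rewrite mem_gauge_class => ca /coboundary_cocycle cb.
by rewrite -(subrK alpha beta); apply: cocycleD.
Qed.

(** Representatives of a gauge class are cohomologous, so any of them will do; the
    default 0 is met only by the empty set. *)
Definition class_of_gauge (c : {set voltage G}) : H1 G :=
  subclass (coboundaries1 G)
    (vsproj (cocycles1 G) (if [pick alpha in c] is Some alpha then alpha else 0)).

Lemma class_of_gaugeE alpha : local_nbhd_preserving alpha ->
  exists2 z : subvs_of (cocycles1 G), vsval z = alpha &
    class_of_gauge (gauge_class alpha) = subclass (coboundaries1 G) z.
Proof.
move=> /lnpP ca; exists (vsproj (cocycles1 G) alpha).
  by rewrite vsprojK //; apply/mem_cocycles1.
rewrite /class_of_gauge; case: pickP => [beta b_a|/(_ alpha)]; last first.
  by rewrite gauge_class_refl.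
have cb := cocycle_gauge_class ca b_a.
apply/eq_subclass; rewrite !vsprojK -?mem_gauge_class //; exact/mem_cocycles1.
Qed.

Lemma class_of_gauge_inj : {in gauge_classes G &, injective class_of_gauge}.
Proof.
move=> _ _ /gauge_classesP[alpha ca ->] /gauge_classesP[beta cb ->].
have /lnpP/class_of_gaugeE[z za ->] := ca; have /lnpP/class_of_gaugeE[z' zb ->] := cb.
by move/eq_subclass; rewrite za zb -eq_gauge_class => /eqP.
Qed.

Lemma class_of_gauge_surj (h : H1 G) :
  exists2 c, c \in gauge_classes G & class_of_gauge c = h.
Proof.
pose z : subvs_of (cocycles1 G) := repr (h : vquot _).
have cz : cocycle (vsval z) by apply/mem_cocycles1; exact: subvsP.
exists (gauge_class (vsval z)); first by apply/gauge_classesP; exists (vsval z).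
have /lnpP/class_of_gaugeE[z' zz' ->] := cz.
by have -> : z' = z; [exact: val_inj | exact: vclassK].
Qed.

Lemma disconnected_gauge_class c alpha : connected_graph G ->
  c \in gauge_classes G -> alpha \in c ->
  (~~ connected_graph (lift_graph alpha) <-> c = gauge_class 0).
Proof.
move=> cG /gauge_classesP[beta cb ->] ab.
have -> : gauge_class beta = gauge_class alpha.
  by apply/eqP; rewrite eq_sym eq_gauge_class -mem_gauge_class.
rewrite (rwP eqP) eq_gauge_class subr0; apply: iff_trans (lift_connectedN _ cG) _.
exact: (rwP (mem_coboundaries1 _)).
Qed.

End GaugeClasses.

Section TenClasses.
Local Notation K := (kneser 'I_10 3).
Implicit Types (S : K) (alpha beta : voltage K).

Lemma connected_ten : connected_graph K.
Proof. by apply: kneser_connected; rewrite // card_ord. Qed.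

Lemma card_ten : #|K| = 120%N.
Proof. by rewrite card_sig /= -cardsE card_draws card_ord. Qed.

(** The 161 determining edges leave room for the 119 dimensions of coboundaries and
    the 42 dimensions detected by the four-cycles, and for nothing else. *)
Lemma mem_coboundaries_circs alpha : alpha \in cocycles1 K ->
  (alpha \in coboundaries1 K) = (circs alpha == 0).
Proof.
move=> za; have BE : coboundaries1 K = (cocycles1 K :&: lker (linfun circs))%VS.
  apply/eqP; rewrite eqEdim; apply/andP; split.
    apply/subvP => beta bB; apply/memv_capP; split.
      exact: (subvP (@coboundaries_sub_cocycles K)).
    have [f ->] := mem_coboundaries1 beta bB.
    by rewrite memv_ker lfunE /= circs_coboundary.
  have := limg_ker_dim (linfun circs) (cocycles1 K).
  have -> : (linfun circs @: cocycles1 K)%VS = fullv.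
    apply/vspaceP => w; rewrite memvf; have [x <-] := circs_combination_surj w.
    apply/memv_imgP; exists (combination x); last by rewrite lfunE.
    by apply/mem_cocycles1; apply: cocycle_combination.
  rewrite dim_ffunF2 card_ord; have := dim_cocycles; have := dim_coboundaries connected_ten.
  rewrite card_ten; have aux b z k : (120 <= b + 1 -> z <= 161 -> k + 42 = z -> k <= b)%N.
    by lia.
  exact: aux.
rewrite BE; apply/memv_capP/eqP => [[_]|c0]; first by rewrite memv_ker lfunE => /eqP.
split; first exact: za.
by rewrite memv_ker lfunE; apply/eqP; exact: c0.
Qed.

Lemma dim_H1_ten : \dim {: H1 K} = 42%N.
Proof.
have conto w : exists2 alpha, alpha \in cocycles1 K & circs alpha = w.
  have [x <-] := circs_combination_surj w; exists (combination x) => //.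
  by apply/mem_cocycles1; apply: cocycle_combination.
have [phi phi_bij _] := subquot_iso mem_coboundaries_circs conto.
by rewrite (dim_linear_bij phi_bij) dim_ffunF2 card_ord.
Qed.

Lemma eq_class_circs alpha beta : cocycle alpha -> cocycle beta ->
  (gauge_class alpha == gauge_class beta) = (circs alpha == circs beta).
Proof.
move=> /mem_cocycles1 ca /mem_cocycles1 cb.
by rewrite eq_gauge_class mem_coboundaries_circs ?rpredB // linearB subr_eq0.
Qed.

Definition combination_class (x : 42.-tuple bool) : {set voltage K} :=
  gauge_class (combination x).

Lemma combination_class_inj : injective combination_class.
Proof.
move=> x y /eqP; rewrite eq_class_circs; try exact: cocycle_combination.
by move/eqP/circs_combination_inj.
Qed.

Lemma gauge_classes_ten : gauge_classes K = [set combination_class x | x : 42.-tuple bool].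
Proof.
apply/setP => c; apply/gauge_classesP/imsetP => [[alpha ca ->]|[x _ ->]].
  have [x xE] := circs_combination_surj (circs alpha); exists x => //.
  apply/eqP; rewrite eq_class_circs ?xE //; exact: cocycle_combination.
by exists (combination x) => //; apply: cocycle_combination.
Qed.

Lemma card_gauge_classes_ten : #|gauge_classes K| = (2 ^ 42)%N.
Proof.
rewrite gauge_classes_ten (card_imset _ combination_class_inj).
have aux n : #|{: n.-tuple bool}| = (2 ^ n)%N by rewrite card_tuple card_bool.
exact: aux 42.
Qed.

End TenClasses.

(** * The symmetric group acting on gauge classes *)

Section RelabelAction.
Variables (T : finType) (d : nat).
Local Notation K := (kneser T d).
Implicit Types (S : K) (alpha beta : voltage K) (g : {perm T}).

Lemma volt_relabel alpha g S S' : adj S S' -> volt (relabel alpha g) S S' =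
  volt alpha (relabel_vertex g^-1 S) (relabel_vertex g^-1 S').
Proof. by move=> SS'; rewrite (volt_edge _ SS') ffunE /= imsetU1 imset_set1. Qed.

Lemma relabel_is_linear g : linear (fun alpha => relabel alpha g).
Proof.
move=> a alpha beta; apply: eq_volt => S S' SS'.
by rewrite voltD voltZ !volt_relabel // voltD voltZ.
Qed.

Lemma relabelB alpha beta g : relabel (alpha - beta) g = relabel alpha g - relabel beta g.
Proof.
by rewrite addrC -scaleN1r relabel_is_linear scaleN1r addrC.
Qed.

Lemma relabel_coboundary g alpha : alpha \in coboundaries1 K ->
  relabel alpha g \in coboundaries1 K.
Proof.
case/mem_coboundaries1=> f ->; apply/mem_coboundaries1.
exists [ffun S => f (relabel_vertex g^-1 S)]; apply: eq_coboundary => S S' SS'.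
by rewrite volt_relabel // volt_coboundary ?relabel_vertex_adj // !ffunE.
Qed.

Lemma relabelK g : cancel (@relabel T d ^~ g) (@relabel T d ^~ g^-1%g).
Proof. by move=> alpha; rewrite /= -relabelM mulgV relabel1. Qed.

Lemma cocycle_relabel g alpha : cocycle alpha -> cocycle (relabel alpha g).
Proof.
move=> ca S S' S'' e1 e2 e3; rewrite !volt_relabel //.
by apply: ca; rewrite relabel_vertex_adj.
Qed.

Lemma class_actionE alpha g :
  class_action T d (gauge_class alpha) g = gauge_class (relabel alpha g).
Proof.
apply/setP => beta; rewrite mem_gauge_class; apply/imsetP/idP => [[gamma]|b_a].
  by rewrite mem_gauge_class => ga ->; rewrite -relabelB; apply: relabel_coboundary.
exists (relabel beta g^-1%g); last by rewrite /= -{2}[g]invgK relabelK.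
rewrite mem_gauge_class -[alpha](relabelK g) -relabelB; exact: relabel_coboundary.
Qed.

Lemma acts_gauge_classes :
  [acts [set: {perm T}], on gauge_classes K | class_action T d].
Proof.
apply/actsP => g _ c; apply/idP/idP => [|/gauge_classesP[alpha ca ->]]; last first.
  by rewrite class_actionE; apply/gauge_classesP; exists (relabel alpha g) => //;
    apply: cocycle_relabel.
case/gauge_classesP=> alpha ca cE; apply/gauge_classesP.
exists (relabel alpha g^-1%g); first exact: cocycle_relabel.
by rewrite -class_actionE -cE actK.
Qed.

End RelabelAction.

Section TenAction.
Local Notation K := (kneser 'I_10 3).
Local Notation pts := (iota 0 10).
Implicit Types (S : K) (g : 'S_10).

Lemma vtype_relabel (A : {set 'I_10}) g S :
  vtype A (relabel_vertex g^-1 S) = vtype (g @: A) S.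
Proof.
rewrite /vtype -(card_imset _ (@perm_inj _ g)) imsetI; last by move=> x y _ _ /perm_inj.
by rewrite /= -imset_comp (eq_imset _ (permKV g)) imset_id.
Qed.

Lemma relabel_omega A g : relabel (omega A) g = omega (g @: A).
Proof.
apply: eq_volt => S S' SS'.
by rewrite volt_relabel // !volt_omega ?relabel_vertex_adj // !vtype_relabel.
Qed.

Local Opaque std triads.

(** The default 1 covers lists that are not permutations of [0 .. 9]. *)
Definition lperm (l : seq nat) : 'S_10 :=
  if [pick p : 'S_10 | [forall i : 'I_10, val (p i) == nth 0%N l i]] is Some p then p else 1%g.

Lemma lpermE l : is_list 10 10 l -> forall i : 'I_10, val (lperm l i) = nth 0%N l i.
Proof.
case/and3P=> l_uniq /eqP l10 /allP l_lt; rewrite /lperm; case: pickP => [p /forallP pE i|].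
  exact/eqP.
have lt_l (i : 'I_10) : (nth 0 l i < 10)%N by apply: l_lt; rewrite mem_nth ?l10.
have f_inj : injective (fun i => Ordinal (lt_l i)).
  by move=> i j [] /eqP; rewrite nth_uniq ?l10 // => /eqP/val_inj.
move=> none i; have /negP[] := negbT (none (perm f_inj)).
by apply/forallP => j; rewrite permE.
Qed.

Lemma lperm_lset l s : is_list 10 10 l -> all (gtn 10) s ->
  lperm l @: lset 10 s = lset 10 (map (nth 0%N l) s).
Proof.
move=> hl /allP s10; apply/setP => i; rewrite inE; apply/imsetP/mapP => [[j]|[x xs ix]].
  by rewrite inE => js ->; exists (val j) => //; apply: lpermE.
by exists (Ordinal (s10 x xs)); [rewrite inE | apply: val_inj; rewrite lpermE].
Qed.

(** One equation for each of the 42 four-cycles on the coefficients of a class: the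
    holonomy of the relabelled combination minus the original one is zero. *)
Definition fix_rows (l : seq nat) : seq bitseq :=
  [seq [seq hol (map (nth 0%N l) a) q (+) hol a q | a <- std] | q <- std].

Lemma relabel_combination l x : is_list 10 10 l -> relabel (combination x) (lperm l) =
  \sum_(i < 42) (tnth x i)%:R *: omega (lset 10 (map (nth 0%N l) (std_nth i))).
Proof.
move=> hl; apply: eq_volt => S S' SS'; rewrite (volt_relabel _ _ SS') /combination [LHS]volt_sum [RHS]volt_sum.
apply: eq_bigr => i _; rewrite [LHS]voltZ [RHS]voltZ; congr (_ * _).
have /and3P[_ _ i10] := std_nth_list i.
by rewrite -(lperm_lset hl i10) -relabel_omega (volt_relabel _ _ SS').
Qed.

Lemma size_fix_rows l : all (fun r => size r == 42%N) (fix_rows l).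
Proof. by apply/allP => r /mapP[q _ ->]; rewrite size_map size_std. Qed.

Lemma fixed_combination l x : is_list 10 10 l ->
  (class_action 'I_10 3 (combination_class x) (lperm l) == combination_class x) =
  solves (fix_rows l) x.
Proof.
move=> hl; rewrite class_actionE eq_class_circs; first last.
- exact: cocycle_combination.
- apply: cocycle_relabel; exact: cocycle_combination.
rewrite relabel_combination // -subr_eq0 -linearB /combination -sumrB.
have circE q : circs (\sum_(i < 42) ((tnth x i)%:R *:
      omega (lset 10 (map (nth 0%N l) (std_nth i))) -
    (tnth x i)%:R *: omega (lset 10 (std_nth i)))) q =
    (dot x (nth [::] (fix_rows l) q))%:R.
  have q42 : (q < size std)%N by rewrite size_std.
  rewrite linear_sum sum_ffunE dotE; last first.
    by rewrite (nth_map [::]) // size_map size_std.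
  apply: eq_bigr => i _; rewrite -scalerBr linearZ linearB !ffunE /= !circ_om ?std_nth_ok //.
  by rewrite oppF2 -natrF2_addb (nth_map [::]) // (nth_map [::]) ?size_std.
apply/eqP/idP => [/ffunP c0|sol].
  apply/(all_nthP [::]) => q; rewrite size_map size_std => q42.
  by have := c0 (Ordinal q42); rewrite circE ffunE /=; case: (dot x _).
apply/ffunP => q; rewrite circE ffunE.
have q42 : (q < size (fix_rows l))%N by rewrite size_map size_std.
by have /(all_nthP [::])/(_ q q42)/negbTE -> := sol.
Qed.

Lemma card_tuple_count n (P : pred bitseq) :
  #|[set x : n.-tuple bool | P x]| = count P (allbits n).
Proof.
have -> : count P (allbits n) = count P (map val (enum {: n.-tuple bool})).
  suff /seq.permP : perm_eq (allbits n) (map val (enum {: n.-tuple bool})) by [].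
  apply: uniq_perm; [exact: allbits_uniq| |].
    by rewrite map_inj_uniq ?enum_uniq //; apply: val_inj.
  move=> x; rewrite mem_allbits; apply/eqP/mapP => [xn|[t _ ->]]; last exact: size_tuple.
  by exists (Tuple (introT eqP xn)); rewrite ?mem_enum.
by rewrite count_map cardsE cardE enumT -size_filter.
Qed.

End TenAction.

(** * Conjugacy classes of the symmetric group on ten points *)

Section ListPermutations.
Local Notation pts := (iota 0 10).
Implicit Types (l : seq nat) (r g h : 'S_10).

Definition lapp l (x : nat) : nat := nth 0%N l x.

Lemma lperm_iter l k (i : 'I_10) : is_list 10 10 l ->
  val ((lperm l ^+ k)%g i) = iter k (lapp l) (val i).
Proof.
move=> hl; elim: k => [|k IHk]; first by rewrite expg0 perm1.
by rewrite expgSr permM lpermE // IHk.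
Qed.

(** Conjugation invariants; those of the first ten powers separate the cycle types. *)
Definition fixpoints r k : nat := #|[set x | (r ^+ k)%g x == x]|.

Lemma fixpointsJ r g k : fixpoints (r ^ g)%g k = fixpoints r k.
Proof.
rewrite /fixpoints -[RHS](card_imset _ (@perm_inj _ g)); apply: eq_card => x.
rewrite inE -conjXg; apply/eqP/imsetP => [rx|[y]].
  exists ((g^-1)%g x); last by rewrite permKV.
  by rewrite inE -{2}rx conjgE !permM permK.
rewrite inE => /eqP ry ->; by rewrite conjgE !permM permK ry.
Qed.

Definition lfixpoints l : seq nat :=
  [seq count (fun x => iter k (lapp l) x == x) pts | k <- iota 1 10].

Lemma lfixpointsE l : is_list 10 10 l ->
  lfixpoints l = [seq fixpoints (lperm l) k | k <- iota 1 10].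
Proof.
move=> hl; apply: eq_map => k; rewrite /fixpoints -val_enum_ord count_map cardsE cardE enumT.
rewrite size_filter; apply: eq_count => x /=.
by rewrite -lperm_iter.
Qed.

Lemma lperm_class_disjoint l l' : is_list 10 10 l -> is_list 10 10 l' ->
  lfixpoints l != lfixpoints l' ->
  [disjoint (lperm l ^: [set: 'S_10])%g & (lperm l' ^: [set: 'S_10])%g].
Proof.
move=> hl hl'; apply: contraR => /pred0Pn[_ /andP[/imsetP[g _ ->] /imsetP[h _ gh]]].
apply/eqP; rewrite !lfixpointsE //; apply: eq_map => k.
by rewrite -(fixpointsJ _ g) gh fixpointsJ.
Qed.

(** ** An upper bound for centralisers *)

Definition same_period l (x y : nat) : bool :=
  all (fun k => (iter k (lapp l) x == x) == (iter k (lapp l) y == y)) (iota 1 10).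

Definition lcycle l (x : nat) : seq nat := [seq iter k (lapp l) x | k <- iota 0 10].

(** [xs] lists one point on each cycle; [F] collects the points on the cycles
    already treated. *)
Fixpoint cent_bounds l (F xs : seq nat) : seq nat :=
  if xs is x :: xs' then
    count (fun y => (y \notin F) && same_period l x y) pts ::
      cent_bounds l (F ++ lcycle l x) xs'
  else [::].

Fixpoint cycle_points l (F xs : seq nat) : bool :=
  if xs is x :: xs' then [&& (x < 10)%N, x \notin F & cycle_points l (F ++ lcycle l x) xs']
  else all (mem F) pts.

(** An element of the centraliser maps a point to a point of the same period, and if it
    fixes the point then it fixes its whole cycle; so the stabilisers of one point on
    each cycle form a chain ending in the trivial group. *)
Lemma card_cent_chain l (H : {group 'S_10}) (F xs : seq nat) : is_list 10 10 l ->
  H \subset 'C[lperm l]%g ->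
  (forall h (y : 'I_10), h \in H -> val y \in F -> h y = y) ->
  cycle_points l F xs -> (#|H| <= \prod_(b <- cent_bounds l F xs) b)%N.
Proof.
move=> hl; elim: xs H F => [|x xs IHxs] H F HC HF.
  move=> cp; have allF : {in pts, forall y, y \in F} by apply/allP; exact: cp.
  rewrite big_nil; suff -> : H = 1%G by rewrite cards1.
  apply/trivGP/subsetP => h hH; rewrite inE; apply/eqP/permP => y.
  rewrite perm1 HF //; apply: allF; rewrite mem_iota leq0n add0n; exact: ltn_ord.
move=> cp; have /and3P[x10 xF {}cp] :
  [&& (x < 10)%N, x \notin F & cycle_points l (F ++ lcycle l x) xs] by exact: cp.
pose x' := Ordinal x10.
have commH h k (y : 'I_10) : h \in H -> h ((lperm l ^+ k)%g y) = (lperm l ^+ k)%g (h y).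
  move=> hH; rewrite -!permM; congr (fun_of_perm _ y).
  have /cent1P hl_comm := subsetP HC h hH.
  exact: (commute_sym (commuteX k hl_comm)).
have -> : cent_bounds l F (x :: xs) =
    count (fun y => (y \notin F) && same_period l x y) pts ::
      cent_bounds l (F ++ lcycle l x) xs by [].
rewrite big_cons -(card_orbit_stab 'P H x'); apply: leq_mul.
  pose P y := (y \notin F) && same_period l x y.
  have -> : count P pts = #|[set y : 'I_10 | P (val y)]|.
    by rewrite -val_enum_ord count_map cardsE cardE enumT -size_filter.
  apply/subset_leq_card/subsetP => y /orbitP[h hH <-]; rewrite inE /P /= /aperm.
  apply/andP; split.
    by apply: contra xF => hxF; have /perm_inj hx := HF h _ hH hxF; move: hxF; rewrite hx.
  apply/allP => k _; apply/eqP.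
  rewrite -[X in iter k _ X == X]/(val x') -!lperm_iter // !val_eqE -commH //.
  by rewrite (inj_eq perm_inj).
apply: IHxs cp => [|h y].
  by apply: subset_trans HC; apply: subsetIl.
rewrite inE => /andP[hH /astab1P hx]; rewrite mem_cat => /orP[yF|]; first exact: HF.
case/mapP=> k _ yk; have -> : y = (lperm l ^+ k)%g x' by apply: val_inj; rewrite lperm_iter.
by rewrite commH //; congr (_ _).
Qed.

End ListPermutations.

(** ** Burnside's count *)

(** A list of disjoint classes is complete, and the sizes [q] are exact, as soon as
    the [q i] are consistent with upper bounds for the centralisers and add up to
    the order of the group. *)
Lemma sum_class_function (gT : finGroupType) (G : {group gT}) (I : finType)
    (r : I -> gT) (q : I -> nat) (F : gT -> nat) :
  (forall i, r i \in G) ->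
  (forall i j, i != j -> [disjoint (r i ^: G)%g & (r j ^: G)%g]) ->
  (forall i, #|'C_G[r i]%g| * q i <= #|G|)%N ->
  (\sum_i q i = #|G|)%N ->
  {in G &, forall g h, F (g ^ h)%g = F g} ->
  (\sum_(g in G) F g = \sum_i q i * F (r i))%N.
Proof.
move=> rG disj qle sumq FJ.
have q_class i : (q i <= #|(r i ^: G)%g|)%N.
  rewrite -(leq_pmul2l (cardG_gt0 'C_G[r i])) -index_cent1 Lagrange ?subsetIl //.
  exact: qle.
pose U := \bigcup_i (r i ^: G)%g.
have sumU E : (\sum_(g in U) E g = \sum_i \sum_(g in (r i ^: G)%g) E g)%N.
  exact: partition_disjoint_bigcup.
have UG : U \subset G by apply/bigcupsP => i _; rewrite class_subG.
have cardU : #|U| = (\sum_i #|(r i ^: G)%g|)%N.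
  by rewrite -sum1_card sumU; apply: eq_bigr => i _; rewrite sum1_card.
have leU : (\sum_i q i <= #|U|)%N by rewrite cardU; apply: leq_sum.
have UE : U = G by apply/eqP; rewrite eqEcard UG -sumq.
have qE i : q i = #|(r i ^: G)%g|.
  have : (\sum_i q i = \sum_i #|(r i ^: G)%g|)%N by rewrite -cardU UE.
  rewrite (bigD1 i) //= [in RHS](bigD1 i) //= => eq_sum.
  apply/eqP; rewrite eqn_leq q_class /= -(leq_add2r (\sum_(j | j != i) q j)) eq_sum.
  by rewrite leq_add2l leq_sum.
rewrite -UE sumU; apply: eq_bigr => i _; rewrite qE -sum_nat_const.
by apply: eq_bigr => _ /imsetP[h hG ->]; apply: FJ.
Qed.

(** The partitions of [n] with parts at most [m]; the number of parts is at most [fuel]. *)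
Fixpoint partitions (fuel m n : nat) : seq (seq nat) :=
  if n is 0 then [:: [::]] else
  if fuel is f.+1 then
    flatten [seq [seq k :: p | p <- partitions f k (n - k)] | k <- iota 1 (minn m n)]
  else [::].

(** The permutation whose cycles are intervals of the given lengths, from [s] on. *)
Fixpoint cycle_list (s : nat) (p : seq nat) : seq nat :=
  if p is k :: p' then rcons (iota s.+1 k.-1) s ++ cycle_list (s + k) p' else [::].

Fixpoint cycle_starts (s : nat) (p : seq nat) : seq nat :=
  if p is k :: p' then s :: cycle_starts (s + k) p' else [::].

(** A representative of each conjugacy class, with the factors of the bound for its
    centraliser. *)
Definition class_data : seq (seq nat * seq nat) :=
  [seq (cycle_list 0 p, cent_bounds (cycle_list 0 p) [::] (cycle_starts 0 p))
     | p <- partitions 10 10 10].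

(** The numbers up to [10!] and beyond are multiplied, divided and compared in binary. *)
Section BinaryArithmetic.
Local Open Scope N_scope.

Definition cent_order (b : seq nat) : N := foldr N.mul 1 (map N.of_nat b).

(** The numerator is [10!]. *)
Definition class_size (b : seq nat) : N := N.div 3628800 (cent_order b).

Definition sumN (s : seq N) : N := foldr N.add 0 s.

Lemma cent_orders_ok :
  all (fun d => N.eqb (cent_order d.2 * class_size d.2) 3628800) class_data.
Proof. by vm_cast_no_check isT. Qed.

Lemma class_sizes_total : sumN [seq class_size d.2 | d <- class_data] = 3628800.
Proof. by vm_cast_no_check (erefl 3628800). Qed.

Lemma burnside_total :
  sumN [seq class_size d.2 * 2 ^ N.of_nat (nullity 42 (fix_rows d.1)) | d <- class_data]
  = 1245395 * 3628800.
Proof. by vm_cast_no_check (erefl (1245395 * 3628800)). Qed.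

End BinaryArithmetic.

Lemma class_data_ok :
  all (fun p => if is_list 10 10 (cycle_list 0 p)
    then cycle_points (cycle_list 0 p) [::] (cycle_starts 0 p) else false)
    (partitions 10 10 10).
Proof. by vm_cast_no_check isT. Qed.

Lemma class_data_uniq : uniq [seq lfixpoints d.1 | d <- class_data].
Proof. by vm_cast_no_check isT. Qed.

Section OrbitCount.
Local Notation K := (kneser 'I_10 3).
Local Notation G := [set: 'S_10].

Local Notation fixed g := #|('Fix_(gauge_classes K | class_action 'I_10 3)[g])%g|.

Lemma fixedJ g h : fixed (g ^ h)%g = fixed g.
Proof.
rewrite -[RHS](card_imset _ (act_inj (class_action 'I_10 3) h)); apply: eq_card => c.
have actsG := acts_act (acts_gauge_classes 'I_10 3).
rewrite inE; apply/andP/imsetP => [[cK /afix1P cg]|[b]].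
  exists (class_action 'I_10 3 c h^-1%g); last by rewrite actKV.
  apply/setIP; split; first by rewrite actsG ?in_setT.
  by apply/afix1P; rewrite -{2}cg -!actM conjgE !mulgA mulgK.
case/setIP=> bK /afix1P bg ->; split; first by rewrite actsG ?in_setT.
by apply/afix1P; rewrite -actM conjgE !mulgA mulgV mul1g actM bg.
Qed.

(** The classes are the combinations of the basis, and the fixed ones are the solutions
    of a linear system. *)
Lemma fixed_lperm l : is_list 10 10 l -> fixed (lperm l) = (2 ^ nullity 42 (fix_rows l))%N.
Proof.
move=> hl; rewrite -(nullityP (size_fix_rows l)) -card_tuple_count.
rewrite -(card_imset _ combination_class_inj); apply: eq_card => c.
rewrite inE gauge_classes_ten; apply/andP/imsetP => [[/imsetP[x _ ->] /afix1P xl]|[x]].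
  by exists x; rewrite // inE -fixed_combination // xl.
rewrite inE -fixed_combination // => /eqP xl ->; split; last exact/afix1P.
by apply/imsetP; exists x.
Qed.

Lemma of_natD m n : N.of_nat (m + n)%N = N.add (N.of_nat m) (N.of_nat n).
Proof. exact: Nat2N.inj_add. Qed.

Lemma of_natM m n : N.of_nat (m * n)%N = N.mul (N.of_nat m) (N.of_nat n).
Proof. exact: Nat2N.inj_mul. Qed.

Lemma of_natX m n : N.of_nat (m ^ n)%N = N.pow (N.of_nat m) (N.of_nat n).
Proof.
elim: n => // n IHn; rewrite expnS of_natM IHn Nat2N.inj_succ.
by rewrite N.pow_succ_r'.
Qed.

Lemma of_nat_sum (I : Type) (s : seq I) (f : I -> nat) :
  N.of_nat (\sum_(i <- s) f i)%N = sumN [seq N.of_nat (f i) | i <- s].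
Proof.
elim: s => [|i s IHs]; first by rewrite big_nil.
by rewrite big_cons of_natD IHs.
Qed.

Lemma of_nat_prod (s : seq nat) : N.of_nat (\prod_(b <- s) b)%N = cent_order s.
Proof.
elim: s => [|i s IHs]; first by rewrite big_nil.
by rewrite big_cons of_natM IHs.
Qed.

Lemma of_nat_fact10 : N.of_nat 10`! = 3628800%num.
Proof. by rewrite fact_prod -(big_map id xpredT id) of_nat_prod. Qed.

Lemma of_nat_orbit_count : N.of_nat (1245 * 1000 + 395)%N = 1245395%num.
Proof. by rewrite of_natD of_natM. Qed.

Definition data_nth (i : 'I_(size class_data)) := nth ([::], [::]) class_data i.

Lemma data_nthP i : exists2 p, data_nth i =
   (cycle_list 0 p, cent_bounds (cycle_list 0 p) [::] (cycle_starts 0 p)) &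
   is_list 10 10 (cycle_list 0 p) /\ cycle_points (cycle_list 0 p) [::] (cycle_starts 0 p).
Proof.
have := mem_nth ([::], [::]) (ltn_ord i); rewrite -/(data_nth i) {1}/class_data.
case/mapP=> p p_in ->; exists p => //.
by have := allP class_data_ok p p_in; case: ifP.
Qed.

Lemma sum_fixed : (\sum_(g in G) fixed g = (1245 * 1000 + 395) * 10`!)%N.
Proof.
have cardG : #|G| = 10`! by rewrite cardsT card_Sn.
pose size_of (d : seq nat * seq nat) := N.to_nat (class_size d.2).
rewrite (@sum_class_function _ [group of G] _ (fun i => lperm (data_nth i).1)
   (fun i => size_of (data_nth i)) (fun g => fixed g)).
- apply: Nat2N.inj.
  pose term d := (size_of d * 2 ^ nullity 42 (fix_rows d.1))%N.
  transitivity (N.of_nat (\sum_(d <- class_data) term d)%N).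
    rewrite (big_nth ([::], [::])) big_mkord; congr N.of_nat; apply: eq_bigr => i _.
    have [p pE [hp _]] := data_nthP i; rewrite /term -/(data_nth i) pE fixed_lperm //.
  apply: (etrans _ (esym (etrans (of_natM _ _) (congr2 N.mul of_nat_orbit_count of_nat_fact10)))).
  have termE d : N.of_nat (term d) =
      N.mul (class_size d.2) (N.pow 2%num (N.of_nat (nullity 42 (fix_rows d.1)))).
    by rewrite /term of_natM N2Nat.id of_natX.
  apply: (etrans (of_nat_sum _ _)).
  exact: (etrans (congr1 sumN (eq_map termE class_data)) burnside_total).
- by move=> i; rewrite inE.
- move=> i j ij; have [p pE [hp _]] := data_nthP i; have [p' pE' [hp' _]] := data_nthP j.
  apply: lperm_class_disjoint; rewrite ?pE ?pE' //.
  have := nth_uniq [::] _ _ class_data_uniq; rewrite size_map => /(_ i j (ltn_ord i) (ltn_ord j)).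
  rewrite !(nth_map ([::], [::])) // -/(data_nth i) -/(data_nth j) pE pE' => ->.
  exact: ij.
- move=> i; have [p pE [hp cp]] := data_nthP i.
  have leC : (#|'C_G[lperm (data_nth i).1]%g| <= \prod_(b <- (data_nth i).2) b)%N.
    rewrite pE; apply: (card_cent_chain (H := 'C_G[_]%G)) => //.
    exact: subsetIr.
  apply: leq_trans (leq_mul leC (leqnn _)) _.
  rewrite cardG eq_leq //; apply: Nat2N.inj.
  rewrite of_natM of_nat_prod N2Nat.id of_nat_fact10.
  apply/N.eqb_eq; exact: (allP cent_orders_ok _ (mem_nth _ (ltn_ord i))).
- rewrite cardG -[LHS](big_mkord xpredT (fun i => size_of (nth ([::], [::]) class_data i))).
  rewrite -(big_nth ([::], [::]) xpredT size_of); apply: Nat2N.inj.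
  apply: (etrans (of_nat_sum _ _)); rewrite [RHS]of_nat_fact10.
  have sizeE d : N.of_nat (size_of d) = class_size d.2 by apply: N2Nat.id.
  exact: (etrans (congr1 sumN (eq_map sizeE class_data)) class_sizes_total).
by move=> g h _ _; apply: fixedJ.
Qed.

(** The number of orbits is the average number of fixed classes. *)
Lemma card_orbits_ten :
  #|[set orbit (class_action 'I_10 3) G c | c in gauge_classes K]| = (1245 * 1000 + 395)%N.
Proof.
have := Frobenius_Cauchy (acts_gauge_classes 'I_10 3); rewrite sum_fixed => /eqP.
have -> : #|G| = 10`! by rewrite cardsT card_Sn.
by rewrite eqn_pmul2r ?fact_gt0 // => /eqP.
Qed.

End OrbitCount.

(** The lift over a class is disconnected for the zero class alone, and that class is
    an orbit by itself. *)
Lemma card_connected_orbits_ten :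
  let orbits := [set orbit (class_action 'I_10 3) [set: 'S_10] c
                | c in gauge_classes (kneser 'I_10 3)] in
  #|[set O in orbits | [forall c in O, forall alpha in c,
      connected_graph (lift_graph alpha)]]| = (1245 * 1000 + 394)%N.
Proof.
move=> orbits; pose to := class_action 'I_10 3.
pose zero := gauge_class (0 : voltage (kneser 'I_10 3)).
have zeroK : zero \in gauge_classes (kneser 'I_10 3).
  by apply/gauge_classesP; exists 0 => // S S' S'' _ _ _; rewrite !volt0 !addr0.
have orbit0 c : zero \in orbit to [set: 'S_10] c -> c = zero.
  rewrite orbit_sym => /orbitP[g _ <-]; rewrite class_actionE.
  by apply/eqP; rewrite eq_gauge_class subr0 relabel_coboundary ?mem0v.
have -> : [set O in orbits | [forall c in O, forall alpha in c,
      connected_graph (lift_graph alpha)]] = orbits :\ orbit to [set: 'S_10] zero.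
  apply/setP => O; rewrite !inE andbC; case OK: (O \in orbits); rewrite ?andbF // !andbT.
  apply/forall_inP/idP => [conn|O0 c cO].
    apply/eqP => O0.
    have /forall_inP/(_ 0 (gauge_class_refl 0)) : [forall alpha in zero, connected_graph (lift_graph alpha)].
      by apply: conn; rewrite O0 orbit_refl.
    by apply/negP; apply/(disconnected_gauge_class connected_ten zeroK (gauge_class_refl 0)).
  have /imsetP[b bK OE] := OK.
  apply/forall_inP => alpha alpha_c; apply: contraR O0 => disc.
  have cK : c \in gauge_classes (kneser 'I_10 3).
    move: cO; rewrite OE => /orbitP[g _ <-].
    by rewrite (acts_act (acts_gauge_classes 'I_10 3)) ?in_setT.
  have /(disconnected_gauge_class connected_ten cK alpha_c) c0 := disc.
  by move: cO; rewrite OE c0 => /orbit0 ->.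
have remove (T : finType) (P : {set T}) x m n :
    x \in P -> #|P| = (m + n.+1)%N -> #|P :\ x| = (m + n)%N.
  by move=> xP; rewrite (cardsD1 x) xP addnS add1n => -[].
exact: (remove _ _ _ (1245 * 1000)%N 394%N (imset_f _ zeroK) card_orbits_ten).
Qed.

(** * The block of five points *)

Section BlockClass.
Local Notation K := (kneser 'I_10 3).
Local Notation G := [set: 'S_10].
Local Notation pts := (iota 0 10).
Local Notation to := (class_action 'I_10 3).
Implicit Types (A : {set 'I_10}) (S : K).

(** Complementation turns the types 1, 2 into 2, 1. *)
Lemma omegaC A : omega (~: A) = omega A.
Proof.
apply: eq_volt => S S' SS'; rewrite !volt_omega // !vtypeC //.
move: (vtype_le A S) (vtype_le A S').
by case: (vtype A S) => [|[|[|[|i]]]] //; case: (vtype A S') => [|[|[|[|j]]]].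
Qed.

Lemma volt_alphaA0 S S' : adj S S' -> volt alphaA0 S S' =
  (has_types A0 S S' 0 1 || has_types A0 S S' 1 3)%:R.
Proof.
move=> SS'; rewrite (volt_edge _ SS') ffunE; congr (nat_of_bool _)%:R.
have neq : S != S' by apply: contraTneq SS' => ->; rewrite adj_irr.
have flip i j : has_types A0 S' S i j = has_types A0 S S' i j.
  by apply/has_typesP/has_typesP; tauto.
rewrite SubK; apply/existsP/idP => [[U /existsP[U' /andP[/eqP UU']]]|h].
  have: U \in [set S; S'] by rewrite UU' set21.
  have: U' \in [set S; S'] by rewrite UU' set22.
  have: S \in [set U; U'] by rewrite -UU' set21.
  have: S' \in [set U; U'] by rewrite -UU' set22.
  rewrite !inE => h1 h2 /orP[]/eqP eU' /orP[]/eqP eU; subst U U' => //.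
  - by rewrite orbb eq_sym (negbTE neq) in h1.
  - by rewrite !flip.
  by rewrite orbb (negbTE neq) in h2.
by exists S; apply/existsP; exists S'; rewrite eqxx.
Qed.

(** The voltages differ by the coboundary of the indicator of type 1. *)
Lemma alphaA0_class : gauge_class alphaA0 = gauge_class (omega A0).
Proof.
apply/eqP; rewrite eq_gauge_class; apply/mem_coboundaries1.
exists [ffun S => (vtype A0 S == 1%N)%:R]; apply: eq_coboundary => S S' SS'.
rewrite voltB volt_alphaA0 // volt_omega // !ffunE /has_types.
move: (vtype_le A0 S) (vtype_le A0 S').
by case: (vtype A0 S) => [|[|[|[|i]]]] //; case: (vtype A0 S') => [|[|[|[|j]]]] // _ _; f2done.
Qed.

Lemma A0_lset : A0 = lset 10 (iota 0 5).
Proof. by apply/setP => i; rewrite [RHS]in_set mem_iota inE. Qed.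

Lemma card_A0 : #|A0| = 5%N.
Proof. by rewrite A0_lset; apply: card_lset. Qed.

Lemma lnp_alphaA0 : local_nbhd_preserving alphaA0.
Proof.
apply/lnpP; apply: (cocycle_gauge_class (cocycle_omega card_A0)).
by rewrite -alphaA0_class gauge_class_refl.
Qed.

Lemma card_lift_alphaA0 : #|lift_graph alphaA0| = 240%N.
Proof. by rewrite card_lift card_ten. Qed.

(** ** The orbit *)

(** A five-point set and its complement give the same voltage, and one of them contains
    the point 0. *)
Definition halves : seq (seq nat) := [seq l <- sublists 5 pts | 0%N \in l].

(** The values of a permutation that maps [0 .. 4] onto the list. *)
Definition complete (l : seq nat) : seq nat := l ++ [seq i <- pts | i \notin l].

Definition hol_row (l : seq nat) : bitseq := [seq hol l q | q <- std].

Lemma size_halves : size halves = 126%N.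
Proof. by vm_cast_no_check (erefl 126%N). Qed.

Lemma hol_rows_uniq : uniq (map hol_row halves).
Proof. by vm_cast_no_check isT. Qed.

Lemma halves_complete : {in halves, forall l, is_list 10 10 (complete l) /\
  map (nth 0%N (complete l)) (iota 0 5) = l}.
Proof.
have /allP hall : all (fun l => is_list 10 10 (complete l) &&
    (map (nth 0%N (complete l)) (iota 0 5) == l)) halves by vm_cast_no_check isT.
by move=> l /hall /andP[? /eqP].
Qed.

Lemma mem_halves l : (l \in halves) = (0%N \in l) && (l \in sublists 5 pts).
Proof. by rewrite mem_filter. Qed.

Local Opaque halves std.

Definition half_class (l : seq nat) : {set voltage K} := gauge_class (omega (lset 10 l)).

Lemma half_list l : l \in halves -> is_list 10 5 l.
Proof. by rewrite mem_halves => /andP[_]; apply: sublists_is_list. Qed.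

Lemma half_class_row l l' : l \in halves -> l' \in halves ->
  half_class l = half_class l' -> hol_row l = hol_row l'.
Proof.
move=> hl hl' /eqP; rewrite eq_class_circs; try by apply/cocycle_omega/card_lset/half_list.
move/eqP/ffunP => e; apply: (@eq_from_nth _ false); rewrite !size_map ?size_std // => q q42.
have := e (Ordinal q42); rewrite !ffunE !circ_om ?std_nth_ok // !(nth_map [::]) ?size_std //.
by rewrite /std_nth; case: (hol l _); case: (hol l' _).
Qed.

Lemma half_classes_uniq : uniq (map half_class halves).
Proof.
have huniq := map_uniq hol_rows_uniq.
rewrite map_inj_in_uniq; first exact: huniq.
move=> l l' hl hl' /(half_class_row hl hl') rowE.
apply/eqP; rewrite -(nth_index [::] hl) -(nth_index [::] hl').
rewrite nth_uniq ?index_mem; [|exact: hl|exact: hl'|exact: huniq].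
rewrite -(nth_uniq [::] _ _ hol_rows_uniq) ?size_map ?index_mem; [|exact: hl|exact: hl'].
rewrite !(nth_map [::]) ?index_mem; [|exact: hl'|exact: hl].
by rewrite !nth_index ?rowE; [|exact: hl'|exact: hl].
Qed.

Lemma orbit_half c :
  (c \in orbit to G (gauge_class (omega A0))) = (c \in map half_class halves).
Proof.
apply/orbitP/mapP => [[g _ <-]|[l hl ->]].
  rewrite class_actionE relabel_omega; set B := g @: A0.
  have B5 : #|B| = 5%N by rewrite card_imset ?card_A0 //; apply: perm_inj.
  have [l0|l0] := boolP (ord0 \in B).
    have [l hl lB] := lset_surj B5; exists l; last by rewrite /half_class lB.
    by rewrite mem_halves hl andbT; move: l0; rewrite -lB inE.
  have C5 : #|~: B| = 5%N by have := cardsC B; rewrite B5 card_ord; lia.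
  have [l hl lB] := lset_surj C5; exists l; last by rewrite /half_class lB omegaC.
  by rewrite mem_halves hl andbT; move: l0; rewrite -in_setC -lB inE.
have [lp le] := halves_complete hl.
exists (lperm (complete l)); first by rewrite in_setT.
by rewrite class_actionE relabel_omega A0_lset lperm_lset // le.
Qed.

Lemma card_orbit_block : #|orbit to G (gauge_class alphaA0)| = 126%N.
Proof.
rewrite alphaA0_class (eq_card orbit_half) -size_halves -(size_map half_class).
exact/card_uniqP/half_classes_uniq.
Qed.

End BlockClass.

(** ** The stabiliser *)

Section BlockStabiliser.
Local Notation K := (kneser 'I_10 3).
Local Notation G := [set: 'S_10].
Local Notation to := (class_action 'I_10 3).
Local Notation W := (wreath2 'S_5).

(** A point of ['I_10] as a block number and a position in the block. *)
Definition cut (i : 'I_10) : bool * 'I_5 :=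
  match @split 5 5 i with inl j => (false, j) | inr j => (true, j) end.

Definition glue (y : bool * 'I_5) : 'I_10 :=
  if y.1 then @rshift 5 5 y.2 else @lshift 5 5 y.2.

Lemma cutK : cancel cut glue.
Proof. by move=> i; rewrite -[RHS](@splitK 5 5) /cut; case: (@split 5 5 i). Qed.

Lemma glueK : cancel glue cut.
Proof.
by case=> -[] j; rewrite /cut /glue /= -1?[rshift _ _](erefl (@unsplit 5 5 (inr j)))
  -1?[lshift _ _](erefl (@unsplit 5 5 (inl j))) unsplitK.
Qed.

Lemma cut_A0 i : (i \in A0) = ~~ (cut i).1.
Proof. by rewrite inE /cut; case: splitP => j ->; rewrite ?ltn_ord // ltnNge leq_addr. Qed.

Definition component (x : 'S_5 * 'S_5) (b : bool) : 'S_5 := if b then x.2 else x.1.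

Lemma component_swap x s b : component (swap x s) b = component x (b (+) odd_perm s).
Proof. by rewrite /component /swap; case: odd_perm; case: b. Qed.

(** The swap acts first, then the components inside the blocks; so the component that
    acts is that of the new block. *)
Definition move (u : W) (y : bool * 'I_5) : bool * 'I_5 :=
  let b := y.1 (+) odd_perm u.1 in (b, component u.2 b y.2).

Lemma moveM u v y : move (u * v)%g y = move v (move u y).
Proof.
rewrite /move /= odd_permM addbA; congr (_, _).
have -> c : component (swap u.2 v.1 * v.2)%g c = (component (swap u.2 v.1) c * component v.2 c)%g.
  by case: c.
by rewrite permM component_swap addbK.
Qed.

Lemma move_inj u : injective (move u).
Proof. by case=> b i [c j] [/addIb -> /perm_inj ->]. Qed.

Fact wreath_fun_inj u : injective (fun i => glue (move u (cut i))).
Proof. exact: inj_comp (can_inj glueK) (inj_comp (@move_inj u) (can_inj cutK)). Qed.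

Definition wreath_perm (u : W) : 'S_10 := perm (@wreath_fun_inj u).

Lemma cut_wreath_perm u i : cut (wreath_perm u i) = move u (cut i).
Proof. by rewrite permE glueK. Qed.

Lemma wreath_permM : {in [set: W] &, {morph wreath_perm : u v / (u * v)%g}}.
Proof.
move=> u v _ _; apply/permP => i; apply: (can_inj cutK).
by rewrite permM !cut_wreath_perm moveM.
Qed.

Definition wreath_morphism := Morphism wreath_permM.

Lemma odd_perm2_inj : injective (fun s : 'S_2 => odd_perm s).
Proof.
pose g (b : bool) : 'S_2 := if b then tperm ord0 ord_max else 1%g.
have gK b : odd_perm (g b) = b by case: b; rewrite /g ?odd_tperm ?odd_perm1.
have /(_ _)[|h _ hK] := inj_card_bij (can_inj gK); first by rewrite card_Sn card_bool.
by move=> s t; rewrite -{1 2}(hK s) -{1 2}(hK t) !gK => ->.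
Qed.

Lemma wreath_perm_inj : injective wreath_perm.
Proof.
move=> u v uv; have {uv} e y : move u y = move v y.
  by rewrite -(glueK y) -!cut_wreath_perm uv.
have odd_uv : odd_perm u.1 = odd_perm v.1 by have [] := e (false, ord0).
have comp_uv b : component u.2 b = component v.2 b.
  apply/permP => j; have := e (b (+) odd_perm u.1, j); rewrite /move /= odd_uv addbK.
  by case.
apply: val_inj; case: u v {e} odd_uv comp_uv => [[a [p q]] ?] [[b [p' q']] ?] /= odd_uv e.
by have := e false; have := e true; rewrite /component /= (odd_perm2_inj odd_uv) => -> ->.
Qed.

Lemma wreath_perm_A0 u : wreath_perm u @: A0 = if odd_perm u.1 then ~: A0 else A0.
Proof.
apply/setP => i; rewrite -[i](permKV (wreath_perm u)); set j := ((wreath_perm u)^-1)%g i.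
rewrite (mem_imset _ _ perm_inj); have mem_j : (wreath_perm u j \in A0) = ((j \in A0) (+) odd_perm u.1).
  by rewrite !cut_A0 cut_wreath_perm /=; case: odd_perm; case: (cut j).1.
by case: ifP => odd_u; rewrite ?in_setC mem_j odd_u; case: (j \in A0).
Qed.

Lemma card_wreath : #|[set: W]| = (2 * (5`! * 5`!))%N.
Proof.
rewrite cardsT card_sub -[RHS]/(_ * (_ * _))%N.
have -> : #|[pred ax | ax \in setX [set: 'S_2] [set: 'S_5 * 'S_5]]| =
    #|setX [set: 'S_2] [set: 'S_5 * 'S_5]| by apply: eq_card.
by rewrite cardsX !cardsT card_prod !card_Sn.
Qed.

Lemma card_stabiliser : #|'C_G[gauge_class alphaA0 | to]%g| = (2 * (5`! * 5`!))%N.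
Proof.
have := card_orbit_stab to [group of G] (gauge_class alphaA0).
rewrite cardsT card_Sn card_orbit_block -(bin_fact (isT : 5 <= 10)%N) => /eqP.
have -> : 'C(10, 5) = (126 * 2)%N by [].
by rewrite -mulnA eqn_pmul2l // => /eqP.
Qed.

(** The wreath product preserves the splitting of the ten points, and its image has the
    order of the stabiliser. *)
Lemma stabiliser_isog : 'C_G[gauge_class alphaA0 | to] \isog [set: W].
Proof.
have inj_w : ('injm wreath_morphism)%g by apply/injmP => u v _ _; apply: wreath_perm_inj.
suff -> : 'C_G[gauge_class alphaA0 | to]%g = (wreath_morphism @* [set: W])%g.
  by rewrite isog_sym; apply: sub_isog inj_w.
apply/esym/eqP; rewrite eqEcard card_stabiliser (card_injm inj_w) // card_wreath leqnn andbT.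
apply/subsetP => _ /morphimP[u _ _ ->]; apply/setIP; split; first exact: in_setT.
apply/astab1P; rewrite alphaA0_class class_actionE relabel_omega /= wreath_perm_A0.
by case: ifP => _; rewrite ?omegaC.
Qed.

End BlockStabiliser.

Theorem theorem1p1 (d : nat) (hd : (3 <= d)%N) :
  (exists G : sgraph,
     [/\ connected_graph G, #|G| = (2 * 'C(3 * d + 1, d))%N
       & locally (kneser 'I_(2 * d + 1) d) G])
  /\
  (forall (Omega : finType) (A : {set Omega}), #|Omega| = (3 * d + 1)%N ->
     let a' := minn #|A| (3 * d + 1 - #|A|)%N in
     let A' := if (2 * #|A| <= 3 * d + 1)%N then A else ~: A in
     exists Z B : {vspace voltage (kneser Omega d)},
     [/\ forall alpha, alpha \in Z <->
           [/\ local_nbhd_preserving alpha, loopless A alpha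
             & type_invariant A alpha],
         forall alpha, alpha \in B <-> type_switching A alpha,
         (B <= Z)%VS,
         (\dim {: subquot Z B})%:R = coefz (gauss_binomial d 3) (a'%:Z - 5)
       & (forall c : subquot Z B, exists! alpha : subvs_of Z,
            subclass B alpha = c /\
            vanishes_on A' (tree_pair d a') (vsval alpha))
         /\
         exists2 phi : {linear subquot Z B -> {ffun triple d a' -> ('F_2)^o}},
           bijective phi &
           forall t : triple d a',
             (exists S S' : kneser Omega d,
                adj S S' /\ has_types A' S S' (triple_i t) (triple_j t))
             /\
             forall alpha : subvs_of Z,
               vanishes_on A' (tree_pair d a') (vsval alpha) ->
               forall S S' : kneser Omega d,
                 adj S S' -> has_types A' S S' (triple_i t) (triple_j t) ->
                 phi (subclass B alpha) t = volt (vsval alpha) S S'])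
  /\
  (forall n : nat, (2 * d + 2 <= n <= 3 * d)%N ->
     forall (Omega : finType) (A : {set Omega}), #|Omega| = (n + d)%N ->
     forall alpha : voltage (kneser Omega d),
       loopless A alpha -> type_invariant A alpha ->
       local_nbhd_preserving alpha -> type_gauge_equiv A alpha 0)
  /\
  (let K := kneser 'I_10 3 in
   [/\ #|gauge_classes K| = (2 ^ 42)%N,
       exists Phi : {set voltage K} -> H1 K,
         [/\ {in gauge_classes K &, injective Phi},
             forall h : H1 K, exists2 c, c \in gauge_classes K & Phi c = h
           & forall alpha : voltage K, local_nbhd_preserving alpha ->
               exists2 z : subvs_of (cocycles1 K), vsval z = alpha &
                 Phi (gauge_class alpha) = subclass (coboundaries1 K) z],
       \dim {: H1 K} = 42%N
     & forall c, c \in gauge_classes K -> forall alpha, alpha \in c ->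
         (~~ connected_graph (lift_graph alpha) <-> c = gauge_class 0)])
  /\
  (let K := kneser 'I_10 3 in
   let orbits := [set orbit (class_action 'I_10 3) [set: 'S_10] c
                 | c in gauge_classes K] in
   #|orbits| = (1245 * 1000 + 395)%N /\
   #|[set O in orbits | [forall c in O, forall alpha in c,
        connected_graph (lift_graph alpha)]]| = (1245 * 1000 + 394)%N)
  /\
  [/\ local_nbhd_preserving alphaA0,
      #|lift_graph alphaA0| = 240%N,
      #|orbit (class_action 'I_10 3) [set: 'S_10] (gauge_class alphaA0)| = 126%N
    & 'C_([set: 'S_10])[gauge_class alphaA0 | class_action 'I_10 3]
        \isog [set: wreath2 'S_5]].
Proof.
split; first exact: exists_locally_kneser.
split; first by move=> Omega A cardO; apply: type_invariant_classes.
split; first by move=> n; apply: type_invariant_rigid.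
split.
  split; [exact: card_gauge_classes_ten| |exact: dim_H1_ten|].
    exists (@class_of_gauge _); split; [exact: class_of_gauge_inj|exact: class_of_gauge_surj|].
    exact: class_of_gaugeE.
  by move=> c cK alpha; apply: disconnected_gauge_class cK; apply: connected_ten.
split; first by split; [exact: card_orbits_ten|exact: card_connected_orbits_ten].
split; [exact: lnp_alphaA0|exact: card_lift_alphaA0|exact: card_orbit_block|].
exact: stabiliser_isog.
Qed.
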